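(* Consider the block energy arrival model with energy block length $L=L_n$ satisfying $L=o(n)$. Let $\varepsilon\in(0,1/2)$ and let $\varepsilon_1>0$, $\varepsilon_2>0$ satisfy $\varepsilon_1+\varepsilon_2=\varepsilon$. For each $n$ define $$\rho=\frac{\sqrt{(P+1)(L\,\mathbb{E}[E^2]+3P^2)\log(1+P)\log\frac1{\varepsilon_2}}}{P\sqrt{2nP}}=\Theta\!\left(\sqrt{\frac Ln}\right),\qquad S=(1-\rho)P,$$ $$\alpha=\frac{2\rho P}{L\,\mathbb{E}[E^2]+3S^2},\qquad\beta=\frac{\alpha}{1+63\alpha S},\qquad mL=L\left\lceil\frac{\log\frac1{\varepsilon_2}}{LP\beta+\frac{L^2\alpha^2\mathbb{E}[E^2]}{2}}\right\rceil=\Theta(\sqrt{nL}).$$ Then there exists a constant $\kappa>0$ not depending on $n$ such that for all sufficiently large $n$ there is a blockwise save-and-transmit $(n,M,\varepsilon)$-EH code, with average transmit power (codeword symbol variance) $S$ and saving phase of length $mL$, that satisfies $$\frac1n\log M\ge\frac12\log(1+P)-\sqrt{\frac{(L\,\mathbb{E}[E^2]+3P^2)\log(1+P)\log\frac1{\varepsilon_2}}{2nP(P+1)}}+\sqrt{\frac{P}{(P+1)n}}\,\Phi^{-1}(\varepsilon_1)-\kappa\max\left\{\frac{L^{1/4}}{n^{3/4}},\frac Ln\right\}.$$ In particular, the probability of seeing a mismatch event in the transmission phase is bounded as $$\mathbb{P}\left\{\bigcup_{k=mL+1}^n\left\{\sum_{i=1}^kE_i<\sum_{i=mL+1}^kX_i^2\right\}\right\}\le\varepsilon_2,$$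 where $X_1,\dots,X_n$ are the symbols of the chosen message's codeword (i.i.d. $\mathcal{N}(0,S)$, independent of the energy arrivals).
   Context: Logarithms are natural; $\Phi$ is the standard normal cdf; $\mathcal{N}(\mu,\sigma^2)$ denotes the normal law or its density; $\|\cdot\|$ is the Euclidean norm; $\Theta(\cdot)$, $o(\cdot)$ are with respect to $n\to\infty$. Block energy arrivals. $E$ is a non-negative random variable with $0<P=\mathbb{E}[E]$ and $\mathbb{E}[E^2]<\infty$. Let the natural number $L$ be the energy block length (it may depend on $n$) and $b_\ell=(\ell-1)L$ for $\ell\in\mathbb{N}$. The variables $E_{b_\ell+1}$, $\ell\in\mathbb{N}$, are i.i.d. copies of $E$, and $E_{b_\ell+1}=E_{b_\ell+2}=\dots=E_{b_\ell+L}$ for every $\ell$. Channel and codes. The channel is $Y_k=X_k+Z_k$ with $Z_1,Z_2,\dots$ i.i.d. $\mathcal{N}(0,1)$, independent of messages, codebook and energy. An $(n,M)$-EH code has a message $W$ uniform on $\{1,\dots,M\}$, encoders producing the time-$k$ input from $(W,E_1,\dots,E_k)$ such that almost surely $\sum_{i=1}^kX_i^2\le\sum_{i=1}^kE_i$ for all $k\le n$, and a decoder $\varphi$ producing an estimate of $W$ from the $n$ channel outputs only. It is an $(n,M,\varepsilon)$-EH code if its average probability of decoding error is at most $\varepsilon$. Blockwise save-and-transmit $(n,M)$-EH code with saving phase of $m$ blocks (length $mL$) and variance $S\in(0,P)$. For each message $w$, the codeword $X^n(w)$ has i.i.d. $\mathcal{N}(0,S)$ entries; codewords are mutually independent and independent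 of $W$, the energy arrivals and the noise. Let $\bar n=\lceil n/L\rceil$. For $\ell=1,\dots,\bar n$ the transmitted block $f_\ell=(\tilde X_{b_\ell+1}(w),\dots,\tilde X_{\min\{b_\ell+L,n\}}(w))$ is defined recursively: if $\ell>m$ and $\sum_{k=b_\ell+1}^{\min\{b_\ell+L,n\}}X_k(w)^2\le\sum_{k=1}^{b_\ell+1}E_k-\sum_{i=1}^{\ell-1}\|f_i\|^2$, then $f_\ell=(X_{b_\ell+1}(w),\dots,X_{\min\{b_\ell+L,n\}}(w))$; otherwise $f_\ell$ is the all-zero block. The received symbols are $\tilde Y_k(W)=\tilde X_k(W)+Z_k$. For a threshold $\log\xi$ (a free design parameter of the code), the decoder outputs $j$ if $j$ is the unique message with $\sum_{k=mL+1}^n\log\frac{q_{Y|X}(\tilde Y_k(W)|X_k(j))}{p_Y(\tilde Y_k(W))}\ge\log\xi$, where $q_{Y|X}(\cdot|x)=\mathcal{N}(x,1)$ and $p_Y=\mathcal{N}(0,S+1)$; otherwise it outputs a uniformly random message. All probabilities are taken jointly over the random codebook, $W$, the energy arrivals, the noise, and the decoder's randomization. *)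

(* Defs.v *)
From HB Require Import structures.
From mathcomp Require Import all_boot all_order all_algebra.
From mathcomp Require Import all_classical all_reals all_analysis.

Set Implicit Arguments.
Unset Strict Implicit.
Unset Printing Implicit Defensive.

Import Order.TTheory GRing.Theory Num.Theory.
Import numFieldNormedType.Exports.
Local Open Scope classical_set_scope.
Local Open Scope ring_scope.

(* Time instants and blocks are numbered from 0: instant [k] is the (k+1)-st
   channel use, and block [l] consists of the instants
   l L, ..., min((l + 1) L, n) - 1, so that instant [k] is in block [k %/ L]. *)

Definition Phi {R : realType} (x : R) : R :=
  fine (normal_prob 0 1 `]-oo, x]).

(* For p in (0, 1), the point returned is the unique solution of Phi x = p. *)
Definition Phi_inv {R : realType} (p : R) : R :=
  xget 0 [set x | Phi x = p].

Definition has_law {R : realType} {d} {Omega : measurableType d}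
    {Pr : probability Omega R} (X : {RV Pr >-> R}) (mu : set R -> \bar R) :=
  forall B : set R, measurable B -> distribution Pr X B = mu B.

(* Mutual independence of a family of classes of events. *)
Definition independent_classes {R : realType} {d} {Omega : measurableType d}
    (Pr : probability Omega R) (I : Type) (F : I -> set (set Omega)) :=
  forall (N : nat) (i : 'I_N -> I) (A : 'I_N -> set Omega),
    injective i -> (forall j, F (i j) (A j)) ->
    Pr (\bigcap_j A j) = (\prod_(j < N) Pr (A j))%E.

(* A code with shared randomness in [C] (such as a random codebook) and private
   decoder randomness in [U].  The type of [encoder] makes it causal: the input
   at instant [k] depends on the energy arrivals at instants 0, ..., k only. *)
Record eh_code (R : realType) (n M : nat) (C U : Type) := EHCode {
  encoder : forall k : 'I_n, C -> 'I_M -> ('I_k.+1 -> R) -> R;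
  decoder : C -> U -> ('I_n -> R) -> 'I_M }.

Arguments encoder {R n M C U} code k _ _ _ : rename.

Section eh_code_operation.
Context {R : realType} {n M : nat} {C U : Type}.
Context {d : measure_display} {Omega : measurableType d}.
Variables (Pr : probability Omega R) (code : eh_code R n M C U).
Variables (E Z : nat -> {RV Pr >-> R}) (W : Omega -> 'I_M).
Variables (c : Omega -> C) (u : Omega -> U).

Definition channel_input (k : 'I_n) (omega : Omega) : R :=
  encoder code k (c omega) (W omega) (fun i => E i omega).

Definition channel_output (k : 'I_n) (omega : Omega) : R :=
  channel_input k omega + Z k omega.

Definition decoding_error : set Omega :=
  [set omega | decoder code (c omega) (u omega)
                 (fun k => channel_output k omega) <> W omega].

(* The second clause is the average probability of error when [W] is uniform on
   the messages, a hypothesis that [ensemble] below provides. *)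
Definition is_eh_code (eps : R) : Prop :=
  {ae Pr, forall omega, forall k : 'I_n,
     \sum_(i < n | (i <= k)%N) channel_input i omega ^+ 2
       <= \sum_(i < k.+1) E i omega} /\
  (Pr decoding_error <= eps%:E)%E.

End eh_code_operation.

Section save_and_transmit.
Context {R : realType}.
Variables (n M L m : nat) (S xi : R).

Definition block_sqnorm (x : 'I_n -> R) (l : nat) : R :=
  \sum_(k < n | (k %/ L == l)%N) x k ^+ 2.

Definition harvested (j : nat) (e : 'I_j -> R) (l : nat) : R :=
  \sum_(i < j | (i <= l * L)%N) e i.

Definition sendable j (e : 'I_j -> R) (x : 'I_n -> R) (l : nat) (s : R) : bool :=
  (m <= l)%N && (block_sqnorm x l <= harvested e l - s).

(* The energy of the blocks transmitted before block [l], that is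
   the sum of |f_i|^2 over i < l. *)
Fixpoint spent j (e : 'I_j -> R) (x : 'I_n -> R) (l : nat) : R :=
  if l is l'.+1 then
    spent e x l' +
    (if sendable e x l' (spent e x l') then block_sqnorm x l' else 0)
  else 0.

Definition st_encoder (k : 'I_n) (c : 'I_M -> 'I_n -> R) (w : 'I_M)
    (e : 'I_k.+1 -> R) : R :=
  let l := (k %/ L)%N in
  if sendable e (c w) l (spent e (c w) l) then c w k else 0.

Definition st_score (c : 'I_M -> 'I_n -> R) (y : 'I_n -> R) (j : 'I_M) : R :=
  \sum_(k < n | (m * L <= k)%N)
     ln (normal_pdf (c j k) 1 (y k) / normal_pdf 0 (Num.sqrt (S + 1)) (y k)).

Definition st_decoder (c : 'I_M -> 'I_n -> R) (u : 'I_M) (y : 'I_n -> R) : 'I_M :=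
  if [pick j | [forall i, (ln xi <= st_score c y i) == (i == j)]] is Some j
  then j else u.

Definition save_and_transmit : eh_code R n M ('I_M -> 'I_n -> R) 'I_M :=
  EHCode (fun k => @st_encoder k) st_decoder.

End save_and_transmit.

Variant source (n M : nat) : Type :=
  | block_source of nat
  | noise_source of nat
  | symbol_source of 'I_M & 'I_n
  | message_source
  | guess_source.

(* The joint probabilistic model under which a save-and-transmit code operates;
   [guess] is the message that the decoder outputs in the absence of a unique
   candidate. *)
Record ensemble {R : realType} {d0 : measure_display}
    {Omega0 : measurableType d0} {Pr0 : probability Omega0 R}
    (E : {RV Pr0 >-> R}) (n M L : nat) (S : R)
    {d : measure_display} {Omega : measurableType d}
    (Pr : probability Omega R) := Ensemble {
  energy : nat -> {RV Pr >-> R};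
  noise : nat -> {RV Pr >-> R};
  codebook : 'I_M -> 'I_n -> {RV Pr >-> R};
  message : Omega -> 'I_M;
  guess : Omega -> 'I_M;
  energy_block : forall k omega, energy k omega = energy (k %/ L * L)%N omega;
  energy_law : forall l, has_law (energy (l * L)%N) (distribution Pr0 E);
  noise_law : forall k, has_law (noise k) (normal_prob 0 1);
  codebook_law : forall w k, has_law (codebook w k) (normal_prob 0 (Num.sqrt S));
  message_measurable : forall w, measurable (message @^-1` [set w]);
  message_law : forall w, Pr (message @^-1` [set w]) = (M%:R^-1)%:E;
  guess_measurable : forall w, measurable (guess @^-1` [set w]);
  guess_law : forall w, Pr (guess @^-1` [set w]) = (M%:R^-1)%:E;
  ensemble_independent : independent_classes Pr (fun s : source n M =>
    match s with
    | block_source l => preimage_set_system setT (energy (l * L)%N) measurable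
    | noise_source k => preimage_set_system setT (noise k) measurable
    | symbol_source w k => preimage_set_system setT (codebook w k) measurable
    | message_source => preimage_set_system setT message setT
    | guess_source => preimage_set_system setT guess setT
    end) }.

Arguments save_and_transmit {R} n M L m S xi.

Section ensemble_events.
Context {R : realType} {d0 : measure_display} {Omega0 : measurableType d0}
  {Pr0 : probability Omega0 R} {E : {RV Pr0 >-> R}} {n M L : nat} {S : R}
  {d : measure_display} {Omega : measurableType d} {Pr : probability Omega R}.
Variable X : ensemble E n M L S Pr.

Definition is_save_and_transmit_code (m : nat) (xi eps : R) : Prop :=
  is_eh_code (save_and_transmit n M L m S xi) (energy X) (noise X) (message X)
    (fun omega w k => codebook X w k omega) (guess X) eps.

Definition mismatch (m : nat) : set Omega :=
  [set omega | exists k : 'I_n, (m * L <= k)%N /\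
    \sum_(i < k.+1) energy X i omega <
    \sum_(i < n | (m * L <= i <= k)%N)
       codebook X (message X omega) i omega ^+ 2].

End ensemble_events.

(* Main.v *)
(* The exponent alpha is tuned to the second moments l E[E^2] + 3 S^2, which
   exceed the variances l Var(E) + 2 S^2 that really matter.  A Chernoff bound
   with a slightly larger exponent, combined with a maximal inequality over the
   blocks, therefore bounds the mismatch probability by eps2 - delta for a constant
   delta > 0.  Spending delta on decoding makes a Berry-Esseen estimate
   unnecessary: a rotation turns the centred information density into a sum of
   products U_k V_k of independent standard normals, which conditionally on (U_k)
   is normal with variance sum U_k^2, and that sum is at most (1 + eta) n up to an
   exponentially small probability. *)

Require Import Defs.
From HB Require Import structures.
From mathcomp Require Import all_boot all_order all_algebra.
From mathcomp Require Import all_classical all_reals all_analysis.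
From mathcomp Require Import measurable_realfun.
From mathcomp Require Import ring lra.
Import Order.TTheory GRing.Theory Num.Theory.
Import numFieldNormedType.Exports.
Local Open Scope classical_set_scope.
Local Open Scope ring_scope.

(** * Gaussian integrals *)

(** The transmitted signal depends on the energy state, which destroys independence between
    instants. Decoding is therefore analysed on an ideal output, in which every block after the
    saving phase is sent; it agrees with the true output unless some codeword block costs more than
    the energy left at its start (an overdraft). An error is then an overdraft, a missed threshold
    or a confusion, with budgets [eps2 - delta], [eps1 + delta / 2] and [delta / 2]. The last budget
    fixes the number of messages as the floor of [xi * (delta / 2)], a constant factor that costs
    O(1/n) in rate. The penalty [rho * P / (P + 1)] splits into equal halves: one from replacing [P]
    by [S] in the logarithm, one from the silent saving phase. The stated [rho] balances the two;
    the other losses are O(L/n). Of the arrivals of a block only the first is known when the block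
    starts, so block l is paid from the arrivals of the blocks before it. This lag leaves [m - 1]
    instead of [m] saved blocks in the Chernoff bound; as [m] grows without bound, the enlarged
    exponent absorbs the difference. *)

Section pushforward_measure.
Context {d d'} {T1 : measurableType d} {T2 : measurableType d'} {R : realType}.

Definition push_measure (mu : {measure set T1 -> \bar R}) (f : T1 -> T2)
  (mf : measurable_fun [set: T1] f) : {measure set T2 -> \bar R}.
Proof. by refine (pushforward mu f : {measure set T2 -> \bar R}); exact: mf. Defined.

Definition pack_mfun (f : T1 -> T2) (mf : measurable_fun [set: T1] f) :
  {mfun T1 >-> T2} := HB.pack f (isMeasurableFun.Build _ _ _ _ f mf).

End pushforward_measure.

Section lebesgue_affine.
Context {R : realType}.
Local Notation mu := (@lebesgue_measure R).

Lemma measurable_affine (a b : R) : measurable_fun [set: R] (fun x : R => a * x + b).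
Proof. by apply: measurable_funD => //; exact: measurable_funM. Qed.

Let affine_measure (a b : R) : {measure set (measurableTypeR R) -> \bar R} :=
  mscale (NngNum (normr_ge0 a)) (@push_measure _ _ (measurableTypeR R) (measurableTypeR R) R mu _ (measurable_affine a b)).

(** The scaled pushforward of [mu] has the Lebesgue value on every interval []x, y]], and these
    values determine the measure. A negative [a] moves the closed end of the preimage to the other
    side, which leaves its length unchanged. *)
Lemma lebesgue_measure_affine (a b : R) (A : set R) : a != 0 -> measurable A ->
  (`|a|%:E * mu ((fun x => (a * x + b)%R) @^-1` A) = mu A)%E.
Proof.
move=> a0 mA; rewrite -[LHS]/(affine_measure a b A).
apply/esym; apply: (@lebesgue_measure_unique R (affine_measure a b) _ A mA).
move=> X [[x y] _ <-] /=.
have an : 0 < `|a| by rewrite normr_gt0.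
rewrite lebesgue_measure_itv/= lte_fin /mscale/= /pushforward.
have [ap|an0] := ltP 0 a.
  have -> : (fun x0 : R => a * x0 + b) @^-1` `]x, y]%classic = `](x - b) / a, (y - b) / a]%classic.
    apply/seteqP; split => t /=; rewrite !in_itv/= ltr_pdivrMr// ler_pdivlMr//;
    by move=> /andP[h1 h2]; apply/andP; split; lra.
  rewrite lebesgue_measure_itv/= lte_fin ltr_pM2r ?invr_gt0// ltrD2r.
  case: ifPn => _; last by rewrite mule0.
  by rewrite gtr0_norm// -!EFinD -EFinM; congr (_%:E); field.
have {}an0 : a < 0 by rewrite lt_neqAle a0.
have -> : (fun x0 : R => a * x0 + b) @^-1` `]x, y]%classic = `[(y - b) / a, (x - b) / a[%classic.
  apply/seteqP; split => t /=; rewrite !in_itv/= ler_ndivrMr// ltr_ndivlMr//;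
  by move=> /andP[h1 h2]; apply/andP; split; lra.
rewrite lebesgue_measure_itv/= lte_fin ltr_nM2r ?invr_lt0// ltrD2r.
case: ifPn => _; last by rewrite mule0.
by rewrite ltr0_norm// -!EFinD -EFinM; congr (_%:E); field.
Qed.

Lemma ge0_integral_affine (a b : R) (h : R -> \bar R) : a != 0 ->
  measurable_fun [set: R] h -> (forall x, 0 <= h x)%E ->
  (\int[mu]_x h x = `|a|%:E * \int[mu]_x h (a * x + b)%R)%E.
Proof.
move=> a0 mh h0.
rewrite -(@ge0_integral_pushforward _ _ (measurableTypeR R) (measurableTypeR R) R
  _ (measurable_affine a b) mu setT h)//.
rewrite -[X in (X%:E * _)%E]/((NngNum (normr_ge0 a))%:num).
rewrite -[in RHS](@ge0_integral_mscale _ _ _ (@push_measure _ _ (measurableTypeR R) (measurableTypeR R) R mu _ (measurable_affine a b)))//.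
by apply: eq_measure_integral => A mA _; exact/esym/lebesgue_measure_affine.
Qed.
End lebesgue_affine.

Section normal_integral.
Context {R : realType}.
Local Notation mu := (@lebesgue_measure R).

(** The Radon-Nikodym derivative of [normal_prob] and the density have the same integral over every
    measurable set, so they agree almost everywhere and one may replace the other. *)
Lemma ge0_integral_normal (m s : R) (h : R -> \bar R) :
  measurable_fun [set: R] h -> (forall x, 0 <= h x)%E ->
  (\int[normal_prob m s]_x h x = \int[mu]_x (h x * (normal_pdf m s x)%:E))%E.
Proof.
move=> mh h0.
have dom := normal_prob_dominates m s.
rewrite -(Radon_Nikodym_SigmaFinite.change_of_variables dom)//.
have mpdf : measurable_fun [set: R] (EFin \o normal_pdf m s).
  by apply/measurable_EFinP; exact: measurable_normal_pdf.
have intRN := Radon_Nikodym_SigmaFinite.f_integrable dom.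
apply: ae_eq_integral => //.
- by apply: emeasurable_funM => //; exact: measurable_int intRN.
- exact: emeasurable_funM.
- apply: ae_eqe_mul2l; apply: integral_ae_eq => //.
  by move=> E _ mE; rewrite -Radon_Nikodym_SigmaFinite.f_integral.
Qed.

Definition measurableTypeR_id : measurableTypeR R -> R := idfun.

Let measurableTypeR_id_measurable : measurable_fun [set: measurableTypeR R] measurableTypeR_id.
Proof. exact: measurable_id. Qed.

HB.instance Definition _ := isMeasurableFun.Build _ _ _ _ measurableTypeR_id measurableTypeR_id_measurable.

(* [normal_prob], whose domain is the type [measurableTypeR R] carrying the
   Lebesgue measure, transported to [R] with its canonical measurable structure. *)
Definition gauss (m s : R) : probability R R := distribution (normal_prob m s) measurableTypeR_id.

Lemma gaussE (m s : R) (A : set R) : gauss m s A = normal_prob m s A.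
Proof. by []. Qed.

Lemma ge0_integral_gauss (m s : R) (h : R -> \bar R) :
  measurable_fun [set: R] h -> (forall x, 0 <= h x)%E ->
  (\int[gauss m s]_x h x = \int[mu]_x (h x * (normal_pdf m s x)%:E))%E.
Proof.
by move=> mh h0; rewrite ge0_integral_distribution// -ge0_integral_normal.
Qed.

End normal_integral.

Section measurable_partial_integral.
Context {d1 d2} {T1 : measurableType d1} {T2 : measurableType d2} {R : realType}.

Lemma measurable_integral_fst (m2 : {sigma_finite_measure set T2 -> \bar R})
    (f : T1 -> T2 -> \bar R) :
  measurable_fun [set: T1 * T2] (fun x => f x.1 x.2) ->
  (forall x y, 0 <= f x y)%E ->
  measurable_fun [set: T1] (fun x => \int[m2]_y f x y)%E.
Proof.
move=> mf f0.
exact: (measurable_fun_fubini_tonelli_F (fun x => f x.1 x.2) mf (fun=> f0 _ _)).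
Qed.

Lemma measurable_integral_snd (m1 : {sigma_finite_measure set T1 -> \bar R})
    (f : T1 -> T2 -> \bar R) :
  measurable_fun [set: T1 * T2] (fun x => f x.1 x.2) ->
  (forall x y, 0 <= f x y)%E ->
  measurable_fun [set: T2] (fun y => \int[m1]_x f x y)%E.
Proof.
move=> mf f0.
exact: (measurable_fun_fubini_tonelli_G (fun x => f x.1 x.2) mf (fun=> f0 _ _)).
Qed.

Lemma tonelli (m1 : {sigma_finite_measure set T1 -> \bar R})
    (m2 : {sigma_finite_measure set T2 -> \bar R}) (f : T1 -> T2 -> \bar R) :
  measurable_fun [set: T1 * T2] (fun x => f x.1 x.2) ->
  (forall x y, 0 <= f x y)%E ->
  (\int[m1]_x \int[m2]_y f x y = \int[m2]_y \int[m1]_x f x y)%E.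
Proof.
move=> mf f0.
exact: (fubini_tonelli (fun x => f x.1 x.2) mf (fun=> f0 _ _)).
Qed.

End measurable_partial_integral.

Section reflection.
Context {R : realType}.
Local Notation mu := (@lebesgue_measure R).

Lemma measurable_fun_pair_comp d (T : measurableType d) d' (T' : measurableType d')
    (h : R * R -> T') (f g : T -> R) :
  measurable_fun [set: R * R] h -> measurable_fun [set: T] f ->
  measurable_fun [set: T] g -> measurable_fun [set: T] (fun x => h (f x, g x)).
Proof.
by move=> mh mf mg; apply: (measurableT_comp mh); exact: measurable_fun_pair.
Qed.

(** Two affine substitutions in one variable replace a planar Jacobian formula: [u = c * g + s * z]
    for fixed [z], then [v = (s * u - z) / c] for fixed [u]. Their factors [|c|] and [1 / |c|]
    cancel. *)
Lemma ge0_integral2_reflection (c s : R) (H : R * R -> \bar R) : c != 0 ->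
  c ^+ 2 + s ^+ 2 = 1 -> measurable_fun [set: R * R] H -> (forall x, 0 <= H x)%E ->
  (\int[mu]_g \int[mu]_z H (c * g + s * z, s * g - c * z)%R =
   \int[mu]_u \int[mu]_v H (u, v))%E.
Proof.
move=> c0 cs mH H0.
have mlin (a b : R) : measurable_fun [set: R * R] (fun x => a * x.1 + b * x.2).
  by apply: measurable_funD; apply: measurable_funM.
have mlin1 (a b : R) : measurable_fun [set: R] (fun x => a * x + b).
  exact: measurable_affine.
have Hk z g : H (c * g + s * z, s * g - c * z) =
    (fun u => H (u, (s * u - z) / c)) (c * g + s * z).
  congr (H (_, _)); apply: (mulIf c0); rewrite divfK//.
  have Ez : c ^+ 2 * z + s ^+ 2 * z = z by rewrite -mulrDl cs mul1r.
  rewrite -[RHS]/(s * (c * g + s * z) - z); lra.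
have mG : measurable_fun [set: R * R]
    (fun x => H (c * x.1 + s * x.2, s * x.1 - c * x.2)).
  apply: measurable_fun_pair_comp => //.
  by under eq_fun do rewrite -mulNr; exact: mlin.
have mK : measurable_fun [set: R * R] (fun x => H (x.1, (s * x.1 - x.2) / c)).
  apply: measurable_fun_pair_comp => //; apply: measurable_funM => //.
  by apply: measurable_funB => //; apply: measurable_funM.
have nc0 : (0 < `|c|%:E)%E by rewrite lte_fin normr_gt0.
rewrite (@fubini_tonelli _ _ _ _ _ mu mu (fun x => H (c * x.1 + s * x.2, s * x.1 - c * x.2)))//=.
have sub1 z : (\int[mu]_u H (u, (s * u - z) / c)%R =
    `|c|%:E * \int[mu]_g H (c * g + s * z, s * g - c * z)%R)%E.
  under [in RHS]eq_integral do rewrite Hk.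
  rewrite (ge0_integral_affine c (s * z) (fun u => H (u, (s * u - z) / c)) c0)//.
  apply: measurable_fun_pair_comp => //.
  have -> : (fun u => (s * u - z) / c) = (fun u => s / c * u + - z / c).
    by apply/funext => u; field.
  exact: measurable_affine.
have ic0 : - c^-1 != 0 by rewrite oppr_eq0 invr_eq0.
have sub2 u : (\int[mu]_v H (u, v) =
    `|c|^-1%:E * \int[mu]_z H (u, (s * u - z) / c)%R)%E.
  rewrite (ge0_integral_affine (- c^-1) (s * u / c) (fun v => H (u, v)) ic0)//; last first.
    exact: measurable_fun_pair_comp.
  rewrite normrN normfV; congr (_ * _)%E; apply: eq_integral => z _.
  by congr (H (_, _)); ring.
transitivity (`|c|^-1%:E * \int[mu]_z \int[mu]_u H (u, (s * u - z) / c)%R)%E.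
  rewrite -ge0_integralZl//; last 2 first.
  - by apply: (@measurable_integral_snd _ _ (measurableTypeR R) (measurableTypeR R) R mu (fun x y => H (x, (s * x - y) / c))).
  - by move=> z _; exact: integral_ge0.
  apply: eq_integral => z _; rewrite sub1 muleA -EFinM mulVf ?mul1e//.
  by rewrite normr_eq0.
rewrite -(@fubini_tonelli _ _ _ _ _ mu mu (fun x => H (x.1, (s * x.1 - x.2) / c)))//=.
rewrite -ge0_integralZl//; last 2 first.
- by apply: (@measurable_integral_fst _ _ (measurableTypeR R) (measurableTypeR R) R mu (fun x y => H (x, (s * x - y) / c))).
- by move=> z _; exact: integral_ge0.
by apply: eq_integral => u _; rewrite sub2.
Qed.

Local Notation gamma := (gauss (0:R) 1).

Lemma normal_pdf01E (x : R) :
  normal_pdf 0 1 x = normal_peak 1 * expR (- (x ^+ 2 / 2)).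
Proof.
rewrite normal_pdfE ?oner_eq0// /normal_fun subr0; congr (_ * expR _).
by rewrite expr1n mulNr.
Qed.

Lemma ge0_integral2_normal (h : R * R -> \bar R) :
  measurable_fun [set: R * R] h -> (forall x, 0 <= h x)%E ->
  (\int[gamma]_g \int[gamma]_z h (g, z) =
   \int[mu]_g \int[mu]_z (h (g, z) * (normal_pdf 0 1 g * normal_pdf 0 1 z)%:E))%E.
Proof.
move=> mh h0.
have mp : measurable_fun [set: R] (EFin \o normal_pdf (0:R) 1).
  by apply/measurable_EFinP; exact: measurable_normal_pdf.
have mhg g : measurable_fun [set: R] (fun z => h (g, z)).
  exact: measurable_fun_pair_comp.
have mh' : measurable_fun [set: R * R] (fun x => h (x.1, x.2)).
  by under eq_fun do rewrite -surjective_pairing.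
have mhp g : measurable_fun [set: R] (fun z => h (g, z) * (normal_pdf 0 1 z)%:E)%E.
  exact: emeasurable_funM.
rewrite ge0_integral_gauss//; last 2 first.
- exact: (@measurable_integral_fst _ _ R R R gamma (fun x y => h (x, y)) mh').
- by move=> g; exact: integral_ge0.
apply: eq_integral => g _.
rewrite ge0_integral_gauss// -ge0_integralZr//; last 3 first.
- exact: mhp.
- by move=> z _; rewrite mule_ge0// lee_fin normal_pdf_ge0.
- by rewrite lee_fin normal_pdf_ge0.
by apply: eq_integral => z _; rewrite -muleA -EFinM [(_ * normal_pdf 0 1 g)%R]mulrC.
Qed.

(** The product density is a function of [g ^+ 2 + z ^+ 2], which an orthogonal map preserves. *)
Lemma ge0_integral_normal_reflection (c s : R) (h : R * R -> \bar R) : c != 0 ->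
  c ^+ 2 + s ^+ 2 = 1 -> measurable_fun [set: R * R] h -> (forall x, 0 <= h x)%E ->
  (\int[gamma]_g \int[gamma]_z h (c * g + s * z, s * g - c * z)%R =
   \int[gamma]_u \int[gamma]_v h (u, v))%E.
Proof.
move=> c0 cs mh h0.
have mh' : measurable_fun [set: R * R] (fun x => h (c * x.1 + s * x.2, s * x.1 - c * x.2)).
  by apply: measurable_fun_pair_comp => //; [apply: measurable_funD|apply: measurable_funB]; apply: measurable_funM.
have mH : measurable_fun [set: R * R] (fun x => h x * (normal_pdf 0 1 x.1 * normal_pdf 0 1 x.2)%:E)%E.
  apply: emeasurable_funM => //; apply/measurable_EFinP.
  by apply: measurable_funM; apply: measurableT_comp => //; exact: measurable_normal_pdf.
have H0 x : (0 <= h x * (normal_pdf 0 1 x.1 * normal_pdf 0 1 x.2)%:E)%E.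
  by rewrite mule_ge0// lee_fin mulr_ge0// normal_pdf_ge0.
apply: (etrans (ge0_integral2_normal _ mh' (fun=> h0 _))).
apply: etrans (esym (ge0_integral2_normal _ mh h0)).
apply: (etrans _ (ge0_integral2_reflection c s _ c0 cs mH H0)).
apply: eq_integral => g _; apply: eq_integral => z _ /=; congr (_ * _%:E)%E.
rewrite !normal_pdf01E mulrACA -expRD [RHS]mulrACA -expRD; congr (_ * expR _).
have -> : (c * g + s * z) ^+ 2 = (c ^+ 2 + s ^+ 2) * (g ^+ 2 + z ^+ 2) - (s * g - c * z) ^+ 2 by ring.
rewrite cs; lra.
Qed.

End reflection.

Section gauss_theory.
Context {R : realType}.
Local Notation mu := (@lebesgue_measure R).

Lemma normal_pdfE_gt0 (m s x : R) : 0 < s ->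
  normal_pdf m s x = (s * Num.sqrt (pi *+ 2))^-1 * expR (- ((x - m) ^+ 2 / (s ^+ 2 * 2))).
Proof.
move=> s0; rewrite normal_pdfE ?gt_eqF// /normal_peak -mulrnAr sqrtrM ?sqr_ge0//.
by rewrite sqrtr_sqr gtr0_norm// /normal_fun mulNr mulr_natr.
Qed.

(** Tilting the density by [expR (t * x ^+ 2)] gives [w^-1] times the normal density of deviation
    [s / w], which integrates to 1. It serves both for the energy of a symbol and, with [s = 1], for
    the variance of the information density. *)
Lemma integral_gauss_sqr_expR (s t : R) : 0 < s -> t * s ^+ 2 * 2 < 1 ->
  (\int[gauss 0 s]_x (expR (t * x ^+ 2))%:E =
   ((Num.sqrt (1 - t * s ^+ 2 * 2))^-1)%:E)%E.
Proof.
move=> s0 ts; set w := Num.sqrt _.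
have w0 : 0 < w by rewrite sqrtr_gt0 subr_gt0.
have wE : w ^+ 2 = 1 - t * s ^+ 2 * 2 by rewrite sqr_sqrtr// subr_ge0 ltW.
have pi20 : 0 < Num.sqrt (pi *+ 2 : R) by rewrite sqrtr_gt0 mulrn_wgt0// pi_gt0.
have mE : measurable_fun [set: R] (fun x => (expR (t * x ^+ 2))%:E).
  apply/measurable_EFinP; apply: (measurableT_comp (@measurable_expR R)).
  by apply: measurable_funM => //; exact: measurable_funX.
rewrite ge0_integral_gauss//.
transitivity (\int[mu]_x (w^-1%:E * (normal_pdf 0 (s / w) x)%:E))%E.
  apply: eq_integral => x _; rewrite -!EFinM; congr (_%:E).
  rewrite !normal_pdfE_gt0 ?divr_gt0// !subr0.
  rewrite [LHS]mulrCA -expRD [RHS]mulrA -[w^-1 * _]invfM; congr (_^-1 * expR _).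
    by field; rewrite gt_eqF.
  have -> : (s / w) ^+ 2 * 2 = s ^+ 2 * 2 / (1 - t * s ^+ 2 * 2).
    by rewrite expr_div_n wE mulrAC.
  by field; rewrite (gt_eqF s0) -wE expf_neq0// gt_eqF.
rewrite ge0_integralZl//.
- by rewrite integral_normal_pdf mule1.
- by apply/measurable_EFinP; exact: measurable_normal_pdf.
- by move=> x _; rewrite lee_fin normal_pdf_ge0.
- by rewrite lee_fin invr_ge0 ltW.
Qed.

(** By Bayes' rule, the likelihood ratio times the prior density of [x] is the posterior density
    given [y]: normal with mean [s ^+ 2 * y / w ^+ 2] and deviation [s / w]. *)
Lemma integral_gauss_likelihood_ratio (s y : R) : 0 < s ->
  (\int[gauss 0 s]_x (normal_pdf x 1 y / normal_pdf 0 (Num.sqrt (s ^+ 2 + 1)) y)%:E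
   = 1)%E.
Proof.
move=> s0; set w := Num.sqrt _.
have w0 : 0 < w by rewrite sqrtr_gt0 ltr_wpDl// sqr_ge0.
have wE : w ^+ 2 = s ^+ 2 + 1 by rewrite sqr_sqrtr// addr_ge0// sqr_ge0.
have pi20 : 0 < Num.sqrt (pi *+ 2 : R) by rewrite sqrtr_gt0 mulrn_wgt0// pi_gt0.
have mE : measurable_fun [set: R]
    (fun x => (normal_pdf x 1 y / normal_pdf 0 w y)%:E).
  apply/measurable_EFinP; apply: measurable_funM => //.
  under eq_fun do rewrite normal_pdfE_gt0//.
  apply: measurable_funM => //; apply: (measurableT_comp (@measurable_expR R)).
  apply: measurableT_comp => //; apply: measurable_funM => //.
  by apply: measurable_funX; exact: measurable_funB.
rewrite ge0_integral_gauss//; last first.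
  by move=> x; rewrite lee_fin divr_ge0// normal_pdf_ge0.
rewrite -[RHS](integral_normal_pdf (s ^+ 2 * y / w ^+ 2) (s / w)).
apply: eq_integral => x _; rewrite -!EFinM; congr (_%:E).
rewrite !normal_pdfE_gt0 ?divr_gt0// !subr0.
set eA := expR (- ((y - x) ^+ 2 / _)); set eB := expR (- (y ^+ 2 / _)).
set eC := expR (- (x ^+ 2 / _)); set eD := expR _; set r := Num.sqrt _.
have r0 : r != 0 by rewrite gt_eqF.
have eB0 : eB != 0 by rewrite gt_eqF// expR_gt0.
have E : eA * eC = eD * eB.
  rewrite /eA /eC /eD /eB -!expRD; congr expR.
  rewrite expr_div_n wE.
  by field; rewrite (gt_eqF s0) gt_eqF// ltr_wpDl// sqr_ge0.
rewrite [LHS](_ : _ = w / (s * r) * (eA * eC) / eB); last first.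
  by field; rewrite r0 eB0 !gt_eqF.
rewrite E; field.
by rewrite r0 eB0 !gt_eqF.
Qed.

Lemma ge0_integral_gauss_scale (s : R) (h : R -> \bar R) : 0 < s ->
  measurable_fun [set: R] h -> (forall x, 0 <= h x)%E ->
  (\int[gauss 0 s]_x h x = \int[gauss 0 1]_x h (s * x)%R)%E.
Proof.
move=> s0 mh h0.
have sn0 : s != 0 by rewrite gt_eqF.
have ms : measurable_fun [set: R] (fun x => s * x) by exact: measurable_funM.
have mhs : measurable_fun [set: R] (fun x => h (s * x)) by exact: measurableT_comp.
pose k x := (h x * (normal_pdf 0 s x)%:E)%E.
have mk : measurable_fun [set: R] k.
  by apply: emeasurable_funM => //; apply/measurable_EFinP; exact: measurable_normal_pdf.
have k0 x : (0 <= k x)%E by rewrite mule_ge0// lee_fin normal_pdf_ge0.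
have mks : measurable_fun [set: R] (fun x => k (s * x + 0)).
  by apply: (measurableT_comp mk); exact: measurable_affine.
apply: (etrans (ge0_integral_gauss _ _ _ mh h0)).
apply: etrans (esym (ge0_integral_gauss _ _ _ mhs (fun=> h0 _))).
apply: (etrans (ge0_integral_affine s 0 k sn0 mk k0)).
have s0' : (0 <= `|s|%:E)%E by rewrite lee_fin.
apply: (etrans (esym (ge0_integralZl mu measurableT mks (fun _ _ => k0 _) s0'))).
apply: eq_integral => x _; rewrite /k addr0 muleCA -EFinM; congr (_ * _%:E)%E.
rewrite gtr0_norm// !normal_pdfE_gt0// !subr0 mul1r mulrA; congr (_ * expR (- _)).
  by rewrite invfM mulrA mulfV// mul1r.
by field.
Qed.

(** A normal variable of variance [q] plus an independent one of variance [u ^+ 2] is normal of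
    variance [q + u ^+ 2]: reflect along the unit vector [(u / r, Num.sqrt q / r)]. The reflection
    needs a nonzero first coordinate, hence the separate case [u = 0]. *)
Lemma ge0_integral_gauss_step (q u : R) (f : R * R -> \bar R) : 0 <= q ->
  measurable_fun [set: R * R] f -> (forall x, 0 <= f x)%E ->
  (\int[gauss 0 1]_v \int[gauss 0 1]_g f (q + u ^+ 2, u * v + Num.sqrt q * g)%R =
   \int[gauss 0 1]_g f (q + u ^+ 2, Num.sqrt (q + u ^+ 2) * g)%R)%E.
Proof.
move=> q0 mf f0; set r := Num.sqrt (q + _).
have [u0|u0] := eqVneq u 0.
  transitivity (\int[gauss 0 1]_(v in [set: R])
      \int[gauss 0 1]_g f (q + u ^+ 2, r * g)%R)%E.
    apply: eq_integral => v _; apply: eq_integral => g _.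
    by rewrite u0 mul0r add0r /r u0 expr0n/= addr0.
  by rewrite integral_cst//= probability_setT mule1.
have r2 : r ^+ 2 = q + u ^+ 2 by rewrite sqr_sqrtr// addr_ge0// sqr_ge0.
have r0 : 0 < r by rewrite sqrtr_gt0 ltr_wpDl// exprn_even_gt0.
have mfr : measurable_fun [set: R] (fun g => f (q + u ^+ 2, r * g)).
  by apply: measurable_fun_pair_comp => //; apply: measurable_funM.
have mh : measurable_fun [set: R * R] (fun x : R * R => f (q + u ^+ 2, r * x.1)).
  apply: (@measurable_fun_pair_comp R _ (R * R)%type _ _ f (fun=> q + u ^+ 2) (fun x => r * x.1)) => //.
  by apply: measurable_funM.
transitivity (\int[gauss 0 1]_v \int[gauss 0 1]_(g in [set: R]) f (q + u ^+ 2, r * v)%R)%E; last first.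
  by apply: eq_integral => v _; rewrite integral_cst//= probability_setT mule1.
rewrite -(ge0_integral_normal_reflection (u / r) (Num.sqrt q / r) (fun x => f (q + u ^+ 2, r * x.1)%R))//.
- apply: eq_integral => v _; apply: eq_integral => g _ /=.
  by congr (f (_, _)); field; rewrite gt_eqF.
- by rewrite mulf_neq0// invr_eq0 gt_eqF.
- rewrite !expr_div_n -mulrDl sqr_sqrtr// r2 addrC mulfV// -r2 expf_neq0// gt_eqF//.
Qed.

End gauss_theory.

(** * The normal distribution function *)

Section Phi_theory.
Context {R : realType}.
Local Notation mu := (@lebesgue_measure R).
Implicit Types x y p : R.

Lemma PhiE x : (Phi x)%:E = gauss 0 1 `]-oo, x]%classic.
Proof. by rewrite /Phi -gaussE fineK// fin_num_measure. Qed.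

Lemma Phi_nondecreasing : {homo @Phi R : x y / x <= y}.
Proof.
move=> x y xy; rewrite -lee_fin !PhiE; apply: le_measure; rewrite ?inE//.
by apply: subset_itvl; rewrite bnd_simp.
Qed.

Lemma PhiB_le x y : x <= y -> Phi y - Phi x <= normal_peak 1 * (y - x).
Proof.
move=> xy; rewrite lerBlDl -lee_fin EFinD !PhiE.
have -> : `]-oo, y]%classic = `]-oo, x]%classic `|` `]x, y]%classic.
  by rewrite -itv_bndbnd_setU// bnd_simp.
rewrite measureU//; last first.
  apply/seteqP; split => // t /= [].
  by rewrite !in_itv/= => tx /andP[]; rewrite ltNge tx.
apply: leeD2l; rewrite -[leLHS]/(normal_prob 0 1 `]x, y]%classic) /normal_prob.
have -> : (normal_peak 1 * (y - x))%:E = (\int[mu]_(t in `]x, y]) (normal_peak 1)%:E)%E.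
  rewrite integral_cst//= lebesgue_measure_itv/= lte_fin.
  have [xy'|] := ltP x y; first by rewrite EFinM EFinB.
  by move=> yx; have -> : x = y; [apply/le_anti/andP|rewrite subrr mulr0 mule0].
apply: ge0_le_integral => //=.
- by move=> t _; rewrite lee_fin normal_pdf_ge0.
- by apply/measurable_EFinP; apply: measurable_funTS; exact: measurable_normal_pdf.
- by move=> t _; rewrite lee_fin normal_pdf_ub// oner_eq0.
Qed.

Lemma Phi_continuous : continuous (@Phi R).
Proof.
have c0 : 0 < normal_peak 1 :> R by rewrite normal_peak_gt0// oner_eq0.
have lip x y : `|Phi x - Phi y| <= normal_peak 1 * `|x - y|.
  wlog : x y / x <= y => [hw|xy].
    by have [|/ltW] := leP x y; [exact: hw|rewrite distrC (distrC x); exact: hw].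
  rewrite distrC (distrC x) !ger0_norm ?subr_ge0//; last exact: Phi_nondecreasing.
  exact: PhiB_le.
move=> x; apply/cvgrPdist_lt => e e0; near=> t.
rewrite (le_lt_trans (lip _ _))// mulrC -ltr_pdivlMr//.
near: t; apply/nbhs_ballP; exists (e / normal_peak 1) => //=; exact: divr_gt0.
Unshelve. all: by end_near. Qed.

(** The half-lines on both sides of 0 cover the line and have equal mass by the symmetry
    [x -> - x]. *)
Lemma Phi0_ge : 1 / 2 <= Phi (0 : R).
Proof.
pose A : set R := `[0%R, +oo[%classic; pose B : set R := `]-oo, 0%R]%classic.
have mAs : measurable A by exact: measurable_itv.
have mBs : measurable B by exact: measurable_itv.
have le1 : (1 <= gauss (0:R) 1 B + gauss (0:R) 1 A)%E.
  rewrite -(probability_setT (gauss (0:R) 1)).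
  rewrite (_ : [set: R] = B `|` A); first exact: measureU2.
  apply/seteqP; split => // t _; rewrite /A /B /= !in_itv/= andbT.
  by have [|/ltW] := leP t 0; [left|right].
suff E : gauss (0:R) 1 A = gauss (0:R) 1 B.
  move: le1; rewrite E -[gauss _ _ B]PhiE -EFinD lee_fin; lra.
have m1 : -1 != 0 :> R by rewrite oppr_eq0 oner_eq0.
have mA : measurable_fun [set: R] (fun x : R => (\1_A x : R)%:E).
  by apply/measurable_EFinP; exact: measurable_indic.
have mB : measurable_fun [set: R] (fun x : R => (\1_B x : R)%:E).
  by apply/measurable_EFinP; exact: measurable_indic.
have E1 : (gauss (0:R) 1 A = \int[gauss (0:R) 1]_x (\1_A x)%:E)%E.
  by rewrite integral_indic// setIT.
have E2 : (gauss (0:R) 1 B = \int[gauss (0:R) 1]_x (\1_B x)%:E)%E.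
  by rewrite integral_indic// setIT.
rewrite E1 E2.
have ind0 (D : set R) x : (0 <= (\1_D x : R)%:E)%E by rewrite lee_fin.
apply: (etrans (ge0_integral_gauss _ _ _ mA (ind0 _))).
apply: etrans (esym (ge0_integral_gauss _ _ _ mB (ind0 _))).
pose k x := ((\1_A x)%:E * (normal_pdf 0 1 x)%:E)%E.
have mk : measurable_fun [set: R] k.
  by apply: emeasurable_funM => //; apply/measurable_EFinP; exact: measurable_normal_pdf.
have k0 x : (0 <= k x)%E by rewrite mule_ge0// lee_fin// normal_pdf_ge0.
apply: (etrans (ge0_integral_affine (-1) 0 k m1 mk k0)).
rewrite normrN1 mul1e; apply: eq_integral => x _; rewrite /k addr0 mulN1r.
rewrite !normal_pdf01E sqrrN; congr (_ * _)%E; congr (_%:E).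
rewrite !indicE; congr (_%:R); congr (nat_of_bool _).
by apply/idP/idP; rewrite !inE/A/B/= !in_itv/= andbT oppr_ge0.
Qed.

Lemma Phi_surj p : 0 < p < 1 -> exists x, Phi x = p.
Proof.
move=> /andP[p0 p1].
pose X : {RV gauss (0:R) 1 >-> R} := pack_mfun _ (@measurable_id _ R setT).
have cE x : cdf X x = (Phi x)%:E by rewrite PhiE.
have [a ap] : exists a, Phi a <= p.
  apply: contrapT => /forallNP nP.
  suff : (p%:E <= 0)%E by rewrite lee_fin leNgt p0.
  apply: (cvge_to_ge (@cvg_cdfNy0 _ _ _ _ X)); apply: nearW => x.
  by rewrite cE lee_fin ltW// ltNge; exact/negP/nP.
have [b pb] : exists b, p <= Phi b.
  apply: contrapT => /forallNP nP.
  suff : (1 <= p%:E)%E by rewrite lee_fin leNgt p1.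
  apply: (cvge_to_le (@cvg_cdfy1 _ _ _ _ X)); apply: nearW => x.
  by rewrite cE lee_fin ltW// ltNge; exact/negP/nP.
have [ab|ba] := leP a b; last first.
  exists b; apply/le_anti; rewrite pb andbT (le_trans _ ap)//.
  by apply: Phi_nondecreasing; exact: ltW.
have [||c _ <-] := @IVT R (@Phi R) a b p ab; last by exists c.
  by apply: continuous_subspaceT => x; exact: Phi_continuous.
by have ab' := le_trans ap pb; rewrite (min_l ab') (max_r ab') ap pb.
Qed.

Lemma Phi_invK p : 0 < p < 1 -> Phi (Phi_inv p) = p.
Proof.
by move=> /Phi_surj[x xp]; rewrite /Phi_inv; case: xgetP => // /(_ x)/(_ xp).
Qed.

Lemma Phi_inv_lt0 p : 0 < p < 1 / 2 -> Phi_inv p < 0.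
Proof.
move=> /andP[p0 p2]; rewrite ltNge; apply/negP => /Phi_nondecreasing.
rewrite Phi_invK; last by rewrite p0; lra.
by apply/negP; rewrite -ltNge (lt_le_trans p2)// Phi0_ge.
Qed.

End Phi_theory.

(** * Independent sources and a maximal inequality *)

Section independence.
Context {d} {Omega : measurableType d} {R : realType} (Pr : probability Omega R).

(** The restriction of [Pr] to [B] and the multiple of [Pr] by the probability of [B] are finite
    measures that agree on the pi-system [G], hence on the sigma-algebra it generates. *)
Lemma sigma_independent_left (G : set (set Omega)) (B : set Omega) :
  G `<=` measurable -> G setT -> setI_closed G -> measurable B ->
  (forall A, G A -> Pr (A `&` B) = (Pr A * Pr B)%E) ->
  forall A, <<s G >> A -> Pr (A `&` B) = (Pr A * Pr B)%E.
Proof.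
move=> Gm GT GI mB GB A sGA.
pose p : {nonneg R} := NngNum (fine_ge0 (measure_ge0 Pr B)).
have pE C : mscale p Pr C = (Pr C * Pr B)%E.
  by rewrite /mscale muleC/= fineK// fin_num_measure.
have E : mrestr Pr mB A = mscale p Pr A.
  apply: (g_sigma_algebra_measure_unique G Gm (fun=> setT)) => //.
  - by rewrite bigcup_const.
  - by move=> C GC; apply: (etrans (GB C GC)); exact/esym/pE.
  - move=> _; apply: (le_lt_trans _ (ltry 1)).
    exact: (probability_le1 Pr (measurableI _ _ measurableT mB)).
exact: (etrans E (pE A)).
Qed.

Lemma sigma_independent (G1 G2 : set (set Omega)) :
  G1 `<=` measurable -> G1 setT -> setI_closed G1 ->
  G2 `<=` measurable -> G2 setT -> setI_closed G2 ->
  (forall A B, G1 A -> G2 B -> Pr (A `&` B) = (Pr A * Pr B)%E) ->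
  forall A B, <<s G1 >> A -> <<s G2 >> B -> Pr (A `&` B) = (Pr A * Pr B)%E.
Proof.
move=> G1m G1T G1I G2m G2T G2I G12 A B sA sB.
have mA : measurable A by apply: sA; split; [exact: sigma_algebra_measurable|].
rewrite setIC muleC; apply: (sigma_independent_left G2) => // C G2C.
rewrite setIC muleC; apply: (sigma_independent_left G1) => //; first exact: G2m.
by move=> D G1D; exact: G12.
Qed.

(** Independence says that the joint law of [(X, Y)] is the product measure; Tonelli's theorem then
    separates the two integrals. *)
Lemma ge0_integral_pair d1 d2 (T1 : measurableType d1) (T2 : measurableType d2)
    (X : Omega -> T1) (Y : Omega -> T2) (h : T1 * T2 -> \bar R) :
  measurable_fun [set: Omega] X -> measurable_fun [set: Omega] Y ->
  (forall A B, measurable A -> measurable B ->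
    Pr (X @^-1` A `&` Y @^-1` B) = (Pr (X @^-1` A) * Pr (Y @^-1` B))%E) ->
  measurable_fun [set: T1 * T2] h -> (forall x, 0 <= h x)%E ->
  (\int[Pr]_t h (X t, Y t) = \int[Pr]_t \int[Pr]_u h (X t, Y u))%E.
Proof.
move=> mX mY XY mh h0.
have mXY : measurable_fun [set: Omega] (fun t => (X t, Y t)).
  exact: measurable_fun_pair.
pose XM := pack_mfun _ mX; pose YM := pack_mfun _ mY; pose XYM := pack_mfun _ mXY.
transitivity (\int[distribution Pr XYM]_x h x)%E.
  by rewrite ge0_integral_distribution.
transitivity (\int[(distribution Pr XM \x distribution Pr YM)%E]_x h x)%E.
  apply: eq_measure_integral => A mA _; apply/esym.
  exact: product_measure_unique.
rewrite fubini_tonelli1// /fubini_F.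
have mF : measurable_fun [set: T1] (fun x => \int[distribution Pr YM]_y h (x, y))%E.
  exact: (measurable_fun_fubini_tonelli_F h mh h0).
rewrite ge0_integral_distribution//; last by move=> x; exact: integral_ge0.
apply: eq_integral => t _ /=; rewrite ge0_integral_distribution//.
exact: (measurableT_comp mh (pair1_measurable _)).
Qed.

End independence.

Section independent_sources.
Context {d} {Omega : measurableType d} {R : realType} (Pr : probability Omega R).
Context {I : eqType} (F : I -> set (set Omega)).
Hypothesis F_measurable : forall i, F i `<=` measurable.
Hypothesis FT : forall i, F i setT.
Hypothesis FI : forall i, setI_closed (F i).
Hypothesis F_indep : independent_classes Pr F.

Lemma bigsetI_mem (s : seq I) (A : I -> set Omega) t :
  (\big[setI/setT]_(i <- s) A i) t <-> (forall i, i \in s -> A i t).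
Proof.
elim: s => [|j s IH]; first by rewrite big_nil.
rewrite big_cons; split => [[Aj /IH As] i|As].
  by rewrite inE => /predU1P[->//|]; exact: As.
by split; [apply: As; rewrite mem_head|apply/IH => i si; apply: As; rewrite inE si orbT].
Qed.

Lemma independent_bigsetI (s : seq I) (A : I -> set Omega) : uniq s ->
  (forall i, F i (A i)) ->
  Pr (\big[setI/setT]_(i <- s) A i) = (\prod_(i <- s) Pr (A i))%E.
Proof.
move=> us FA; rewrite big_tnth.
have inj : injective (tnth (in_tuple s)) by apply/tuple_uniqP.
rewrite [RHS]big_tnth -(F_indep _ _ (fun j => A (tnth (in_tuple s) j)) inj)//.
congr (Pr _); rewrite -(big_tnth _ _ s xpredT A).
apply/seteqP; split => t.
  by move=> /bigsetI_mem As j _; apply: As; exact: mem_tnth.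
move=> As; apply/bigsetI_mem => i /(tnthP (in_tuple s))[j ->]; exact: As.
Qed.

Definition sources (J : set I) : set (set Omega) := \bigcup_(i in J) F i.

(** [sources J] is not closed under intersection. Finite intersections of events from distinct
    sources are, and so form the pi-system that the extension to sigma-algebras requires. *)
Let cylinder (J : set I) : set (set Omega) := [set B | exists s A,
  [/\ uniq s, (forall i, i \in s -> J i), (forall i, F i (A i)) &
      B = \big[setI/setT]_(i <- s) A i]].

Let cylinder_measurable J : cylinder J `<=` measurable.
Proof.
by move=> _ [s [A [_ _ FA ->]]]; apply: bigsetI_measurable => i _; exact: F_measurable.
Qed.

Let cylinderT J : cylinder J setT.
Proof. by exists [::], (fun=> setT); split => //; rewrite big_nil. Qed.

Let cylinderI J : setI_closed (cylinder J).
Proof.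
move=> _ _ [s [A [us sJ FA ->]]] [s' [A' [us' sJ' FA' ->]]].
(* A source occurring in both lists contributes the intersection of its two events, and [setT]
   stands for a missing one. *)
exists (undup (s ++ s')), (fun i => (if i \in s then A i else setT) `&` (if i \in s' then A' i else setT)).
split.
- exact: undup_uniq.
- by move=> i; rewrite mem_undup mem_cat => /orP[/sJ|/sJ'].
- by move=> i; apply: FI; case: ifP.
- apply/seteqP; split => t.
    move=> [/bigsetI_mem As /bigsetI_mem As']; apply/bigsetI_mem => i _.
    split.
      by case: ifP => // si; exact: As.
    by case: ifP => // si; exact: As'.
  move=> /bigsetI_mem As; split; apply/bigsetI_mem => i si.
    have iu : i \in undup (s ++ s') by rewrite mem_undup mem_cat si.
    by have [+ _] := As i iu; rewrite si.
  have iu : i \in undup (s ++ s') by rewrite mem_undup mem_cat si orbT.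
  by have [_ +] := As i iu; rewrite si.
Qed.

Let sources_cylinder J : sources J `<=` cylinder J.
Proof.
move=> B [i Ji FB]; exists [:: i], (fun j => if j == i then B else setT); split => //.
- by move=> j; rewrite inE => /eqP->.
- by move=> j; case: eqVneq => // ->.
- by rewrite big_seq1 eqxx.
Qed.

(** Cylinders over disjoint index sets concatenate to a single cylinder, for which the product
    formula of [independent_classes] factors. *)
Lemma independent_sources (J K : set I) (A B : set Omega) : J `&` K = set0 ->
  <<s sources J >> A -> <<s sources K >> B -> Pr (A `&` B) = (Pr A * Pr B)%E.
Proof.
move=> JK sA sB.
apply: (@sigma_independent _ _ _ _ (cylinder J) (cylinder K)) => //.
- move=> _ _ [s [A1 [us sJ FA1 ->]]] [s' [A2 [us' sK FA2 ->]]].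
  have ss' i : i \in s -> i \notin s'.
    move=> si; apply/negP => s'i.
    have : (J `&` K) i by split; [exact: sJ|exact: sK].
    by rewrite JK.
  pose A3 i := if i \in s then A1 i else A2 i.
  have FA3 i : F i (A3 i) by rewrite /A3; case: ifP.
  have E1 : \big[setI/setT]_(i <- s) A1 i = \big[setI/setT]_(i <- s) A3 i.
    by apply: eq_big_seq => i si; rewrite /A3 si.
  have E2 : \big[setI/setT]_(i <- s') A2 i = \big[setI/setT]_(i <- s') A3 i.
    by apply: eq_big_seq => i si; rewrite /A3 ifN//; apply: contraL si => /ss'.
  rewrite E1 E2 -big_cat !independent_bigsetI// ?big_cat// cat_uniq us us' andbT.
  by apply/hasPn => i; apply: contraL => /ss'.
- by apply: (sub_smallest2r _ (@sources_cylinder J)) sA.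
- by apply: (sub_smallest2r _ (@sources_cylinder K)) sB.
Qed.

End independent_sources.

Section measurable_comparison.
Context {d} {T : measurableType d} {R : realType}.
Implicit Types f g : T -> R.

Lemma measurable_set_ler f g : measurable_fun [set: T] f ->
  measurable_fun [set: T] g -> measurable [set x | f x <= g x].
Proof.
move=> mf mg; have := measurable_fun_ler mf mg.
by move=> /(_ measurableT [set true] I); rewrite setTI.
Qed.

Lemma measurable_set_ltr f g : measurable_fun [set: T] f ->
  measurable_fun [set: T] g -> measurable [set x | f x < g x].
Proof.
move=> mf mg; have := measurable_fun_ltr mf mg.
by move=> /(_ measurableT [set true] I); rewrite setTI.
Qed.

(** Markov's inequality, in the form that all the exponential bounds below use. *)
Lemma measure_le_integral (mu : {measure set T -> \bar R}) (A : set T) f :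
  measurable A -> measurable_fun [set: T] f -> (forall x, 0 <= f x) ->
  (forall x, A x -> 1 <= f x) -> (mu A <= \int[mu]_x (f x)%:E)%E.
Proof.
move=> mA mf f0 f1; rewrite -(setIT A) -integral_indic//.
apply: ge0_le_integral => //.
- by apply: measurableT_comp => //; exact: measurable_indic.
- exact: measurableT_comp.
- move=> x _; rewrite lee_fin indicE; have [|_] := boolP (x \in A) => //.
  by rewrite inE => /f1.
Qed.

End measurable_comparison.

Section independent_expectations.
Context {d} {Omega : measurableType d} {R : realType} (Pr : probability Omega R).
Context {I : eqType} (F : I -> set (set Omega)).
Hypothesis F_measurable : forall i, F i `<=` measurable.
Hypothesis FT : forall i, F i setT.
Hypothesis FI : forall i, setI_closed (F i).
Hypothesis F_indep : independent_classes Pr F.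

(** [measurable_fun (known J) X] expresses that [X] is determined by the sources in [J]; disjoint
    sets of sources then give independent variables. *)
Local Notation known J := [set: g_sigma_algebraType (sources F J)].

Lemma sigma_sources_measurable (J : set I) : <<s sources F J >> `<=` measurable.
Proof.
apply: smallest_sub; first exact: sigma_algebra_measurable.
by move=> A [i _]; exact: F_measurable.
Qed.

Lemma measurable_known (J : set I) d' (T : measurableType d') (X : Omega -> T) :
  measurable_fun (known J) X -> measurable_fun [set: Omega] X.
Proof.
move=> mX _ B mB; rewrite setTI; apply: (@sigma_sources_measurable J).
by have := mX measurableT B mB; rewrite setTI.
Qed.

Lemma measurable_knownS (J K : set I) d' (T : measurableType d') (X : Omega -> T) :
  J `<=` K -> measurable_fun (known J) X -> measurable_fun (known K) X.
Proof.
move=> JK mX _ B mB; have := mX measurableT B mB; apply: sub_sigma_algebra2.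
by move=> A [i /JK Ki FiA]; exists i.
Qed.

Lemma measurable_source (J : set I) (i : I) d' (T : measurableType d') (X : Omega -> T) :
  J i -> (forall B, measurable B -> F i (X @^-1` B)) -> measurable_fun (known J) X.
Proof.
by move=> Ji FX _ B mB; rewrite setTI; apply: sub_sigma_algebra; exists i => //; exact: FX.
Qed.

Lemma ge0_integral_independent d1 d2 (T1 : measurableType d1) (T2 : measurableType d2)
    (J K : set I) (X : Omega -> T1) (Y : Omega -> T2) (h : T1 * T2 -> \bar R) :
  J `&` K = set0 ->
  measurable_fun (known J) X -> measurable_fun (known K) Y ->
  measurable_fun [set: T1 * T2] h -> (forall x, 0 <= h x)%E ->
  (\int[Pr]_t h (X t, Y t) = \int[Pr]_t \int[Pr]_u h (X t, Y u))%E.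
Proof.
move=> JK mX mY mh h0; apply: ge0_integral_pair => //.
- exact: measurable_known mX.
- exact: measurable_known mY.
- move=> A B mA mB; apply: (independent_sources Pr F F_measurable FT FI F_indep J K _ _ JK).
    by have := mX measurableT A mA; rewrite setTI.
  by have := mY measurableT B mB; rewrite setTI.
Qed.

Lemma ge0_integral_independentM (J K : set I) (f g : Omega -> R) :
  J `&` K = set0 ->
  measurable_fun (known J) f -> measurable_fun (known K) g ->
  (forall t, 0 <= f t) -> (forall t, 0 <= g t) ->
  (\int[Pr]_t (f t * g t)%:E = \int[Pr]_t (f t)%:E * \int[Pr]_t (g t)%:E)%E.
Proof.
move=> JK mf mg f0 g0.
(* The absolute value makes the integrand nonnegative on the whole plane; on the values of [f] and
   [g] it changes nothing. *)
have mh : measurable_fun [set: R * R] (fun x => `|x.1 * x.2|%:E).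
  apply/measurable_EFinP; apply: measurableT_comp => //; exact: measurable_funM.
transitivity (\int[Pr]_t `|f t * g t|%:E)%E.
  by apply: eq_integral => t _; rewrite ger0_norm// mulr_ge0.
rewrite (ge0_integral_independent _ _ _ _ J K f g (fun x => `|x.1 * x.2|%:E) JK)//.
have mf' : measurable_fun [set: Omega] (EFin \o f).
  by apply/measurable_EFinP; exact: measurable_known mf.
have mg' : measurable_fun [set: Omega] (EFin \o g).
  by apply/measurable_EFinP; exact: measurable_known mg.
rewrite -ge0_integralZr//; last 2 first.
- by move=> t _; rewrite lee_fin.
- by apply: integral_ge0 => t _; rewrite lee_fin.
apply: eq_integral => t _ /=; rewrite -ge0_integralZl//; last 2 first.
- by move=> u _; rewrite lee_fin.
- by rewrite lee_fin.
by apply: eq_integral => u _; rewrite ger0_norm// mulr_ge0.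
Qed.

Lemma ge0_integral_independent_prod (K : eqType) (s : seq K) (J : K -> set I)
    (f : K -> Omega -> R) : uniq s ->
  {in s &, forall k k', k != k' -> J k `&` J k' = set0} ->
  (forall k, k \in s -> measurable_fun (known (J k)) (f k)) ->
  (forall k t, 0 <= f k t) ->
  (\int[Pr]_t (\prod_(k <- s) f k t)%:E = \prod_(k <- s) \int[Pr]_t (f k t)%:E)%E.
Proof.
elim: s => [|k s IH] /=.
  move=> _ _ _ _; under eq_integral do rewrite big_nil.
  rewrite big_nil integral_cst// mul1e; exact: probability_setT.
move=> /andP[ks us] disj mf f0.
under eq_integral do rewrite big_cons.
rewrite big_cons (ge0_integral_independentM (J k) (\bigcup_(k' in [set` s]) J k')).
- rewrite IH// => [k1 k2 k1s k2s|k1 k1s]; last by apply: mf; rewrite inE k1s orbT.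
  by apply: disj; rewrite inE ?k1s ?k2s orbT.
- apply/seteqP; split => // i [Jki [k' /= k's Jk'i]].
  have : (J k `&` J k') i by [].
  rewrite (disj k k') ?mem_head ?inE ?k's ?orbT//.
  by apply: contraNneq ks => ->.
- by apply: mf; rewrite mem_head.
- apply: (@measurable_prod _ (g_sigma_algebraType _)) => k' k's.
  apply: (@measurable_knownS (J k')); first by move=> i Ji; exists k'.
  by apply: mf; rewrite inE k's orbT.
- by move=> t; exact: f0.
- by move=> t; apply: prodr_ge0 => k' _; exact: f0.
Qed.

(** Doob's inequality for a nonnegative supermartingale. The partial products are stopped when they
    first reach 1; stopping keeps the expectation from growing, and Markov's inequality applies at
    the final time. The initial factor is free of the mean condition and gives the bound. *)
Lemma maximal_inequality (A : nat -> Omega -> R) (J : nat -> set I) (T : nat) :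
  (forall s t, s != t -> J s `&` J t = set0) ->
  (forall t, measurable_fun (known (J t)) (A t)) ->
  (forall t w, 0 <= A t w) ->
  (forall t, \int[Pr]_w (A t.+1 w)%:E <= 1)%E ->
  (Pr [set w | exists2 t, (t <= T)%N & (1 <= \prod_(s < t.+1) A s w)%R]
    <= \int[Pr]_w (A 0%N w)%:E)%E.
Proof.
move=> disj mA A0 A1.
(* The stopped product: it is frozen once it is at least 1. *)
pose N := fix N (t : nat) (w : Omega) : R :=
  if t is t'.+1 then if 1 <= N t' w then N t' w else N t' w * A t w else A 0%N w.
have N0 t w : 0 <= N t w by elim: t => //= t IH; case: ifP => // _; exact: mulr_ge0.
pose K t : set I := \bigcup_(s in [set s | (s <= t)%N]) J s.
have mN t : measurable_fun (known (K t)) (N t).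
  elim: t => [|t IH]; first by apply: measurable_knownS (mA 0%N) => i Ji; exists 0%N.
  have mNt : measurable_fun (known (K t.+1)) (N t).
    by apply: measurable_knownS IH => i [s /= st Ji]; exists s => //=; exact: leqW.
  have mAt : measurable_fun (known (K t.+1)) (A t.+1).
    by apply: measurable_knownS (mA t.+1) => i Ji; exists t.+1 => /=.
  apply: (@measurable_fun_ifT _ _ (g_sigma_algebraType _)) => //.
  - by apply: (@measurable_fun_ler _ (g_sigma_algebraType _)).
  - by apply: (@measurable_funM _ (g_sigma_algebraType _)).
have mI t : measurable_fun [set: Omega] (EFin \o N t).
  by apply/measurable_EFinP; exact: measurable_known (mN t).
have dec t : (\int[Pr]_w (N t.+1 w)%:E <= \int[Pr]_w (N t w)%:E)%E.
  (* [b] indicates that the product is already frozen. Only the part weighted by [1 - b] is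
     multiplied by the new factor, which is independent of it and has mean at most 1. *)
  pose b w : R := if 1 <= N t w then 1 else 0.
  have mb : measurable_fun (known (K t)) b.
    apply: (@measurable_fun_ifT _ _ (g_sigma_algebraType _)) => //.
    by apply: (@measurable_fun_ler _ (g_sigma_algebraType _)).
  have mNb : measurable_fun (known (K t)) (fun w => N t w * (1 - b w)).
    apply: (@measurable_funM _ (g_sigma_algebraType _)) => //.
    by apply: (@measurable_funB _ (g_sigma_algebraType _)).
  have b1 w : 0 <= b w <= 1 by rewrite /b; case: ifP; rewrite ?lexx ler01.
  have NE w : N t.+1 w = N t w * b w + N t w * (1 - b w) * A t.+1 w.
    by rewrite /= /b; case: ifP => _; rewrite /= ?mulr1 ?mulr0 ?subrr ?subr0 ?mulr0 ?mul0r ?addr0 ?add0r ?mulr1.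
  have Nb0 w : 0 <= N t w * b w by rewrite mulr_ge0//; case/andP: (b1 w).
  have Nb1 w : 0 <= N t w * (1 - b w) by rewrite mulr_ge0// subr_ge0; case/andP: (b1 w).
  have mNb' : measurable_fun [set: Omega] (fun w => N t w * b w).
    apply: (@measurable_known (K t)).
    exact: (@measurable_funM _ (g_sigma_algebraType _)).
  have mNb1 := measurable_known (K t) _ _ _ mNb.
  have mA1 := measurable_known _ _ _ _ (mA t.+1).
  under eq_integral do rewrite NE EFinD.
  rewrite ge0_integralD//; last 4 first.
  - by move=> w _; rewrite lee_fin.
  - exact/measurable_EFinP.
  - by move=> w _; rewrite lee_fin mulr_ge0.
  - by apply/measurable_EFinP; exact: measurable_funM.
  rewrite (ge0_integral_independentM (K t) (J t.+1) (fun w => N t w * (1 - b w)))//; last first.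
    apply/seteqP; split => // i [[s /= st Ji] Jti].
    have : (J s `&` J t.+1) i by [].
    by rewrite disj// neq_ltn ltnS st.
  apply: (@le_trans _ _ (\int[Pr]_w (N t w * b w)%:E + \int[Pr]_w (N t w * (1 - b w))%:E * 1)%E).
    apply: leeD => //; apply: lee_wpmul2l => //.
    by apply: integral_ge0 => w _; rewrite lee_fin.
  rewrite mule1 -ge0_integralD//; last 4 first.
  - by move=> w _; rewrite lee_fin.
  - exact/measurable_EFinP.
  - by move=> w _; rewrite lee_fin.
  - exact/measurable_EFinP.
  rewrite le_eqVlt; apply/orP; left; apply/eqP; apply: eq_integral => w _.
  by rewrite -EFinD -mulrDr addrC subrK mulr1.
have le0 : (\int[Pr]_w (N T w)%:E <= \int[Pr]_w (A 0%N w)%:E)%E.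
  by elim: T => [//|T IH]; exact: le_trans (dec T) IH.
apply: le_trans le0.
have hit w t : (forall s, (s < t)%N -> \prod_(i < s.+1) A i w < 1) ->
    N t w = \prod_(i < t.+1) A i w.
  elim: t => [_|t IH lt1]; first by rewrite big_ord1.
  rewrite big_ord_recr/= IH; last by move=> s st; apply: lt1; exact: leqW.
  by rewrite leNgt lt1.
have stay w s t : (s <= t)%N -> 1 <= N s w -> 1 <= N t w.
  move=> /subnKC <-; elim: (t - s)%N => [|k IH]; first by rewrite addn0.
  by move=> /IH h; rewrite addnS /= h.
have mNT : measurable [set w | 1 <= N T w].
  exact: (measurable_set_ler _ _ (measurable_cst (1 : R)) (measurable_known _ _ _ _ (mN T))).
rewrite (_ : [set w | _] = [set w | 1 <= N T w]); last first.
  apply/seteqP; split => w /=.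
    (* At the least crossing time the stopped and unstopped products coincide, by [hit]; [stay]
       carries the value on to time [T]. *)
    move=> [t tT At]; pose Q s := 1 <= \prod_(i < s.+1) A i w.
    have [s Qs smin] := ex_minnP (ex_intro Q t At).
    apply: (stay w s); first exact: leq_trans (smin _ At) tT.
    rewrite hit// => r rs; rewrite ltNge; apply/negP => /smin.
    by rewrite leqNgt rs.
  move=> NT; apply: contrapT => nQ.
  have lt1 s : (s <= T)%N -> \prod_(i < s.+1) A i w < 1.
    by move=> sT; rewrite ltNge; apply/negP => Qs; apply: nQ; exists s.
  by move: NT; rewrite hit ?leNgt ?lt1// => s sT; apply: lt1; exact: ltnW.
by apply: measure_le_integral => //; exact: measurable_known (mN T).
Qed.

End independent_expectations.

(** * The conditional normal law of a sum of products *)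

Section product_sum.
Context {d} {Omega : measurableType d} {R : realType} (Pr : probability Omega R).
Context {I : eqType} (F : I -> set (set Omega)).
Hypothesis F_measurable : forall i, F i `<=` measurable.
Hypothesis FT : forall i, F i setT.
Hypothesis FI : forall i, setI_closed (F i).
Hypothesis F_indep : independent_classes Pr F.

Local Notation known J := [set: g_sigma_algebraType (sources F J)].
Local Notation gamma := (gauss (0:R) 1).

Definition standard_pair (U V : Omega -> R) :=
  forall h : R * R -> \bar R, measurable_fun [set: R * R] h -> (forall x, 0 <= h x)%E ->
  (\int[Pr]_t h (U t, V t) = \int[gamma]_u \int[gamma]_v h (u, v))%E.

Context {K : eqType} (J : K -> set I) (U V : K -> Omega -> R).
Hypothesis J_disjoint : forall k k', k != k' -> J k `&` J k' = set0.
Hypothesis U_known : forall k, measurable_fun (known (J k)) (U k).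
Hypothesis V_known : forall k, measurable_fun (known (J k)) (V k).
Hypothesis UV_law : forall k, standard_pair (U k) (V k).

Let Q (s : seq K) t := \sum_(k <- s) U k t ^+ 2.
Let S (s : seq K) t := \sum_(k <- s) U k t * V k t.

Lemma measurable_sqrt_fun d' (T : measurableType d') (f : T -> R) :
  measurable_fun [set: T] f -> measurable_fun [set: T] (fun x => Num.sqrt (f x)).
Proof.
move=> mf; apply: (measurableT_comp _ mf).
by apply: continuous_measurable_fun; exact: sqrt_continuous.
Qed.

Let Q_ge0 s t : 0 <= Q s t.
Proof. by apply: sumr_ge0 => k _; exact: sqr_ge0. Qed.

Lemma measurable_sum_seq d' (T : measurableType d') (L : eqType) (s : seq L)
    (h : L -> T -> R) : (forall k, k \in s -> measurable_fun [set: T] (h k)) ->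
  measurable_fun [set: T] (fun x => \sum_(k <- s) h k x).
Proof.
elim: s => [|k s IH] mh.
  by under eq_fun do rewrite big_nil; exact: measurable_cst.
under eq_fun do rewrite big_cons.
apply: measurable_funD; first by apply: mh; rewrite mem_head.
by apply: IH => k' k's; apply: mh; rewrite inE k's orbT.
Qed.

Let Js (s : seq K) : set I := \bigcup_(k in [set` s]) J k.

Let known_Js s k (X : Omega -> R) : k \in s -> measurable_fun (known (J k)) X ->
  measurable_fun (known (Js s)) X.
Proof. by move=> ks; apply: measurable_knownS => i Ji; exists k. Qed.

Let Q_known s : measurable_fun (known (Js s)) (Q s).
Proof.
apply: (@measurable_sum_seq _ (g_sigma_algebraType _)) => k ks.
apply: (@measurable_funX _ (g_sigma_algebraType _)).
by apply: (known_Js _ _ _ ks); exact: U_known.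
Qed.

Let S_known s : measurable_fun (known (Js s)) (S s).
Proof.
apply: (@measurable_sum_seq _ (g_sigma_algebraType _)) => k ks.
apply: (@measurable_funM _ (g_sigma_algebraType _)).
  by apply: (known_Js _ _ _ ks); exact: U_known.
by apply: (known_Js _ _ _ ks); exact: V_known.
Qed.

(** Conditionally on all [U k], the sum of products is centred normal with variance the sum of
    squares. Stating this through the joint law of both sums avoids conditional distributions and
    permits an induction in which each new pair adds [u ^+ 2] to the variance. *)
Lemma integral_sum_product (s : seq K) (f : R * R -> \bar R) : uniq s ->
  measurable_fun [set: R * R] f -> (forall x, 0 <= f x)%E ->
  (\int[Pr]_t f (\sum_(k <- s) U k t ^+ 2, \sum_(k <- s) U k t * V k t)%R =
   \int[Pr]_t \int[gamma]_g f (\sum_(k <- s) U k t ^+ 2,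
                               Num.sqrt (\sum_(k <- s) U k t ^+ 2) * g)%R)%E.
Proof.
elim: s f => [|k s IH] f /=.
  move=> _ mf f0; apply: eq_integral => t _; rewrite !big_nil.
  under [RHS]eq_integral do rewrite sqrtr0 mul0r.
  by rewrite integral_cst//= probability_setT mule1.
move=> /andP[ks us] mf f0.
under eq_integral do rewrite !big_cons.
under [RHS]eq_integral do under eq_integral do rewrite !big_cons.
have JsJ : Js s `&` J k = set0.
  apply/seteqP; split => // i [[k' /= k's Jk'i] Jki].
  have : (J k' `&` J k) i by [].
  by rewrite J_disjoint//; apply: contraTneq k's => ->.
pose X t := (Q s t, S s t); pose Y t := (U k t, V k t).
have mX : measurable_fun (known (Js s)) X.
  by apply: (@measurable_fun_pair _ _ _ (g_sigma_algebraType _)).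
have mY : measurable_fun (known (J k)) Y.
  by apply: (@measurable_fun_pair _ _ _ (g_sigma_algebraType _)).
have mfst (d1 d2 : measure_display) (T1 : measurableType d1) (T2 : measurableType d2) :
  measurable_fun [set: T1 * T2] fst by exact: measurable_fst.
have msnd (d1 d2 : measure_display) (T1 : measurableType d1) (T2 : measurableType d2) :
  measurable_fun [set: T1 * T2] snd by exact: measurable_snd.
pose Kf q := (\int[gamma]_g f (q, Num.sqrt q * g)%R)%E.
have mKf : measurable_fun [set: R] Kf.
  rewrite /Kf; apply: (@measurable_integral_fst _ _ R R R gamma (fun q g => f (q, Num.sqrt q * g))) => //.
  apply: measurable_fun_pair_comp => //; apply: measurable_funM => //.
  exact: measurable_sqrt_fun.
have Kf0 q : (0 <= Kf q)%E by exact: integral_ge0.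
have mh1 : measurable_fun [set: (R * R) * (R * R)]
    (fun x => f (x.2.1 ^+ 2 + x.1.1, x.2.1 * x.2.2 + x.1.2)).
  apply: measurable_fun_pair_comp => //; apply: measurable_funD.
  - by apply: measurable_funX; apply: measurableT_comp.
  - by apply: measurableT_comp.
  - by apply: measurable_funM; apply: measurableT_comp.
  - by apply: measurableT_comp.
have mh2 : measurable_fun [set: (R * R) * (R * R)] (fun x => Kf (x.2.1 ^+ 2 + x.1.1)).
  apply: (measurableT_comp mKf); apply: measurable_funD.
    by apply: measurable_funX; apply: measurableT_comp.
  by apply: measurableT_comp.
apply: (etrans (ge0_integral_independent Pr F F_measurable FT FI F_indep _ _ _ _ _ _ X Y _ JsJ mX mY mh1 (fun=> f0 _))).
apply: etrans (esym (ge0_integral_independent Pr F F_measurable FT FI F_indep _ _ _ _ _ _ X Y _ JsJ mX mY mh2 (fun=> Kf0 _))).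
(* The new pair is integrated out first, so that the induction hypothesis can be applied to [G] on
   the remaining indices. *)
pose G x := (\int[gamma]_u \int[gamma]_v f (u ^+ 2 + x.1, u * v + x.2)%R)%E.
have pairR1 (q p : R) : measurable_fun [set: R * R] (fun x => f (x.1 ^+ 2 + q, x.1 * x.2 + p)).
  apply: measurable_fun_pair_comp => //; apply: measurable_funD => //.
    exact: measurable_funX.
  exact: measurable_funM.
transitivity (\int[Pr]_t G (X t))%E.
  apply: eq_integral => t _.
  exact: (UV_law k (fun x => f (x.1 ^+ 2 + Q s t, x.1 * x.2 + S s t)) (pairR1 _ _) (fun=> f0 _)).
have mG : measurable_fun [set: R * R] G.
  rewrite /G; apply: (@measurable_integral_fst _ _ (R * R)%type R R gamma (fun x u => \int[gamma]_v f (u ^+ 2 + x.1, u * v + x.2)%R)%E); last first.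
    by move=> x u; exact: integral_ge0.
  apply: (@measurable_integral_fst _ _ ((R * R) * R)%type R R gamma (fun x v => f (x.2 ^+ 2 + x.1.1, x.2 * v + x.1.2)%R)%E) => //.
  apply: measurable_fun_pair_comp => //; apply: measurable_funD.
  - by apply: measurable_funX; apply: measurableT_comp.
  - by do 2 apply: measurableT_comp => //.
  - by apply: measurable_funM => //; apply: measurableT_comp.
  - by do 2 apply: measurableT_comp => //.
have G0 x : (0 <= G x)%E by apply: integral_ge0 => u _; exact: integral_ge0.
apply: (etrans (IH G us mG G0)); apply: eq_integral => t _.
have mKfq q : measurable_fun [set: R * R] (fun x => Kf (x.1 ^+ 2 + q)).
  by apply: (measurableT_comp mKf); apply: measurable_funD => //; exact: measurable_funX.
apply: etrans (esym (UV_law k (fun x => Kf (x.1 ^+ 2 + Q s t)) (mKfq _) (fun=> Kf0 _))).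
rewrite -/(Q s t) /G /=; set q := Q s t; have q0 : 0 <= q by exact: Q_ge0.
(* [u] is moved outermost, because the merging of the two normal terms takes place for fixed [u]. *)
rewrite (@tonelli _ _ R R R gamma gamma (fun g u => \int[gamma]_v f (u ^+ 2 + q, u * v + Num.sqrt q * g)%R)%E)/=; last 2 first.
- apply: (@measurable_integral_fst _ _ (R * R)%type R R gamma (fun x v => f (x.2 ^+ 2 + q, x.2 * v + Num.sqrt q * x.1)%R)%E) => //.
  apply: measurable_fun_pair_comp => //; apply: measurable_funD => //.
  - by apply: measurable_funX; apply: measurableT_comp.
  - by apply: measurable_funM => //; apply: measurableT_comp.
  - by apply: measurable_funM => //; apply: measurableT_comp.
- by move=> g u; exact: integral_ge0.
apply: eq_integral => u _.
rewrite integral_cst//= probability_setT mule1.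
rewrite (@tonelli _ _ R R R gamma gamma (fun g v => f (u ^+ 2 + q, u * v + Num.sqrt q * g)%R)%E)//=; last first.
  apply: measurable_fun_pair_comp => //; apply: measurable_funD => //;
  exact: measurable_funM.
rewrite /Kf addrC; exact: ge0_integral_gauss_step.
Qed.

End product_sum.

(** * Tails of sums of squares and of products of normal variables *)

Section product_sum_tail.
Context {d} {Omega : measurableType d} {R : realType} (Pr : probability Omega R).
Context {I : eqType} (F : I -> set (set Omega)).
Hypothesis F_measurable : forall i, F i `<=` measurable.
Hypothesis FT : forall i, F i setT.
Hypothesis FI : forall i, setI_closed (F i).
Hypothesis F_indep : independent_classes Pr F.

Local Notation known J := [set: g_sigma_algebraType (sources F J)].
Local Notation gamma := (gauss (0:R) 1).

Context {K : eqType} (J : K -> set I) (U V : K -> Omega -> R).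
Hypothesis J_disjoint : forall k k', k != k' -> J k `&` J k' = set0.
Hypothesis U_known : forall k, measurable_fun (known (J k)) (U k).
Hypothesis V_known : forall k, measurable_fun (known (J k)) (V k).
Hypothesis UV_law : forall k, standard_pair Pr (U k) (V k).

Let mU k : measurable_fun [set: Omega] (U k).
Proof. exact: (measurable_known F F_measurable _ _ _ _ (U_known k)). Qed.

Let mV k : measurable_fun [set: Omega] (V k).
Proof. exact: (measurable_known F F_measurable _ _ _ _ (V_known k)). Qed.

Let mQ (s : seq K) : measurable_fun [set: Omega] (fun t => \sum_(k <- s) U k t ^+ 2).
Proof. by apply: measurable_sum => k; exact: measurable_funX. Qed.

Let mS (s : seq K) : measurable_fun [set: Omega] (fun t => \sum_(k <- s) U k t * V k t).
Proof. by apply: measurable_sum => k; exact: measurable_funM. Qed.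

Lemma sum_sqr_tail (s : seq K) (t r : R) : uniq s -> 0 <= t -> t * 2 < 1 ->
  (Pr [set w | (r < \sum_(k <- s) U k w ^+ 2)%R]
    <= (expR (- (t * r)) * (Num.sqrt (1 - t * 2))^-1 ^+ size s)%:E)%E.
Proof.
move=> us t0 t2.
have mexp k : measurable_fun [set: Omega] (fun w => expR (t * U k w ^+ 2)).
  apply: (measurableT_comp (@measurable_expR R)); apply: measurable_funM => //.
  exact: measurable_funX.
have E1 k : (\int[Pr]_w (expR (t * U k w ^+ 2))%:E = ((Num.sqrt (1 - t * 2))^-1)%:E)%E.
  have mh : measurable_fun [set: R * R] (fun x : R * R => (expR (t * x.1 ^+ 2))%:E).
    apply: measurableT_comp => //; apply: (measurableT_comp (@measurable_expR R)).
    by apply: measurable_funM => //; exact: measurable_funX.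
  apply: (etrans (UV_law k (fun x => (expR (t * x.1 ^+ 2))%:E) mh _)).
    by move=> x; rewrite lee_fin expR_ge0.
  transitivity (\int[gamma]_u (expR (t * u ^+ 2))%:E)%E.
    by apply: eq_integral => u _; rewrite /= integral_cst//= probability_setT mule1.
  by rewrite integral_gauss_sqr_expR ?expr1n ?mulr1.
have E2 : (\int[Pr]_w (\prod_(k <- s) expR (t * U k w ^+ 2))%:E =
           ((Num.sqrt (1 - t * 2))^-1 ^+ size s)%:E)%E.
  rewrite (ge0_integral_independent_prod Pr F F_measurable FT FI F_indep K s J
    (fun k w => expR (t * U k w ^+ 2)))//.
  - under eq_bigr do rewrite E1.
    elim: (s) => [|k s' IH]; first by rewrite big_nil.
    by rewrite big_cons IH -EFinM -exprS.
  - by move=> k k' _ _; exact: J_disjoint.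
  - move=> k _; apply: (measurableT_comp (@measurable_expR R)).
    apply: (@measurable_funM _ (g_sigma_algebraType _)) => //.
    exact: (@measurable_funX _ (g_sigma_algebraType _)).
rewrite EFinM -E2 -ge0_integralZl//; last 2 first.
- by apply: measurableT_comp => //; exact: measurable_prod.
- by move=> w _; rewrite lee_fin; apply: prodr_ge0 => k _; exact: expR_ge0.
apply: (@measure_le_integral _ _ _ Pr _ (fun w => expR (- (t * r)) * \prod_(k <- s) expR (t * U k w ^+ 2))).
- exact: measurable_set_ltr.
- by apply: measurable_funM => //; exact: measurable_prod.
- by move=> w; rewrite mulr_ge0 ?expR_ge0//; apply: prodr_ge0 => k _; exact: expR_ge0.
- move=> w /= rQ; rewrite -expR_sum -expRD -mulr_sumr -expR0 ler_expR.
  by rewrite addrC -mulrBr mulr_ge0// subr_ge0 ltW.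
Qed.

(** Given that the sum of squares is [q], the conditional probability is that of
    [Num.sqrt q * g < c]. As [c] is negative it grows with [q], so on [q <= r] it is at most the
    value at [r]. *)
Lemma sum_product_tail (s : seq K) (c r : R) : uniq s -> c < 0 -> 0 < r ->
  (Pr [set w | (\sum_(k <- s) U k w * V k w < c)%R] <=
   Pr [set w | (r < \sum_(k <- s) U k w ^+ 2)%R] + (Phi (c / Num.sqrt r))%:E)%E.
Proof.
move=> us c0 r0.
have sr0 : 0 < Num.sqrt r by rewrite sqrtr_gt0.
pose A := [set x : R * R | x.2 < c].
have mA : measurable A by exact: measurable_set_ltr.
have mI : measurable_fun [set: R * R] (EFin \o \1_A : R * R -> \bar R).
  by apply: measurableT_comp => //; exact: measurable_indic.
have mB : measurable [set w | r < \sum_(k <- s) U k w ^+ 2].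
  exact: measurable_set_ltr.
have mC : measurable [set w | \sum_(k <- s) U k w * V k w < c].
  exact: measurable_set_ltr.
rewrite -[X in (Pr X <= _)%E]setIT -integral_indic//.
have I0 x : (0 <= (EFin \o \1_A : R * R -> \bar R) x)%E by rewrite lee_fin.
have := integral_sum_product Pr F F_measurable FT FI F_indep J U V
  J_disjoint U_known V_known UV_law s _ us mI I0.
rewrite /= => E.
rewrite (_ : (\int[Pr]_x _)%E = (\int[Pr]_t (\1_A (\sum_(k <- s) U k t ^+ 2, \sum_(k <- s) U k t * V k t)%R)%:E)%E); last first.
  by apply: eq_integral => w _; rewrite !indicE; congr ((nat_of_bool _)%:R%:E); apply/idP/idP; rewrite !inE.
rewrite E.
have -> : (Phi (c / Num.sqrt r))%:E = (\int[Pr]_t (Phi (c / Num.sqrt r))%:E)%E.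
  by rewrite integral_cst//= probability_setT mule1.
rewrite -[X in (_ <= Pr X + _)%E]setIT -integral_indic//.
have Phi_ge0 x : 0 <= Phi x :> R by rewrite -lee_fin PhiE.
have mR : measurable_fun [set: Omega] (fun w => (\1_[set w | r < \sum_(k <- s) U k w ^+ 2] w : R)%:E).
  by apply: measurableT_comp => //; exact: measurable_indic.
rewrite -ge0_integralD//; last by move=> w _; rewrite lee_fin.
apply: ge0_le_integral => //.
- by move=> w _; exact: integral_ge0.
- pose h (x : R * R) := ((\1_A : R * R -> R) (x.1, Num.sqrt x.1 * x.2))%:E.
  have mh : measurable_fun [set: R * R] h.
    apply: measurableT_comp => //; apply: (measurable_fun_pair_comp _ _ _ _ (\1_A : R * R -> R)) => //.
    by apply: measurable_funM => //; apply: (measurable_sqrt_fun _ _ fst).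
  have mG : measurable_fun [set: R] (fun q => \int[gamma]_g h (q, g))%E.
    apply: (@measurable_integral_fst _ _ R R R gamma (fun q g => h (q, g)) mh).
    by move=> q g; rewrite lee_fin.
  exact: (measurableT_comp mG (mQ s)).
- by apply: emeasurable_funD.
move=> w _; set q := \sum_(k <- s) _.
have mD : measurable [set g | Num.sqrt q * g < c].
  by apply: measurable_set_ltr => //; exact: measurable_funM.
have -> : (\int[gamma]_g (\1_A (q, Num.sqrt q * g)%R)%:E = gamma [set g | (Num.sqrt q * g < c)%R])%E.
  by rewrite -[X in gamma X]setIT -integral_indic.
rewrite indicE; have [rq|rq] := boolP (w \in _).
  rewrite -[leLHS]adde0 leeD ?lee_fin//; exact: probability_le1.
rewrite add0e PhiE; apply: le_measure; rewrite ?inE//.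
move=> g /= qg; rewrite in_itv/= ler_pdivlMr//.
have {}rq : q <= r by move: rq; rewrite notin_setE/= => /negP; rewrite -leNgt.
(* Since [q] may vanish, no division by its root: from [g < 0] and [q <= r], [Num.sqrt r * g] is at
   most [Num.sqrt q * g]. *)
have g0 : g < 0.
  rewrite ltNge; apply/negP => g0; move: qg; apply/negP; rewrite -leNgt.
  by rewrite (le_trans (ltW c0))// mulr_ge0// sqrtr_ge0.
rewrite (le_trans _ (ltW qg))// mulrC; apply: ler_wnM2r; first exact: ltW.
exact: ler_wsqrtr.
Qed.

End product_sum_tail.

(** * Energy accounting of the code *)

Lemma ler_sum_prefix {R : realType} (e : nat -> R) (a b : nat) :
  (forall i, 0 <= e i) -> (a <= b)%N -> \sum_(i < a) e i <= \sum_(i < b) e i.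
Proof.
move=> e0 ab; rewrite -!(big_mkord xpredT e) [leRHS](big_cat_nat (n := a))//=.
by rewrite lerDl sumr_ge0.
Qed.

Lemma sum_constant_blocks {R : realType} (L l : nat) (e : nat -> R) :
  (forall i, e i = e (i %/ L * L)%N) ->
  \sum_(i < l * L) e i = L%:R * \sum_(j < l) e (j * L)%N.
Proof.
move=> eL; case: L eL => [|L] eL; first by rewrite muln0 big_ord0 mul0r.
elim: l => [|l IH]; first by rewrite mul0n !big_ord0 mulr0.
rewrite [in RHS]big_ord_recr /= mulrDr -IH mulSnr -!(big_mkord xpredT e).
rewrite (big_cat_nat (n := (l * L.+1)%N))//= ?leq_addr//; congr (_ + _).
rewrite (eq_big_nat _ _ (F2 := fun=> e (l * L.+1)%N)).
  by rewrite sumr_const_nat addKn mulr_natl.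
move=> i /andP[li iL]; rewrite eL -(subnKC li) divnMDl// divn_small ?addn0//.
by rewrite ltn_subLR.
Qed.

Section energy_causality.
Context {R : realType} {n M L m : nat}.
Hypothesis L_gt0 : (0 < L)%N.
Variables (c : 'I_M -> 'I_n -> R) (w : 'I_M) (e : nat -> R).

(** The successor includes the first arrival of block [l], which is known when the encoder decides
    on that block. *)
Definition harvest (l : nat) : R := \sum_(i < (l * L).+1) e i.

Definition codeword_energy (l : nat) : R :=
  \sum_(k < n | (m * L <= k < l * L)%N) c w k ^+ 2.

(** It compares the raw codeword with the arrivals and makes no reference to the state of the
    encoder, so its probability concerns sums of independent variables only. *)
Definition overdraft : Prop := exists l : nat,
  [/\ (m <= l)%N, (l * L < n)%N & harvest l < codeword_energy l.+1].

Definition st_input (k : 'I_n) : R :=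
  st_encoder L m c w (fun i : 'I_k.+1 => e i).

Let x := c w.

(** [spent] is computed at each instant [k] from a prefix of [k + 1] arrivals. Here it is run on the
    whole sequence, which gives one state for all instants; the prefix at [k] contains every arrival
    that the blocks up to [k %/ L] consult. *)
Let sp := fix sp (l : nat) : R := if l is l'.+1 then
  sp l' + (if (m <= l')%N && (block_sqnorm L x l' <= harvest l' - sp l')
           then block_sqnorm L x l' else 0) else 0.

Let sent l := (m <= l)%N && (block_sqnorm L x l <= harvest l - sp l).

Let harvested_prefix (k l : nat) : (l * L <= k)%N ->
  harvested L (fun i : 'I_k.+1 => e i) l = harvest l.
Proof.
move=> lk; rewrite /harvested /harvest.
rewrite -(big_mkord (fun i => (i <= l * L)%N) e) -(big_mkord xpredT e).
by rewrite (big_nat_widen _ _ _ _ _ (lk : ((l * L).+1 <= k.+1)%N)).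
Qed.

Let spent_prefix (k l : nat) : (l <= k %/ L)%N ->
  spent L m (fun i : 'I_k.+1 => e i) x l = sp l.
Proof.
elim: l => [//|l IH] lk; rewrite [LHS]/= /sendable IH ?(ltnW lk)//.
rewrite harvested_prefix// (leq_trans _ (leq_divM k L))// leq_mul2r (ltnW lk) orbT//.
Qed.

Let st_inputE (k : 'I_n) : st_input k = if sent (k %/ L)%N then x k else 0.
Proof.
by rewrite /st_input /st_encoder /sendable spent_prefix// harvested_prefix// leq_divM.
Qed.

Let sum_sqr_input l : \sum_(k < n | (k %/ L < l)%N) st_input k ^+ 2 = sp l.
Proof.
elim: l => [|l IH]; first by rewrite big_pred0.
rewrite (bigID (fun k : 'I_n => k %/ L < l)%N) /=; congr (_ + _).
  by rewrite -IH; apply: eq_bigl => k; rewrite ltnS andb_idl// => /ltnW.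
rewrite (eq_bigl (fun k : 'I_n => k %/ L == l)%N); last first.
  by move=> k; rewrite -leqNgt ltnS eqn_leq.
case: ifPn => [sl|nsl].
  by apply: eq_bigr => k /eqP kl; rewrite st_inputE kl /sent sl.
by rewrite big1// => k /eqP kl; rewrite st_inputE kl /sent (negbTE nsl) expr0n.
Qed.

(** A block is sent only if its full cost is covered at its start, so the total spent through block
    [l] never exceeds [harvest l]. Within a block, the spending so far is bounded by that of the
    full block, and the harvest at its start by the energy up to [k]. *)
Lemma st_input_causal (k : 'I_n) : (forall i, 0 <= e i) ->
  \sum_(i < n | (i <= k)%N) st_input i ^+ 2 <= \sum_(i < k.+1) e i.
Proof.
move=> e0.
have harvestS l : harvest l <= harvest l.+1.
  by apply: ler_sum_prefix => //; rewrite ltnS leq_mul2r leqnSn orbT.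
have sp_le l : sp l.+1 <= harvest l.
  elim: l => [|l IH] /=.
    rewrite add0r; case: ifPn => [/andP[_]|_]; first by rewrite subr0.
    by apply: sumr_ge0.
  rewrite -/(sp l.+1); case: ifPn => [/andP[_]|_]; first by rewrite lerBrDl.
  by rewrite addr0 (le_trans IH).
apply: (@le_trans _ _ (harvest (k %/ L))); last first.
  by apply: ler_sum_prefix => //; rewrite ltnS leq_divM.
apply: le_trans (sp_le _); rewrite -sum_sqr_input.
rewrite big_mkcond [leRHS]big_mkcond; apply: ler_sum => i _.
rewrite ltnS; have [ik|ik] := leqP i k; first by rewrite leq_div2r.
by case: ifP => // _; exact: sqr_ge0.
Qed.

Lemma codeword_energyS l : codeword_energy l.+1 = codeword_energy l + (if (m <= l)%N then block_sqnorm L x l else 0).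
Proof.
rewrite /codeword_energy (bigID (fun k : 'I_n => k < l * L)%N) /=; congr (_ + _).
    apply: eq_bigl => i; rewrite -andbA; congr (_ && _); rewrite andb_idl//.
    by move=> il; rewrite (leq_trans il)// leq_mul2r leqnSn orbT.
case: ifPn => [ml|]; last first.
    rewrite -ltnNge => lm; rewrite big_pred0// => i.
    apply/negbTE/negP => /andP[/andP[mi il] _]; move: mi.
    by rewrite leqNgt (leq_trans il)// leq_mul2r lm orbT.
apply: eq_bigl => i; rewrite -leqNgt.
have -> : (i %/ L == l)%N = (l * L <= i)%N && (i < l.+1 * L)%N.
    by rewrite eqn_leq -leq_divRL// -ltn_divLR// ltnS andbC.
case: (leqP (l * L) i) => [li|]; last by rewrite andbF.
by rewrite andbT (leq_trans _ li)// leq_mul2r ml orbT.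
Qed.

(** By induction on blocks the energy spent equals that of the codeword, so in the absence of an
    overdraft the test for sending succeeds at every block from [m] on. *)
Lemma st_input_codeword (k : 'I_n) : ~ overdraft -> (m * L <= k)%N -> st_input k = c w k.
Proof.
move=> nov mk.
have usedS := codeword_energyS.
have used_le l : (m <= l)%N -> (l * L < n)%N -> codeword_energy l.+1 <= harvest l.
  by move=> ml ln; rewrite leNgt; apply/negP => lt; apply: nov; exists l.
have spE l : sp l = codeword_energy l.
  elim: l => [|l IH].
    by rewrite /codeword_energy big_pred0// => i; rewrite mul0n ltn0 andbF.
  rewrite usedS /= IH; congr (_ + _).
  have [ml|//] := leqP m l.
  have [ln|ln] := ltnP (l * L) n; first by have := used_le l ml ln; rewrite usedS ml lerBrDl => ->.
  (* A block starting at [n] or later is empty and costs nothing, sent or not. *)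
  have -> : block_sqnorm L x l = 0; last by rewrite if_same.
  rewrite /block_sqnorm big_pred0// => i; apply/negbTE/negP => /eqP il.
  by have := ltn_ord i; rewrite ltnNge (leq_trans ln)// -il leq_divM.
rewrite st_inputE ifT// /sent spE lerBrDl.
have ml : (m <= k %/ L)%N by rewrite leq_divRL.
rewrite ml /=; have := usedS (k %/ L)%N; rewrite ml => <-.
by apply: used_le => //; apply: leq_ltn_trans (leq_divM _ _) (ltn_ord k).
Qed.

End energy_causality.

(** * The independent sources of the ensemble *)

HB.instance Definition _ n M := gen_eqMixin (source n M).

Lemma bigsetU_mem {T : Type} {I : eqType} (s : seq I) (A : I -> set T) t :
  (\big[setU/set0]_(i <- s) A i) t <-> exists2 i, i \in s & A i t.
Proof.
elim: s => [|j s IH]; first by rewrite big_nil; split => // -[].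
rewrite big_cons; split => [[At|/IH[i si At]]|[i]].
- by exists j => //; rewrite mem_head.
- by exists i => //; rewrite inE si orbT.
- by rewrite inE => /predU1P[->|si] At; [left|right; apply/IH; exists i].
Qed.

Lemma measure_bigsetU_le {d} {T : measurableType d} {R : realType}
    (mu : {measure set T -> \bar R}) {I : eqType} (s : seq I) (A : I -> set T) :
  (forall i, measurable (A i)) ->
  (mu (\big[setU/set0]_(i <- s) A i) <= \sum_(i <- s) mu (A i))%E.
Proof.
move=> mA; elim: s => [|j s IH]; first by rewrite !big_nil measure0.
rewrite !big_cons (le_trans (measureU2 _ _ _))//; first exact: bigsetU_measurable.
exact: leeD2l.
Qed.

Section ensemble_sources.
Context {R : realType} {d0 : measure_display} {Omega0 : measurableType d0}
  {Pr0 : probability Omega0 R} {E : {RV Pr0 >-> R}} {n M L : nat} {S : R}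
  {d : measure_display} {Omega : measurableType d} {Pr : probability Omega R}.
Variable X : ensemble E n M L S Pr.

Definition source_events (s : source n M) : set (set Omega) :=
  match s with
  | block_source l => preimage_set_system setT (energy X (l * L)%N) measurable
  | noise_source k => preimage_set_system setT (noise X k) measurable
  | symbol_source w k => preimage_set_system setT (codebook X w k) measurable
  | message_source => preimage_set_system setT (message X) setT
  | guess_source => preimage_set_system setT (guess X) setT
  end.

Lemma source_events_indep : independent_classes Pr source_events.
Proof. exact: (@ensemble_independent _ _ _ _ _ _ _ _ _ _ _ _ X). Qed.

Lemma measurable_finite_preimage (V : Omega -> 'I_M) (B : set 'I_M) :
  (forall w, measurable (V @^-1` [set w])) -> measurable (V @^-1` B).
Proof.
move=> mV; have -> : V @^-1` B = \bigcup_(w in B) V @^-1` [set w].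
  by apply/seteqP; split => t /= => [Bt|[w Bw /= ->]//]; exists (V t).
by apply: fin_bigcup_measurable => //; exact: finite_finset.
Qed.

Lemma source_events_measurable s : source_events s `<=` measurable.
Proof.
case: s => [l|k|w k||] _ /= [B mB <-]; rewrite setTI.
- by rewrite -[_ @^-1` _]setTI; exact: measurable_funPT.
- by rewrite -[_ @^-1` _]setTI; exact: measurable_funPT.
- by rewrite -[_ @^-1` _]setTI; exact: measurable_funPT.
- by apply: measurable_finite_preimage; exact: message_measurable.
- by apply: measurable_finite_preimage; exact: guess_measurable.
Qed.

Lemma source_eventsT s : source_events s setT.
Proof.
by case: s => [l|k|w k||] /=; exists setT; rewrite ?setTI.
Qed.

Lemma source_eventsI s : setI_closed (source_events s).
Proof.
case: s => [l|k|w k||] _ _ /= [A mA <-] [B mB <-]; exists (A `&` B);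
  rewrite ?setTI ?preimage_setI//; exact: measurableI.
Qed.

Local Notation known J := [set: g_sigma_algebraType (sources source_events J)].

Lemma energy_known J l : J (block_source n M l) ->
  measurable_fun (known J) (energy X (l * L)%N).
Proof.
by move=> Jl; apply: (measurable_source _ _ _ _ _ _ Jl) => B mB; exists B; rewrite ?setTI.
Qed.

Lemma noise_known J k : J (noise_source n M k) -> measurable_fun (known J) (noise X k).
Proof.
by move=> Jl; apply: (measurable_source _ _ _ _ _ _ Jl) => B mB; exists B; rewrite ?setTI.
Qed.

Lemma codebook_known J w k : J (symbol_source w k) ->
  measurable_fun (known J) (codebook X w k).
Proof.
by move=> Jl; apply: (measurable_source _ _ _ _ _ _ Jl) => B mB; exists B; rewrite ?setTI.
Qed.

Lemma ge0_integral_law (Y : {RV Pr >-> R}) (mu : {measure set R -> \bar R}) (f : R -> \bar R) :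
  has_law Y mu -> measurable_fun [set: R] f -> (forall x, 0 <= f x)%E ->
  (\int[Pr]_t f (Y t) = \int[mu]_x f x)%E.
Proof.
move=> lawY mf f0; rewrite -(@ge0_integral_distribution _ _ _ _ _ Pr Y f mf f0).
by apply: eq_measure_integral => A mA _; exact: lawY.
Qed.

Lemma ge0_integral_energy l (f : R -> \bar R) :
  measurable_fun [set: R] f -> (forall x, 0 <= f x)%E ->
  (\int[Pr]_t f (energy X (l * L)%N t) = \int[Pr0]_t f (E t))%E.
Proof.
move=> mf f0; rewrite (ge0_integral_law _ (distribution Pr0 E))//; last exact: energy_law.
by rewrite ge0_integral_distribution.
Qed.

Lemma ge0_integral_noise k (f : R -> \bar R) :
  measurable_fun [set: R] f -> (forall x, 0 <= f x)%E ->
  (\int[Pr]_t f (noise X k t) = \int[gauss 0 1]_x f x)%E.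
Proof. by move=> mf f0; apply: ge0_integral_law => //; exact: noise_law. Qed.

Lemma ge0_integral_codebook w k (f : R -> \bar R) :
  measurable_fun [set: R] f -> (forall x, 0 <= f x)%E ->
  (\int[Pr]_t f (codebook X w k t) = \int[gauss 0 (Num.sqrt S)]_x f x)%E.
Proof. by move=> mf f0; apply: ge0_integral_law => //; exact: codebook_law. Qed.

(* The code is analysed for each message [w] separately: [A w] is the event of
   interest when [w] is sent. *)
Lemma measurable_message_cases (A : 'I_M -> set Omega) :
  (forall w, measurable (A w)) -> measurable [set t | A (message X t) t].
Proof.
move=> mA.
have -> : [set t | A (message X t) t] =
    \bigcup_(w in [set: 'I_M]) (A w `&` message X @^-1` [set w]).
  apply/seteqP; split => [t At|t [w _ [Awt /= ->]]//]; by exists (message X t).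
apply: fin_bigcup_measurable => [|w _]; first exact: finite_finset.
by apply: measurableI => //; exact: message_measurable.
Qed.

(** The event is the union over [w] of [A w] intersected with the choice of [w]. The message is
    independent of [A w], so each term is at most [p / M]. *)
Lemma message_cases_le (J : set (source n M)) (A : 'I_M -> set Omega) (p : \bar R) :
  (0 < M)%N -> (0 <= p)%E -> ~ J (message_source n M) ->
  (forall w, <<s sources source_events J >> (A w)) -> (forall w, Pr (A w) <= p)%E ->
  (Pr [set t | A (message X t) t] <= p)%E.
Proof.
move=> M0 p0 Jm JA Ap.
have mA w : measurable (A w).
  exact: (sigma_sources_measurable _ source_events_measurable _ _ (JA w)).
have mAw w : measurable (A w `&` message X @^-1` [set w]).
  by apply: measurableI => //; exact: message_measurable.
have -> : [set t | A (message X t) t] =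
    \big[setU/set0]_(w <- enum 'I_M) (A w `&` message X @^-1` [set w]).
  apply/seteqP; split => t /=.
    by move=> At; apply/bigsetU_mem; exists (message X t); rewrite ?mem_enum.
  by move=> /bigsetU_mem[w _ [Awt /= ->]].
have indep w : Pr (A w `&` message X @^-1` [set w]) = (Pr (A w) * (M%:R^-1)%:E)%E.
  rewrite -(message_law X w); apply: (independent_sources Pr source_events
    source_events_measurable source_eventsT source_eventsI source_events_indep J
    [set message_source n M]) => //.
  - by apply/seteqP; split => // s [Js /= sm]; apply: Jm; rewrite -sm.
  - apply: sub_sigma_algebra; exists (message_source n M) => //=.
    by exists [set w] => //; rewrite setTI.
apply: (le_trans (measure_bigsetU_le _ _ _ mAw)).
apply: (@le_trans _ _ (\sum_(w <- enum 'I_M) (p * (M%:R^-1)%:E))%E).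
  by apply: lee_sum => w _; rewrite [leLHS](indep w) lee_wpmul2r// lee_fin.
rewrite big_enum/= -ge0_sume_distrr//.
rewrite sumEFin sumr_const card_ord -[_ *+ _]mulr_natl. rewrite mulfV ?mule1//.
by rewrite pnatr_eq0 -lt0n.
Qed.

End ensemble_sources.

Lemma ae_measure_le {d} {T : measurableType d} {R : realType}
    (mu : {measure set T -> \bar R}) (A B : set T) :
  measurable A -> measurable B -> {ae mu, forall x, A x -> B x} -> (mu A <= mu B)%E.
Proof.
move=> mA mB [N [mN N0 AB]].
apply: (@le_trans _ _ (mu (B `|` N))).
  apply: le_measure; rewrite ?inE//; first exact: measurableU.
  move=> x Ax; have [Bx|nBx] := pselect (B x); [by left|right].
  by apply: AB => /= /(_ Ax).
apply: (le_trans (measureU2 _ mB mN)); rewrite -[leRHS]adde0.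
by apply: leeD => //; rewrite [leLHS]N0.
Qed.

(** * The probability of an overdraft *)

Section overdraft_probability.
Context {R : realType} {d0 : measure_display} {Omega0 : measurableType d0}
  {Pr0 : probability Omega0 R} {E : {RV Pr0 >-> R}} {n M L : nat} {S : R}
  {d : measure_display} {Omega : measurableType d} {Pr : probability Omega R}.
Variable X : ensemble E n M L S Pr.
Hypothesis L_gt0 : (0 < L)%N.
Hypothesis E_ge0 : forall t, 0 <= E t.
Variable m : nat.

Local Notation known J := [set: g_sigma_algebraType (sources (source_events X) J)].

Definition overdraft_event (w : 'I_M) : set Omega :=
  [set t | @overdraft R n M L m (fun w k => codebook X w k t) w (fun i => energy X i t)].

Definition not_message : set (source n M) := [set s | s <> message_source n M].

Lemma energy_not_message i : measurable_fun (known not_message) (energy X i).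
Proof.
have -> : energy X i = energy X (i %/ L * L)%N :> (Omega -> R).
  by apply/funext => t; exact: energy_block.
exact: energy_known.
Qed.

Lemma overdraft_not_message w :
  <<s sources (source_events X) not_message >> (overdraft_event w).
Proof.
rewrite (_ : overdraft_event w = \bigcup_l [set t |
  [/\ (m <= l)%N, (l * L < n)%N & harvest (L := L) (fun i => energy X i t) l <
    codeword_energy (L := L) (m := m) (fun w k => codebook X w k t) w l.+1]]); last first.
  by apply/seteqP; split => t [l]; [exists l|move=> _ ?; exists l].
apply: (@bigcupT_measurable _ (g_sigma_algebraType _)) => l.
have [/andP[ml ln]|nml] := boolP ((m <= l)%N && (l * L < n)%N); last first.
  rewrite (_ : [set t | _] = set0); first exact: (@measurable0 _ (g_sigma_algebraType _)).
  by apply/seteqP; split => // t [ml ln _]; move: nml; rewrite ml ln.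
rewrite (_ : [set t | _] = [set t | harvest (L := L) (fun i => energy X i t) l <
    codeword_energy (L := L) (m := m) (fun w k => codebook X w k t) w l.+1]); last first.
  by apply/seteqP; split => t => [[]|].
apply: (@measurable_set_ltr _ (g_sigma_algebraType _)).
  apply: (@measurable_sum _ (g_sigma_algebraType _)) => i.
  exact: energy_not_message.
rewrite /codeword_energy; under eq_fun do rewrite big_mkcond/=.
apply: (@measurable_sum _ (g_sigma_algebraType _)) => i.
case: (m * L <= i < l.+1 * L)%N; last exact: measurable_cst.
apply: (@measurable_funX _ (g_sigma_algebraType _)).
exact: codebook_known.
Qed.

(** The ensemble shares with [E] only its law, so pointwise nonnegativity of [E] transfers almost
    surely. *)
Lemma ae_energy_ge0 : {ae Pr, forall t, forall i, 0 <= energy X i t}.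
Proof.
apply: ae_foralln => i.
have mN : measurable [set t | energy X i t < 0] by exact: measurable_set_ltr.
exists [set t | energy X i t < 0]; split => //; last first.
  by move=> t /= /negP; rewrite -ltNge.
have mneg : measurable [set x : R | x < 0] by exact: measurable_set_ltr.
have -> : [set t | energy X i t < 0] = energy X (i %/ L * L)%N @^-1` [set x | x < 0].
  by apply/seteqP; split => t /=; rewrite -energy_block.
rewrite -[LHS]/(distribution Pr (energy X (i %/ L * L)%N) [set x | x < 0]).
rewrite (energy_law X _ mneg) /distribution /pushforward.
rewrite (_ : _ @^-1` _ = set0) ?measure0//.
by apply/seteqP; split => // t /=; rewrite ltNge E_ge0.
Qed.

Variables (w : 'I_M) (th ee : R).
Hypothesis S_gt0 : 0 < S.
Hypothesis th_gt0 : 0 < th.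
Hypothesis thS : th * S * 2 < 1.
Hypothesis Pr0_ee : (\int[Pr0]_t (expR (- (th * L%:R * E t)))%:E <= ee%:E)%E.
Hypothesis drift : ee * (Num.sqrt (1 - th * S * 2))^-1 ^+ L <= 1.

(** The factor that each source contributes to [expR (th * (codeword energy - harvested
    energy))]. *)
Let f (s : source n M) (t : Omega) : R :=
  match s with
  | block_source l => expR (- (th * L%:R * energy X (l * L)%N t))
  | symbol_source w k => expR (th * codebook X w k t ^+ 2)
  | _ => 1
  end.

Let block_symbols (l : nat) : seq 'I_n := [seq k : 'I_n <- enum 'I_n | (k %/ L == l)%N].

(** Time 0 gathers the arrivals of the first [m - 1] blocks; time [t + 1] adds the arrivals of block
    [m - 1 + t] and the symbols of block [m + t], which those arrivals must help to pay for.
    Different times use disjoint sources. *)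
Let ks (t : nat) : seq (source n M) :=
  if t is t'.+1 then
    block_source n M (m.-1 + t') ::
      [seq symbol_source w k | k <- block_symbols (m + t')]
  else [seq block_source n M j | j <- iota 0 m.-1].

Let f_known s : measurable_fun (known [set s]) (f s).
Proof.
case: s => [l|k|w' k||]; rewrite /f; try exact: measurable_cst.
- apply: (measurableT_comp (@measurable_expR R)).
  apply: (@measurableT_comp _ _ _ (g_sigma_algebraType _)) => //.
  apply: (@measurable_funM _ (g_sigma_algebraType _)) => //; exact: energy_known.
- apply: (measurableT_comp (@measurable_expR R)).
  apply: (@measurable_funM _ (g_sigma_algebraType _)) => //.
  by apply: (@measurable_funX _ (g_sigma_algebraType _)); exact: codebook_known.
Qed.

Let f_ge0 s t : 0 <= f s t.
Proof. by case: s => *; rewrite /f ?expR_ge0. Qed.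

Let integral_block l : (\int[Pr]_t (f (block_source n M l) t)%:E <= ee%:E)%E.
Proof.
rewrite /f (ge0_integral_energy X l (fun x => (expR (- (th * L%:R * x)))%:E))//.
apply: measurableT_comp => //; apply: (measurableT_comp (@measurable_expR R)).
by apply: measurableT_comp => //; exact: measurable_funM.
Qed.

Let integral_symbol k : (\int[Pr]_t (f (symbol_source w k) t)%:E =
  ((Num.sqrt (1 - th * S * 2))^-1)%:E)%E.
Proof.
rewrite /f (ge0_integral_codebook X w k (fun x => (expR (th * x ^+ 2))%:E))//.
- by rewrite integral_gauss_sqr_expR ?sqrtr_gt0// sqr_sqrtr// ltW.
- apply: measurableT_comp => //; apply: (measurableT_comp (@measurable_expR R)).
  by apply: measurable_funM => //; exact: measurable_funX.
Qed.

Let integral_prod_f s : uniq s ->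
  (\int[Pr]_t (\prod_(k <- s) f k t)%:E = \prod_(k <- s) \int[Pr]_t (f k t)%:E)%E.
Proof.
move=> us; apply: (ge0_integral_independent_prod Pr (source_events X)
  (source_events_measurable X) (source_eventsT X) (source_eventsI X)
  (source_events_indep X) _ s (fun k => [set k])) => //.
by move=> k k' _ _ kk'; apply/seteqP; split => // i [/= ->] /eqP; rewrite (negbTE kk').
Qed.

Let symbols_uniq t : uniq [seq symbol_source w k | k <- block_symbols (m + t)].
Proof. by rewrite map_inj_uniq ?filter_uniq -?enumT ?enum_uniq// => k k' []. Qed.

Let ks_uniq t : uniq (ks t).
Proof.
case: t => [|t]; first by rewrite map_inj_uniq ?iota_uniq// => k k' [].
rewrite /= symbols_uniq andbT; apply/negP => /mapP[k _]; by [].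
Qed.

Let ks_disjoint s t : s != t -> [set` ks s] `&` [set` ks t] = set0.
Proof.
wlog st : s t / (s < t)%N.
  move=> hw; have [st _|ts _|//] := ltngtP s t.
    by apply: hw => //; rewrite ltn_eqF.
  by rewrite setIC; apply: hw => //; rewrite ltn_eqF.
move=> _; apply/seteqP; split => // a [/=].
case: t st => [//|t]; case: s => [|s] st.
  move=> /mapP[j]; rewrite mem_iota add0n => /andP[_ jm] ->.
  rewrite inE => /predU1P[[jE]|/mapP[k _]//].
  by move: jm; rewrite jE ltnNge leq_addr.
rewrite !inE => /predU1P[->|/mapP[k]].
  move=> /predU1P[[] /addnI stE|/mapP[k _]//].
  by move: st; rewrite stE ltnn.
rewrite mem_filter => /andP[/eqP kE _] -> /predU1P[//|/mapP[k']].
rewrite mem_filter => /andP[/eqP kE' _] [kk']; move: kE'; rewrite -kk' kE => /addnI stE.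
by move: st; rewrite stE ltnn.
Qed.

Let A t (o : Omega) : R := \prod_(k <- ks t) f k o.

Let count_block l : (size (block_symbols l) <= L)%N.
Proof.
rewrite -(size_map val) -[X in (_ <= X)%N](size_iota (l * L) L); apply: uniq_leq_size.
  by rewrite map_inj_uniq ?filter_uniq -?enumT ?enum_uniq//; exact: val_inj.
move=> i /mapP[k]; rewrite mem_filter => /andP[/eqP kl _] ->.
by rewrite mem_iota -kl leq_divM -mulSnr ltn_ceil.
Qed.

Let sq1 : 1 <= (Num.sqrt (1 - th * S * 2))^-1.
Proof.
rewrite invr_ge1 ?unitf_gt0 ?sqrtr_gt0 ?subr_gt0//.
rewrite -[leRHS]sqrtr1; apply: ler_wsqrtr.
by rewrite gerBl !mulr_ge0// ltW.
Qed.

(** An overdraft forces a partial product of the [A t] to reach 1. The hypothesis [drift] says that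
    one energy block offsets [L] symbols in exponential mean, so every later factor has mean at most
    1; the initial factor gives [ee] once per saved block. *)
Lemma overdraft_probability_le : (0 < m)%N ->
  (Pr (overdraft_event w) <= (ee ^+ m.-1)%:E)%E.
Proof.
move=> m0.
have A_known t : measurable_fun (known [set` ks t]) (A t).
  apply: (@measurable_prod _ (g_sigma_algebraType _)) => k kt.
  by apply: (measurable_knownS _ [set k]); [move=> i /= ->|exact: f_known].
have mA t : measurable_fun [set: Omega] (A t).
  exact: (measurable_known _ (source_events_measurable X) _ _ _ _ (A_known t)).
have A_ge0 t o : 0 <= A t o by apply: prodr_ge0.
have A_le1 t : (\int[Pr]_o (A t.+1 o)%:E <= 1)%E.
  rewrite integral_prod_f// big_cons big_map.
  under eq_bigr do rewrite integral_symbol.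
  apply: (@le_trans _ _ (ee * (Num.sqrt (1 - th * S * 2))^-1 ^+ L)%:E); last by rewrite lee_fin.
  rewrite EFinM; apply: lee_pmul => //.
  - by apply: integral_ge0 => o _; rewrite lee_fin f_ge0.
  - by apply: prode_ge0 => *; rewrite lee_fin (le_trans ler01).
  (* The last block may be shorter than [L], and those beyond it are empty; each symbol factor is at
     least 1, so [L] of them are an upper bound. *)
  - rewrite (_ : (\prod_(k <- _) _)%E = ((Num.sqrt (1 - th * S * 2))^-1 ^+
        size (block_symbols (m + t)))%:E).
      by rewrite lee_fin ler_weXn2l.
    elim: (block_symbols _) => [|k s IH]; first by rewrite big_nil.
    by rewrite big_cons IH -EFinM -exprS.
have A0 : (\int[Pr]_o (A 0%N o)%:E <= (ee ^+ m.-1)%:E)%E.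
  rewrite integral_prod_f// big_map -[in leRHS](size_iota 0 m.-1).
  elim: (iota 0 m.-1) => [|j s IH]; first by rewrite big_nil.
  rewrite big_cons exprS EFinM lee_pmul//.
    by apply: integral_ge0 => o _; rewrite lee_fin f_ge0.
  by apply: prode_ge0 => j' _; apply: integral_ge0 => o _; rewrite lee_fin f_ge0.
apply: (le_trans _ A0).
apply: (le_trans _ (maximal_inequality Pr (source_events X)
  (source_events_measurable X) (source_eventsT X) (source_eventsI X)
  (source_events_indep X) A (fun t => [set` ks t]) n.+1
  ks_disjoint A_known A_ge0 A_le1)).
apply: ae_measure_le.
- exact: (sigma_sources_measurable _ (source_events_measurable X) _ _ (overdraft_not_message w)).
- rewrite (_ : [set o | _] = \bigcup_t
    [set o | (t <= n.+1)%N /\ 1 <= \prod_(s < t.+1) A s o]); last first.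
    by apply/seteqP; split => o [t]; [exists t|move=> _ [? ?]; exists t].
  apply: bigcupT_measurable => t.
  have [tn|nt] := boolP (t <= n.+1)%N; last first.
    by rewrite (_ : [set o | _] = set0)//; apply/seteqP; split => // o [].
  rewrite (_ : [set o | _] = [set o | 1 <= \prod_(s < t.+1) A s o]); last first.
    by apply/seteqP; split => o => [[]|].
  by apply: measurable_set_ler => //; exact: measurable_prod.
case: ae_energy_ge0 => N [mN N0 sub]; exists N; split => //.
apply: subset_trans sub; apply: subsetC => o e0 [l [ml ln lt]].
(* At this time the product contains the symbols of blocks [m] to [l] and the arrivals of the blocks
   below [l]. *)
exists (l - m).+1.
  by rewrite ltnS (leq_trans (leq_subr _ _))// (leq_trans _ (ltnW ln))// leq_pmulr.
have prodA t : \prod_(s < t.+1) A s o = expR (th *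
    (codeword_energy (L := L) (m := m) (fun w k => codebook X w k o) w (m + t) -
     L%:R * \sum_(j < m.-1 + t) energy X (j * L)%N o)).
  elim: t => [|t IH].
    rewrite big_ord1 /A big_map -expR_sum; congr expR.
    rewrite !addn0 [codeword_energy _ _ _]big_pred0 ?sub0r; last first.
      by move=> k; case: leqP => // mk; rewrite ltnNge mk.
    rewrite mulrN mulrA mulr_sumr -sumrN -(big_mkord xpredT (fun j => - (th * L%:R * energy X (j * L)%N o))).
    by rewrite /index_iota subn0.
  rewrite big_ord_recr/= IH /A /= big_cons big_map -expR_sum -!expRD; congr expR.
  rewrite !addnS codeword_energyS// leq_addr big_ord_recr/=.
  rewrite -mulr_sumr [X in _ + (_ + th * X) = _](_ : _ =
    block_sqnorm L (fun k => codebook X w k o) (m + t)); last first.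
    by rewrite /block_symbols big_filter big_enum_cond; exact: eq_bigl.
  ring.
rewrite prodA -[leLHS]expR0 ler_expR; apply: mulr_ge0; first exact: ltW.
rewrite subr_ge0.
have -> : (m + (l - m).+1 = l.+1)%N by rewrite addnS subnKC.
have -> : (m.-1 + (l - m).+1 = l)%N by rewrite addnS -addSn prednK// subnKC.
have hE := sum_constant_blocks L l (fun i => energy X i o) (fun i => energy_block X i o).
(* [harvest l] also counts the first arrival of block [l], which is nonnegative and is dropped. *)
apply: le_trans (ltW lt); rewrite -[leLHS]hE.
by rewrite /harvest big_ord_recr/= lerDl.
Qed.

End overdraft_probability.

(** * Information density and decoding errors *)

Section log_likelihood.
Context {R : realType}.
Variables (S : R) (S_gt0 : 0 < S).

Lemma ln_likelihood_ratio (x y : R) :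
  ln (normal_pdf x 1 y / normal_pdf 0 (Num.sqrt (S + 1)) y) =
  1 / 2 * ln (1 + S) + (y ^+ 2 / (2 * (S + 1)) - (y - x) ^+ 2 / 2).
Proof.
have S1 : 0 < S + 1 by rewrite addr_gt0.
have r0 : 0 < Num.sqrt (S + 1) by rewrite sqrtr_gt0.
have pi0 : 0 < Num.sqrt (pi *+ 2 : R) by rewrite sqrtr_gt0 mulrn_wgt0// pi_gt0.
rewrite !normal_pdfE_gt0// subr0 sqr_sqrtr ?(ltW S1)//.
set eA := expR _; set eB := expR _; set p := Num.sqrt (pi *+ 2).
have -> : (1 * p)^-1 * eA / ((Num.sqrt (S + 1) * p)^-1 * eB) = Num.sqrt (S + 1) * (eA / eB).
  by field; rewrite !gt_eqF// expR_gt0.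
rewrite lnM ?posrE ?divr_gt0 ?expR_gt0// ln_div ?posrE ?expR_gt0// !expRK.
congr (_ + _); last by field; rewrite gt_eqF.
have -> : 1 + S = Num.sqrt (S + 1) ^+ 2 by rewrite sqr_sqrtr ?(ltW S1)// addrC.
by rewrite lnXn// [X in _ = _ * X]mulr2n; lra.
Qed.

Lemma likelihood_ratio_gt0 (x y : R) :
  0 < normal_pdf x 1 y / normal_pdf 0 (Num.sqrt (S + 1)) y.
Proof.
have r0 : 0 < Num.sqrt (S + 1) by rewrite sqrtr_gt0 addr_gt0.
have pi0 : 0 < Num.sqrt (pi *+ 2 : R) by rewrite sqrtr_gt0 mulrn_wgt0// pi_gt0.
by rewrite divr_gt0// normal_pdfE_gt0// mulr_gt0 ?expR_gt0// invr_gt0 mulr_gt0.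
Qed.

Lemma likelihood_ratioE (x y : R) :
  normal_pdf x 1 y / normal_pdf 0 (Num.sqrt (S + 1)) y =
  expR (1 / 2 * ln (1 + S) + (y ^+ 2 / (2 * (S + 1)) - (y - x) ^+ 2 / 2)).
Proof. by rewrite -ln_likelihood_ratio lnK// posrE likelihood_ratio_gt0. Qed.

(** [rot_c] and [rot_s] are the sine and cosine of half the angle whose cosine is [rot_b]. Hence
    [rot_s ^+ 2 - rot_c ^+ 2 = rot_b] and [2 * rot_c * rot_s = Num.sqrt (S / (1 + S))], which match
    the cross term and the difference of squares in the information density. *)
Definition rot_b : R := (Num.sqrt (1 + S))^-1.
Definition rot_c : R := Num.sqrt ((1 - rot_b) / 2).
Definition rot_s : R := Num.sqrt ((1 + rot_b) / 2).

Let r_gt0 : 0 < Num.sqrt (1 + S). Proof. by rewrite sqrtr_gt0 addr_gt0. Qed.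

Let b_gt0 : 0 < rot_b. Proof. by rewrite invr_gt0. Qed.

Let b_lt1 : rot_b < 1.
Proof. by rewrite invf_lt1// -[ltLHS]sqrtr1 ltr_sqrt ?addr_gt0// ltrDl. Qed.

Lemma rot_c_gt0 : 0 < rot_c.
Proof. by rewrite sqrtr_gt0 divr_gt0// subr_gt0. Qed.

Lemma rot_cs : rot_c ^+ 2 + rot_s ^+ 2 = 1.
Proof.
rewrite !sqr_sqrtr; first by field.
  by rewrite divr_ge0// addr_ge0// ltW.
by rewrite divr_ge0// subr_ge0 ltW.
Qed.

(* The quadratic form in (x / sqrt S, z) has eigenvalues of opposite signs, so
   after an orthogonal change of variables it is a product. *)
Lemma log_likelihood_product (x z : R) :
  (x + z) ^+ 2 / (2 * (S + 1)) - z ^+ 2 / 2 =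
  Num.sqrt (S / (1 + S)) *
    ((rot_c / Num.sqrt S * x + rot_s * z) * (rot_s / Num.sqrt S * x - rot_c * z)).
Proof.
have s0 : 0 < Num.sqrt S by rewrite sqrtr_gt0.
have S1 : 0 < 1 + S by rewrite addr_gt0.
have sS : Num.sqrt S ^+ 2 = S by rewrite sqr_sqrtr// ltW.
have rS : Num.sqrt (1 + S) ^+ 2 = 1 + S by rewrite sqr_sqrtr// ltW.
have aE : Num.sqrt (S / (1 + S)) = Num.sqrt S * rot_b.
  by rewrite sqrtrM ?(ltW S_gt0)// sqrtrV// ltW.
have c2 : rot_c ^+ 2 = (1 - rot_b) / 2 by rewrite sqr_sqrtr// divr_ge0// subr_ge0 ltW.
have s2 : rot_s ^+ 2 = (1 + rot_b) / 2 by rewrite sqr_sqrtr// divr_ge0// addr_ge0// ltW.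
have b2 : rot_b ^+ 2 = (1 + S)^-1 by rewrite exprVn rS.
have csE : rot_c * rot_s = Num.sqrt S * rot_b / 2.
  apply/eqP; rewrite -(@eqrXn2 _ 2)//; last 2 first.
  - by rewrite mulr_ge0// sqrtr_ge0.
  - by rewrite !mulr_ge0 ?sqrtr_ge0// ltW.
  rewrite exprMn c2 s2 !exprMn sS b2 exprVn; apply/eqP.
  rewrite (_ : (1 - rot_b) / 2 * ((1 + rot_b) / 2) = (1 - rot_b ^+ 2) / 4); last by field.
  by rewrite b2; field; rewrite gt_eqF.
set g := x / Num.sqrt S.
have xE : x = Num.sqrt S * g by rewrite /g mulrC divfK// gt_eqF.
have -> : rot_c / Num.sqrt S * x = rot_c * g by rewrite /g; ring.
have -> : rot_s / Num.sqrt S * x = rot_s * g by rewrite /g; ring.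
have -> : (rot_c * g + rot_s * z) * (rot_s * g - rot_c * z) =
  rot_c * rot_s * (g ^+ 2 - z ^+ 2) + (rot_s ^+ 2 - rot_c ^+ 2) * g * z by ring.
rewrite csE s2 c2 aE.
have -> : Num.sqrt S * rot_b * (Num.sqrt S * rot_b / 2 * (g ^+ 2 - z ^+ 2) +
   ((1 + rot_b) / 2 - (1 - rot_b) / 2) * g * z) =
   rot_b ^+ 2 * (Num.sqrt S ^+ 2 * g ^+ 2 / 2 - Num.sqrt S ^+ 2 * z ^+ 2 / 2 + Num.sqrt S * g * z).
  by field.
rewrite xE b2.
rewrite [(Num.sqrt S * g + z) ^+ 2](_ : _ = Num.sqrt S ^+ 2 * g ^+ 2 + 2 * Num.sqrt S * g * z + z ^+ 2); last by ring.
by rewrite sS; field; rewrite !gt_eqF// addrC.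
Qed.

End log_likelihood.

Section decoding.
Context {R : realType} {d0 : measure_display} {Omega0 : measurableType d0}
  {Pr0 : probability Omega0 R} {E : {RV Pr0 >-> R}} {n M L : nat} {S : R}
  {d : measure_display} {Omega : measurableType d} {Pr : probability Omega R}.
Variable X : ensemble E n M L S Pr.
Hypothesis S_gt0 : 0 < S.
Variables (m : nat) (xi : R).
Hypothesis xi_gt0 : 0 < xi.

Local Notation known J := [set: g_sigma_algebraType (sources (source_events X) J)].
Local Notation gamma := (gauss (0:R) 1).
Local Notation cb t := (fun w k => codebook X w k t).

Definition active : seq 'I_n := [seq k : 'I_n <- enum 'I_n | (m * L <= k)%N].

Lemma active_uniq : uniq active.
Proof. by rewrite filter_uniq// -?enumT enum_uniq. Qed.

Lemma size_active : size active = (n - m * L)%N.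
Proof.
rewrite size_filter -(count_map val (fun k => m * L <= k)%N) val_enum_ord.
elim: n => // k IHk; rewrite -addn1 iotaD count_cat IHk/= add0n addn0.
have [mk|km] := leqP (m * L) k; first by rewrite !addn1 subSn.
by rewrite addn0 addn1 (eqnP (ltnW km)); apply/esym/eqnP.
Qed.

(** Free of the energy arrivals: outputs at different instants depend on disjoint sources. *)
Definition ideal_output (w : 'I_M) (t : Omega) (k : 'I_n) : R :=
  codebook X w k t + noise X k t.

Definition ideal_score (w j : 'I_M) (t : Omega) : R :=
  st_score L m S (cb t) (ideal_output w t) j.

Let ratio (w j : 'I_M) (k : 'I_n) (t : Omega) : R :=
  normal_pdf (codebook X j k t) 1 (ideal_output w t k) /
  normal_pdf 0 (Num.sqrt (S + 1)) (ideal_output w t k).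

Let sqS_gt0 : 0 < Num.sqrt S. Proof. by rewrite sqrtr_gt0. Qed.

Let ideal_scoreE w j t : ideal_score w j t = \sum_(k <- active) ln (ratio w j k t).
Proof. by rewrite /active big_filter big_enum_cond. Qed.

Lemma measurable_likelihood_ratio d' (T : measurableType d') (f g : T -> R) :
  measurable_fun [set: T] f -> measurable_fun [set: T] g ->
  measurable_fun [set: T]
    (fun t => normal_pdf (f t) 1 (g t) / normal_pdf 0 (Num.sqrt (S + 1)) (g t)).
Proof.
move=> mf mg.
under eq_fun do rewrite likelihood_ratioE//.
apply: (measurableT_comp (@measurable_expR R)); apply: measurable_funD => //.
apply: measurable_funB; apply: measurable_funM => //; apply: measurable_funX => //.
exact: measurable_funB.
Qed.

Let ratio_known (J : set (source n M)) w j k : J (symbol_source w k) ->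
  J (symbol_source j k) -> J (noise_source n M k) -> measurable_fun (known J) (ratio w j k).
Proof.
move=> Jw Jj Jk; apply: (measurable_likelihood_ratio _ (g_sigma_algebraType _)).
  exact: codebook_known.
apply: (@measurable_funD _ (g_sigma_algebraType _)); first exact: codebook_known.
exact: noise_known.
Qed.

Let ratio_gt0 w j k t : 0 < ratio w j k t.
Proof. exact: likelihood_ratio_gt0. Qed.

Lemma measurable_ln_known (J : set (source n M)) (f : Omega -> R) :
  measurable_fun (known J) f -> measurable_fun (known J) (fun t => ln (f t)).
Proof. by move=> mf; exact: (measurableT_comp (@measurable_ln R)). Qed.

Lemma ideal_score_known w j : measurable_fun (known not_message) (ideal_score w j).
Proof.
rewrite (_ : ideal_score w j = (fun t => \sum_(k <- active) ln (ratio w j k t))); last first.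
  by apply/funext => t; exact: ideal_scoreE.
apply: (@measurable_sum _ (g_sigma_algebraType _)) => k.
by apply: measurable_ln_known; exact: ratio_known.
Qed.

Let instant (s : source n M) : option nat :=
  match s with symbol_source _ k => Some (val k) | noise_source k => Some k | _ => None end.

Let instant_disjoint (J : 'I_n -> set (source n M)) :
  (forall k s, J k s -> instant s = Some (val k)) ->
  forall k k', k != k' -> J k `&` J k' = set0.
Proof.
move=> Ji k k' kk'; apply/seteqP; split => // s [/Ji sk /Ji].
by rewrite sk => -[/val_inj kE]; move: kk'; rewrite kE eqxx.
Qed.

Definition missed_event (w : 'I_M) : set Omega := [set t | ideal_score w w t < ln xi].

Definition confusion_event (w : 'I_M) : set Omega :=
  [set t | exists2 j, j != w & ln xi <= ideal_score w j t].

Lemma missed_not_message w : <<s sources (source_events X) not_message >> (missed_event w).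
Proof.
apply: (@measurable_set_ltr _ (g_sigma_algebraType _)) => //; exact: ideal_score_known.
Qed.

Lemma confusion_not_message w :
  <<s sources (source_events X) not_message >> (confusion_event w).
Proof.
rewrite (_ : confusion_event w = \bigcup_(j in [set j | j != w]) [set t | ln xi <= ideal_score w j t]); last first.
  by apply/seteqP; split => t [j jw lj]; exists j.
apply: (@fin_bigcup_measurable _ (g_sigma_algebraType _)); first exact: finite_finset.
by move=> j _; apply: (@measurable_set_ler _ (g_sigma_algebraType _)) => //; exact: ideal_score_known.
Qed.

Let integral_ratio w j k : j != w -> (\int[Pr]_t (ratio w j k t)%:E = 1)%E.
Proof.
move=> jw.
pose h (x : R * R) : \bar R :=
  `|normal_pdf x.2 1 x.1 / normal_pdf 0 (Num.sqrt (S + 1)) x.1|%:E.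
have mh : measurable_fun [set: R * R] h.
  apply: measurableT_comp => //; apply: measurableT_comp => //.
  exact: measurable_likelihood_ratio.
pose J := [set s | s = symbol_source w k \/ s = noise_source n M k].
pose K := [set symbol_source j k : source n M].
have JK : J `&` K = set0.
  apply/seteqP; split => // s [/= Js Ks]; case: Js; rewrite Ks => -[]// jE.
  by move: jw; rewrite jE eqxx.
have mY : measurable_fun (known J) (fun t => ideal_output w t k).
  apply: (@measurable_funD _ (g_sigma_algebraType _)); first by apply: codebook_known; left.
  by apply: noise_known; right.
have mX : measurable_fun (known K) (codebook X j k) by exact: codebook_known.
transitivity (\int[Pr]_t h (ideal_output w t k, codebook X j k t))%E.
  by apply: eq_integral => t _; rewrite /h ger0_norm// ltW// ratio_gt0.
have h0 x : (0 <= h x)%E by rewrite lee_fin.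
apply: (etrans (ge0_integral_independent Pr (source_events X) (source_events_measurable X)
  (source_eventsT X) (source_eventsI X) (source_events_indep X) _ _ _ _ J K _ _ h JK mY mX mh h0)).
transitivity (\int[Pr]_(t in [set: Omega]) 1)%E; last by rewrite integral_cst//= probability_setT mule1.
apply: eq_integral => t _; set y := ideal_output w t k.
have mhy : measurable_fun [set: R] (fun x => h (y, x)).
  exact: (measurableT_comp mh (pair1_measurable _)).
rewrite (ge0_integral_codebook X j k (fun x => h (y, x)) mhy)//.
rewrite -[RHS](integral_gauss_likelihood_ratio _ y sqS_gt0).
apply: eq_integral => x _; rewrite /h /= sqr_sqrtr ?(ltW S_gt0)// ger0_norm//.
by rewrite divr_ge0// normal_pdf_ge0.
Qed.

(** A wrong codeword is independent of the output, so the exponential of its score is a product of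
    independent factors of mean 1. Markov's inequality gives [xi^-1] per competitor, and the union
    bound adds them. *)
Lemma confusion_probability_le w : (Pr (confusion_event w) <= (M%:R / xi)%:E)%E.
Proof.
pose A j := if j != w then [set t | ln xi <= ideal_score w j t] else set0.
have mA j : measurable (A j).
  rewrite /A; case: ifP => // _; apply: measurable_set_ler => //.
  exact: (measurable_known _ (source_events_measurable X) _ _ _ _ (ideal_score_known w j)).
have -> : confusion_event w = \big[setU/set0]_(j <- enum 'I_M) A j.
  apply/seteqP; split => t.
    by move=> [j jw lj]; apply/bigsetU_mem; exists j; rewrite ?mem_enum// /A jw.
  by move=> /bigsetU_mem[j _]; rewrite /A; case: ifP => // jw lj; exists j.
apply: (le_trans (measure_bigsetU_le _ _ _ mA)).
apply: (@le_trans _ _ (\sum_(j <- enum 'I_M) (xi^-1)%:E)%E); last first.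
  by rewrite sumEFin big_enum sumr_const card_ord -[_ *+ _]mulr_natl.
apply: lee_sum => j _; rewrite /A; case: ifPn => [jw|_]; last first.
  by rewrite measure0 lee_fin invr_ge0 ltW.
have mr k : measurable_fun [set: Omega] (ratio w j k).
  by apply: (measurable_known _ (source_events_measurable X) not_message); exact: ratio_known.
pose J k := [set s | [\/ s = symbol_source w k, s = noise_source n M k | s = symbol_source j k]].
have J_disj : forall k k', k != k' -> J k `&` J k' = set0.
  by apply: instant_disjoint => k s [->|->|->].
have E1 : (\int[Pr]_t (\prod_(k <- active) ratio w j k t)%:E = 1)%E.
  rewrite (ge0_integral_independent_prod Pr (source_events X) (source_events_measurable X)
    (source_eventsT X) (source_eventsI X) (source_events_indep X) _ active
    J (ratio w j)).
  - by rewrite big1// => k _; exact: integral_ratio.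
  - exact: active_uniq.
  - by move=> k k' _ _; exact: J_disj.
  - by move=> k _; apply: ratio_known; [apply: Or31|apply: Or33|apply: Or32].
  - by move=> k t; exact: ltW.
have -> : (xi^-1)%:E = (\int[Pr]_t (xi^-1 * \prod_(k <- active) ratio w j k t)%:E)%E.
  under eq_integral do rewrite EFinM.
  rewrite ge0_integralZl//; first by rewrite E1 mule1.
  - by apply: measurableT_comp => //; exact: measurable_prod.
  - by move=> t _; rewrite lee_fin; apply: prodr_ge0 => k _; exact: ltW.
  - by rewrite lee_fin invr_ge0 ltW.
apply: (measure_le_integral Pr).
- by move: (mA j); rewrite /A jw.
- by apply: measurable_funM => //; exact: measurable_prod.
- by move=> t; rewrite mulr_ge0 ?invr_ge0 ?(ltW xi_gt0)//; apply: prodr_ge0 => k _; exact: ltW.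
- move=> t /= lj; rewrite mulrC ler_pdivlMr// mul1r -[leLHS](lnK (_ : xi \is Num.pos))//.
  apply: (@le_trans _ _ (expR (ideal_score w j t))); first by rewrite ler_expR.
  rewrite ideal_scoreE expR_sum; apply: ler_prod => k _.
  by rewrite expR_ge0 lnK ?lexx// posrE.
Qed.

Let U (w : 'I_M) (k : 'I_n) (t : Omega) : R :=
  rot_c S / Num.sqrt S * codebook X w k t + rot_s S * noise X k t.

Let V (w : 'I_M) (k : 'I_n) (t : Omega) : R :=
  rot_s S / Num.sqrt S * codebook X w k t - rot_c S * noise X k t.

(** The normalised symbol and the noise are independent standard normals, and [(U, V)] is their
    image under a reflection. *)
Let standard_UV w k : standard_pair Pr (U w k) (V w k).
Proof.
move=> h mh h0.
pose J := [set symbol_source w k : source n M].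
pose K := [set noise_source n M k].
have JK : J `&` K = set0 by apply/seteqP; split => // s [/= ->].
have mx : measurable_fun (known J) (codebook X w k) by exact: codebook_known.
have mz : measurable_fun (known K) (noise X k) by exact: noise_known.
set c := rot_c S; set s := rot_s S; set v := Num.sqrt S.
pose h' (x : R * R) := h (c / v * x.1 + s * x.2, s / v * x.1 - c * x.2).
have mh' : measurable_fun [set: R * R] h'.
  by apply: measurable_fun_pair_comp => //; [apply: measurable_funD|apply: measurable_funB]; apply: measurable_funM.
apply: (etrans (ge0_integral_independent Pr (source_events X) (source_events_measurable X)
  (source_eventsT X) (source_eventsI X) (source_events_indep X) _ _ _ _ J K _ _ h' JK mx mz mh' (fun=> h0 _))).
pose G x := (\int[gamma]_z h' (x, z))%E.
have mG : measurable_fun [set: R] G.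
  rewrite /G; apply: (@measurable_integral_fst _ _ R R R gamma (fun x z => h' (x, z)) mh').
  by move=> *; exact: h0.
have G0 x : (0 <= G x)%E by apply: integral_ge0 => *; exact: h0.
transitivity (\int[Pr]_t G (codebook X w k t))%E.
  apply: eq_integral => t _.
  apply: (ge0_integral_noise X k (fun z => h' (codebook X w k t, z))); last by move=> ?; exact: h0.
  exact: (measurableT_comp mh' (pair1_measurable _)).
rewrite (ge0_integral_codebook X w k G mG G0).
apply: (etrans (ge0_integral_gauss_scale v G sqS_gt0 mG G0)).
apply: etrans (ge0_integral_normal_reflection c s h _ _ mh h0).
- apply: eq_integral => g _; apply: eq_integral => z _; rewrite /h' /=.
  have vg q : q / v * (v * g) = q * g by rewrite mulrA divfK// gt_eqF.
  by rewrite !vg.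
- by rewrite gt_eqF// rot_c_gt0.
- exact: rot_cs.
Qed.

(** The score of the true message is its mean plus [Num.sqrt (S / (1 + S))] times the sum of the
    products [U * V]; [c] is the threshold in these units. *)
Lemma missed_probability_le w (th r : R) : 0 <= th -> th * 2 < 1 -> 0 < r ->
  let c := (ln xi - (size active)%:R * (1 / 2 * ln (1 + S))) / Num.sqrt (S / (1 + S)) in
  c < 0 ->
  (Pr (missed_event w) <= (expR (- (th * r)) * (Num.sqrt (1 - th * 2))^-1 ^+ size active
     + Phi (c / Num.sqrt r))%:E)%E.
Proof.
move=> th0 th2 r0 c c0.
have a0 : 0 < Num.sqrt (S / (1 + S)) by rewrite sqrtr_gt0 divr_gt0// addr_gt0.
pose J k := [set s : source n M | s = symbol_source w k \/ s = noise_source n M k].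
have J_disj : forall k k', k != k' -> J k `&` J k' = set0.
  by apply: instant_disjoint => k s [->|->].
have U_known k : measurable_fun (known (J k)) (U w k).
  apply: (@measurable_funD _ (g_sigma_algebraType _)); apply: (@measurable_funM _ (g_sigma_algebraType _)) => //.
    by apply: codebook_known; left.
  by apply: noise_known; right.
have V_known k : measurable_fun (known (J k)) (V w k).
  apply: (@measurable_funB _ (g_sigma_algebraType _)); apply: (@measurable_funM _ (g_sigma_algebraType _)) => //.
    by apply: codebook_known; left.
  by apply: noise_known; right.
rewrite EFinD.
have -> : missed_event w = [set t | (\sum_(k <- active) U w k t * V w k t < c)%R].
  apply/seteqP; suff E1 t : ideal_score w w t = (size active)%:R * (1 / 2 * ln (1 + S)) +
      Num.sqrt (S / (1 + S)) * \sum_(k <- active) U w k t * V w k t.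
    by split => t; rewrite /missed_event /= E1 /c ltr_pdivlMr// mulrC => h; lra.
  rewrite ideal_scoreE mulr_sumr.
  under eq_bigr => k _ do rewrite /ratio ln_likelihood_ratio// {2}/ideal_output addrAC subrr add0r log_likelihood_product//.
  rewrite big_split/=; congr (_ + _).
  by rewrite big_const_seq count_predT iter_addr_0 mulr_natl.
apply: (le_trans (sum_product_tail Pr (source_events X) (source_events_measurable X)
  (source_eventsT X) (source_eventsI X) (source_events_indep X) J (U w) (V w)
  J_disj U_known V_known (standard_UV w) active c r active_uniq c0 r0)).
apply: leeD => //.
exact: (sum_sqr_tail Pr (source_events X) (source_events_measurable X)
  (source_eventsT X) (source_eventsI X) (source_events_indep X) J (U w) (V w)
  J_disj U_known (standard_UV w) active th r active_uniq th0 th2).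
Qed.

End decoding.

(** * From the three bad events to the code *)

Section reliability.
Context {R : realType} {d0 : measure_display} {Omega0 : measurableType d0}
  {Pr0 : probability Omega0 R} {E : {RV Pr0 >-> R}} {n M L : nat} {S : R}
  {d : measure_display} {Omega : measurableType d} {Pr : probability Omega R}.
Variable X : ensemble E n M L S Pr.
Hypothesis L_gt0 : (0 < L)%N.
Hypothesis M_gt0 : (0 < M)%N.
Hypothesis E_ge0 : forall t, 0 <= E t.
Variables (m : nat) (xi : R).

Local Notation cb t := (fun w k => codebook X w k t).
Local Notation en t := (fun i => energy X i t).

Let measurable_sum_cond (I : finType) (P : pred I) (f : I -> Omega -> R) :
  (forall i, measurable_fun [set: Omega] (f i)) ->
  measurable_fun [set: Omega] (fun t => \sum_(i | P i) f i t).
Proof.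
move=> mf; under eq_fun do rewrite big_mkcond/=.
by apply: measurable_sum => i; case: (P i).
Qed.

Let measurable_block w l : measurable_fun [set: Omega] (fun t => block_sqnorm L (cb t w) l).
Proof. by apply: measurable_sum_cond => k; exact: measurable_funX. Qed.

Let measurable_sendable (k : nat) w l (s : Omega -> R) : measurable_fun [set: Omega] s ->
  measurable_fun [set: Omega]
    (fun t => sendable L m (fun i : 'I_k.+1 => energy X i t) (cb t w) l (s t)).
Proof.
move=> ms; rewrite /sendable; case: (m <= l)%N => //=.
apply: measurable_fun_ler; first exact: measurable_block.
by apply: measurable_funB => //; exact: measurable_sum_cond.
Qed.

Let measurable_spent (k : nat) w l : measurable_fun [set: Omega]
  (fun t => spent L m (fun i : 'I_k.+1 => energy X i t) (cb t w) l).
Proof.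
elim: l => [|l IH] //=; apply: measurable_funD => //.
apply: measurable_fun_ifT => //; exact: measurable_sendable.
Qed.

Lemma measurable_st_input w (k : 'I_n) :
  measurable_fun [set: Omega] (fun t => @st_input R n M L m (cb t) w (en t) k).
Proof.
apply: measurable_fun_ifT => //; apply: measurable_sendable.
exact: measurable_spent.
Qed.

Let output w t (k : 'I_n) : R := @st_input R n M L m (cb t) w (en t) k + noise X k t.

Let score w j t : R := st_score L m S (cb t) (output w t) j.

Lemma measurable_st_score w j : 0 < S -> measurable_fun [set: Omega] (score w j).
Proof.
move=> S0; apply: measurable_sum_cond => k.
apply: (measurableT_comp (@measurable_ln R)); apply: measurable_likelihood_ratio => //.
by apply: measurable_funD => //; exact: measurable_st_input.
Qed.

Let decide (b : 'I_M -> bool) (v : 'I_M) : 'I_M :=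
  if [pick j | [forall i, b i == (i == j)]] is Some j then j else v.

Let error_event w : set Omega :=
  [set t | decide (fun j => ln xi <= score w j t) (guess X t) <> w].

(** The decision is a function of finitely many bits and the guess, so the event is a finite union
    over their values. *)
Let measurable_error w : 0 < S -> measurable (error_event w).
Proof.
move=> S0.
rewrite (_ : error_event w = \bigcup_(bv in [set bv : {ffun 'I_M -> bool} * 'I_M | decide bv.1 bv.2 <> w])
   ([set t | forall j, (ln xi <= score w j t) = bv.1 j] `&` guess X @^-1` [set bv.2])); last first.
  apply/seteqP; split => t.
    move=> et; exists ([ffun j => ln xi <= score w j t], guess X t) => /=; last first.
      by split => // j; rewrite ffunE.
    rewrite (_ : fun_of_fin _ = fun j => ln xi <= score w j t) //.
    by apply/funext => j; rewrite ffunE.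
  move=> [[b v] /= bv [bE gv]]; rewrite /error_event /= gv.
  by rewrite (_ : (fun j => ln xi <= score w j t) = b)//; apply/funext.
apply: fin_bigcup_measurable => [|[b v] _ /=]; first exact: finite_finset.
apply: measurableI; last exact: guess_measurable.
rewrite (_ : [set t | _] = \bigcap_(j in [set: 'I_M]) [set t | (ln xi <= score w j t) = b j]); last first.
  by apply/seteqP; split => t bt j; [move=> _; exact: bt|exact: (bt j I)].
apply: fin_bigcap_measurable => [|j _]; first exact: finite_finset.
have := measurable_fun_ler (measurable_cst (ln xi : R)) (measurable_st_score w j S0).
by move=> /(_ measurableT [set b j] I); rewrite setTI.
Qed.

Lemma decoding_errorE : decoding_error (save_and_transmit n M L m S xi)
    (energy X) (noise X) (message X) (fun t w k => codebook X w k t) (guess X) =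
  [set t | error_event (message X t) t].
Proof. by []. Qed.

(** Outside the three events the scores are the ideal ones and [w] alone passes the threshold, so
    the decoder returns [w] whatever the guess. *)
Lemma decoding_error_sub t : error_event (message X t) t ->
  overdraft_event X m (message X t) t \/
  missed_event X m xi (message X t) t \/ confusion_event X m xi (message X t) t.
Proof.
set w := message X t => et; apply: contrapT => /not_orP[nov /not_orP[nmiss nconf]].
have scoreE j : score w j t = ideal_score X m w j t.
  apply: eq_bigr => k mk; rewrite /output /ideal_output.
  by rewrite st_input_codeword.
apply: et; rewrite /decide; case: pickP => [j /forallP jP|/(_ w)/negbT/negP[]].
  have := jP w; rewrite scoreE leNgt.
  have -> : (ideal_score X m w w t < ln xi) = false by apply/negP.
  by move=> /eqP/esym/eqP.
apply/forallP => j; apply/eqP; rewrite scoreE; have [->|jw] := eqVneq j w.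
  by rewrite leNgt; apply/negP.
by apply/negP => lj; apply: nconf; exists j.
Qed.

Lemma ae_energy_constraint : {ae Pr, forall t, forall k : 'I_n,
  \sum_(i < n | (i <= k)%N) channel_input (save_and_transmit n M L m S xi)
     (energy X) (message X) (fun t w k => codebook X w k t) i t ^+ 2
   <= \sum_(i < k.+1) energy X i t}.
Proof.
case: (ae_energy_ge0 X E_ge0) => N [mN N0 sub]; exists N; split => //.
apply: subset_trans sub; apply: subsetC => t e0 k.
exact: (@st_input_causal R n M L m (cb t) (message X t) (en t) k).
Qed.

Let not_message_message : ~ not_message (message_source n M).
Proof. by apply. Qed.

(** A mismatch at instant [k] is an overdraft of its block: going back to the start of the block
    lowers the harvest, and going on to its end raises the codeword energy. *)
Lemma mismatch_probability_le (p : R) : 0 <= p ->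
  (forall w, Pr (overdraft_event X m w) <= p%:E)%E -> (Pr (mismatch X m) <= p%:E)%E.
Proof.
move=> p0 ovp.
apply: le_trans (message_cases_le X not_message (overdraft_event X m) p%:E M_gt0 _
  not_message_message (overdraft_not_message X m) ovp); last by rewrite lee_fin.
apply: ae_measure_le.
- pose A w := [set t | exists k : 'I_n, (m * L <= k)%N /\
    \sum_(i < k.+1) energy X i t < \sum_(i < n | (m * L <= i <= k)%N) codebook X w i t ^+ 2].
  rewrite (_ : mismatch X m = [set t | A (message X t) t])//.
  apply: measurable_message_cases => w.
  rewrite (_ : A w = \bigcup_(k in [set k : 'I_n | (m * L <= k)%N]) [set t |
    \sum_(i < k.+1) energy X i t < \sum_(i < n | (m * L <= i <= k)%N) codebook X w i t ^+ 2]); last first.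
    by apply/seteqP; split => t; [move=> [k [mk lt]]|move=> [k mk lt]]; exists k.
  apply: fin_bigcup_measurable => [|k _]; first exact: finite_finset.
  apply: measurable_set_ltr; first exact: measurable_sum_cond.
  by apply: measurable_sum_cond => i; exact: measurable_funX.
- apply: measurable_message_cases => w.
  exact: (sigma_sources_measurable _ (source_events_measurable X) _ _ (overdraft_not_message X m w)).
case: (ae_energy_ge0 X E_ge0) => N [mN N0 sub]; exists N; split => //.
apply: subset_trans sub; apply: subsetC => t e0 [k [mk lt]].
exists (k %/ L)%N; split.
- by rewrite leq_divRL.
- exact: leq_ltn_trans (leq_divM _ _) (ltn_ord k).
- apply: le_lt_trans (lt_le_trans lt _).
    by apply: ler_sum_prefix => //; rewrite ltnS leq_divM.
  rewrite /codeword_energy big_mkcond [leRHS]big_mkcond; apply: ler_sum => i _.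
  case: ifP => [/andP[-> ik]|_]; last by case: ifP => // _; exact: sqr_ge0.
  by rewrite (leq_ltn_trans ik)//= ltn_ceil.
Qed.

Lemma save_and_transmit_reliable (pm pl pc eps : R) : 0 < S -> 0 < xi ->
  0 <= pm -> 0 <= pl -> M%:R / xi <= pc -> pm + pl + pc <= eps ->
  (forall w, Pr (overdraft_event X m w) <= pm%:E)%E ->
  (forall w, Pr (missed_event X m xi w) <= pl%:E)%E ->
  is_save_and_transmit_code X m xi eps.
Proof.
move=> S0 xi0 pm0 pl0 Mxi sum_le ovp missp; split; first exact: ae_energy_constraint.
rewrite decoding_errorE.
have sigmam := sigma_sources_measurable _ (source_events_measurable X).
have mov : measurable [set t | overdraft_event X m (message X t) t].
  by apply: measurable_message_cases => w; exact: (sigmam _ _ (overdraft_not_message X m w)).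
have mmiss : measurable [set t | missed_event X m xi (message X t) t].
  by apply: measurable_message_cases => w; exact: (sigmam _ _ (missed_not_message X S0 m xi w)).
have mconf : measurable [set t | confusion_event X m xi (message X t) t].
  by apply: measurable_message_cases => w; exact: (sigmam _ _ (confusion_not_message X S0 m xi w)).
have nm := not_message_message.
have pc0 : 0 <= pc by rewrite (le_trans _ Mxi)// divr_ge0// ltW.
have le1 : (Pr [set t | overdraft_event X m (message X t) t] <= pm%:E)%E.
  by apply: (message_cases_le X not_message _ _ M_gt0 _ nm (overdraft_not_message X m) ovp); rewrite lee_fin.
have le2 : (Pr [set t | missed_event X m xi (message X t) t] <= pl%:E)%E.
  by apply: (message_cases_le X not_message _ _ M_gt0 _ nm (missed_not_message X S0 m xi) missp); rewrite lee_fin.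
have le3 : (Pr [set t | confusion_event X m xi (message X t) t] <= pc%:E)%E.
  apply: (message_cases_le X not_message _ _ M_gt0 _ nm (confusion_not_message X S0 m xi)).
    by rewrite lee_fin.
  by move=> w; rewrite (le_trans (confusion_probability_le X S0 m xi xi0 w))// lee_fin.
apply: (@le_trans _ _ (pm%:E + (pl%:E + pc%:E))%E); last first.
  by rewrite -!EFinD lee_fin addrA.
apply: (@le_trans _ _ (Pr ([set t | overdraft_event X m (message X t) t] `|`
  ([set t | missed_event X m xi (message X t) t] `|`
   [set t | confusion_event X m xi (message X t) t]))%classic)).
  apply: le_measure; rewrite ?inE.
  - by apply: measurable_message_cases => w; exact: measurable_error.
  - by apply: measurableU => //; exact: measurableU.
  - move=> t et; have [h|[h|h]] := decoding_error_sub t et.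
    + by left.
    + by right; left.
    + by right; right.
apply: (le_trans (measureU2 _ mov (measurableU _ _ mmiss mconf))).
apply: leeD => //; apply: (le_trans (measureU2 _ mmiss mconf)); exact: leeD.
Qed.

End reliability.

(** * Choice of the parameters *)

Section exponential_bounds.
Context {R : realType}.
Implicit Types x y : R.

Lemma expR_ge_quadratic x : 0 <= x -> 1 + x + x ^+ 2 / 2 <= expR x.
Proof.
move=> x0.
have nd : nondecreasing_seq (series (exp_coeff x)).
  by apply: nondecreasing_series => i _ _; rewrite /exp_coeff /= divr_ge0// exprn_ge0.
have := nondecreasing_cvgn_le nd (is_cvg_series_exp_coeff x) 3.
rewrite /expR; apply: le_trans.
rewrite /series /= big_mkord !big_ord_recr big_ord0 /exp_coeff /=.
by rewrite add0r expr0 expr1 fact0 !divr1.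
Qed.

Lemma expRN_le_quadratic x : 0 <= x -> expR (- x) <= 1 - x + x ^+ 2 / 2.
Proof.
move=> x0; have e := expR_ge_quadratic x x0.
have p0 : 0 < 1 + x + x ^+ 2 / 2 by have := sqr_ge0 x; lra.
rewrite expRN; apply: (@le_trans _ _ (1 + x + x ^+ 2 / 2)^-1).
  by rewrite lef_pV2// posrE ?expR_gt0.
rewrite -[leLHS]mul1r ler_pdivrMr//.
have -> : (1 - x + x ^+ 2 / 2) * (1 + x + x ^+ 2 / 2) = 1 + (x ^+ 2) ^+ 2 / 4 by field.
by rewrite lerDl divr_ge0// sqr_ge0.
Qed.

Lemma expRN_ge_quadratic x : x <= 2 -> 1 - x + x ^+ 2 / 4 <= expR (- x).
Proof.
move=> x2; have -> : 1 - x + x ^+ 2 / 4 = (1 - x / 2) ^+ 2 by field.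
have -> : expR (- x) = expR (- (x / 2)) ^+ 2.
  by rewrite -expRM_natl; congr expR; field.
rewrite lerXn2r ?nnegrE ?expR_ge0//; first by lra.
by have := expR_ge1Dx (- (x / 2)); lra.
Qed.

(** The logarithm of the left side is [y + y ^+ 2] plus terms of third order; 5/4 instead of 1
    absorbs these on the given range. *)
Lemma invsqrt_le_expR y : 0 <= y <= 1 / 20 ->
  (Num.sqrt (1 - y * 2))^-1 <= expR (y + 5 / 4 * y ^+ 2).
Proof.
move=> /andP[y0 y1].
have s0 : 0 < 1 - y * 2 by lra.
rewrite -[leRHS]invrK -expRN lef_pV2 ?posrE ?sqrtr_gt0 ?expR_gt0//.
rewrite -[leLHS]ger0_norm ?expR_ge0// -sqrtr_sqr ler_sqrt ?(ltW s0)//.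
rewrite -expRM_natl; set u := 2 * y + 5 / 2 * y ^+ 2.
have -> : 2%:R * - (y + 5 / 4 * y ^+ 2) = - u by rewrite /u; field.
have u0 : 0 <= u by rewrite /u; have := sqr_ge0 y; lra.
apply: (le_trans (expRN_le_quadratic u u0)).
suff : 0 <= y ^+ 2 * (1 / 2 - 5 * y - 25 / 8 * y ^+ 2).
  by move=> h; rewrite /u; lra.
rewrite mulr_ge0 ?sqr_ge0//.
have : y ^+ 2 <= (1 / 20) ^+ 2 by rewrite lerXn2r ?nnegrE//; lra.
lra.
Qed.

Lemma ln1B_ge y : 0 <= y <= 2 / 5 -> - y - y ^+ 2 <= ln (1 - y).
Proof.
move=> /andP[y0 y1].
have s0 : 0 < 1 - y by lra.
rewrite -ler_expR lnK ?posrE//; set u := y + y ^+ 2.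
have -> : - y - y ^+ 2 = - u by rewrite /u; ring.
have u0 : 0 <= u by rewrite /u; have := sqr_ge0 y; lra.
apply: (le_trans (expRN_le_quadratic u u0)).
suff : 0 <= y ^+ 2 * (1 / 2 - y - y ^+ 2 / 2).
  by move=> h; rewrite /u; lra.
rewrite mulr_ge0 ?sqr_ge0//.
have : y ^+ 2 <= (2 / 5) ^+ 2 by rewrite lerXn2r ?nnegrE//; lra.
lra.
Qed.

(** To second order the exponent could contain the variance [q - p ^+ 2]. A quarter of this gain is
    kept, which leaves room for the higher orders; it is here that the mean is subtracted from the
    second moment. *)
Lemma quadratic_le_expRN (t p q : R) : 0 <= t -> 0 < p -> t * q <= p / 2 -> t * p <= 1 -> 0 <= q ->
  1 - t * p + t ^+ 2 * q / 2 <= expR (- (t * p - t ^+ 2 * (q - p ^+ 2 / 4) / 2)).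
Proof.
move=> t0 p0 tq tp q0; set x := t * p - _.
have t2 : t ^+ 2 * q <= t * p / 2 by rewrite expr2 -mulrA -mulrA ler_wpM2l.
have tp0 : 0 <= t * p by rewrite mulr_ge0// ltW.
have tp2 : (t * p) ^+ 2 <= 1 by rewrite exprn_ile1.
have xE : x = t * p - t ^+ 2 * q / 2 + (t * p) ^+ 2 / 8 by rewrite /x; field.
have x2 : x <= 2 by rewrite xE; have := mulr_ge0 (sqr_ge0 t) q0; lra.
have xlo : 3 / 4 * (t * p) <= x by rewrite xE; have := sqr_ge0 (t * p); lra.
have xx : 9 / 16 * (t * p) ^+ 2 <= x ^+ 2.
  have -> : 9 / 16 * (t * p) ^+ 2 = (3 / 4 * (t * p)) ^+ 2 by field.
  by rewrite lerXn2r ?nnegrE//; lra.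
apply: le_trans (expRN_ge_quadratic x x2).
have := sqr_ge0 (t * p); move: xE xx; clearbody x; lra.
Qed.

End exponential_bounds.

(** * Moments and Laplace transform of the energy *)

Section energy_moments.
Context {R : realType} {d : measure_display} {T : measurableType d}
  {Pr : probability T R} (E : {RV Pr >-> R}) (P E2 : R).
Hypothesis E_ge0 : forall t, 0 <= E t.
Hypothesis EP : ('E_Pr[E] = P%:E)%E.
Hypothesis EE2 : ('E_Pr[(fun t => E t ^+ 2)%R] = E2%:E)%E.

Let mE : measurable_fun [set: T] E. Proof. exact: measurable_funPT. Qed.

Let intE : (\int[Pr]_t (E t)%:E = P%:E)%E.
Proof. by rewrite -EP unlock. Qed.

Let intE2 : (\int[Pr]_t (E t ^+ 2)%:E = E2%:E)%E.
Proof. by rewrite -EE2 unlock. Qed.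

Let mE2 : measurable_fun [set: T] (fun t => E t ^+ 2).
Proof. exact: measurable_funX. Qed.

Let int_affine (a b : R) : 0 <= a -> 0 <= b ->
  (\int[Pr]_t (a + b * E t ^+ 2)%:E = (a + b * E2)%:E)%E.
Proof.
move=> a0 b0.
have mb : measurable_fun [set: T] (fun t => (b * E t ^+ 2)%:E).
  by apply: measurableT_comp => //; exact: measurable_funM.
under eq_integral do rewrite EFinD EFinM.
rewrite ge0_integralD//=.
- rewrite integral_cst//= probability_setT mule1 ge0_integralZl//=.
  + by rewrite intE2.
  + by apply: measurableT_comp.
  + by move=> t _; rewrite lee_fin sqr_ge0.
- by move=> t _; rewrite lee_fin mulr_ge0// sqr_ge0.
Qed.

(** The inequality holds pointwise by completing a square; with [l = P / 2] it yields the positivity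
    of [E2]. *)
Lemma mean_le_second_moment (l : R) : 0 < l -> P <= l + E2 / (4 * l).
Proof.
move=> l0; rewrite -lee_fin -intE [E2 / _]mulrC -int_affine ?invr_ge0 ?mulr_ge0 ?(ltW l0)//.
apply: ge0_le_integral => //.
- by move=> t _; rewrite lee_fin.
- exact: measurableT_comp.
- apply: measurableT_comp => //; apply: measurable_funD => //; exact: measurable_funM.
- move=> t _; rewrite lee_fin -subr_ge0.
  have -> : l + (4 * l)^-1 * E t ^+ 2 - E t = (2 * l - E t) ^+ 2 / (4 * l).
    by field; rewrite gt_eqF.
  by rewrite divr_ge0 ?sqr_ge0// mulr_ge0// ltW.
Qed.

Lemma second_moment_gt0 : 0 < P -> 0 < E2.
Proof.
move=> P0; have P2 : 0 < P / 2 by lra.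
have := mean_le_second_moment (P / 2) P2; rewrite -[_ <= _]/(_ <= _) => h.
have : 0 < E2 / (4 * (P / 2)) by lra.
by rewrite pmulr_lgt0// invr_gt0; lra.
Qed.

Lemma integral_expRN_le (t : R) : 0 <= t ->
  (\int[Pr]_w (expR (- (t * E w)))%:E <= (1 - t * P + t ^+ 2 * E2 / 2)%:E)%E.
Proof.
move=> t0.
have mexp : measurable_fun [set: T] (fun w => (expR (- (t * E w)))%:E).
  apply: measurableT_comp => //; apply: (measurableT_comp (@measurable_expR R)).
  by apply: measurableT_comp => //; exact: measurable_funM.
have mtE : measurable_fun [set: T] (fun w => (t * E w)%:E).
  by apply: measurableT_comp => //; exact: measurable_funM.
(* The linear term changes sides so that every integrand is nonnegative. *)
suff : (\int[Pr]_w (expR (- (t * E w)))%:E + (t * P)%:E <= (1 + t ^+ 2 / 2 * E2)%:E)%E.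
  rewrite -leeBrDr// -EFinB => /le_trans; apply; rewrite lee_fin; lra.
have -> : (t * P)%:E = (\int[Pr]_w (t * E w)%:E)%E.
  under eq_integral do rewrite EFinM.
  rewrite ge0_integralZl//=.
  - by rewrite intE.
  - exact: measurableT_comp.
  - by move=> w _; rewrite lee_fin.
rewrite -ge0_integralD//; last by move=> w _; rewrite lee_fin mulr_ge0.
rewrite -int_affine//; last by rewrite divr_ge0// sqr_ge0.
apply: ge0_le_integral => //.
- by move=> w _; rewrite -EFinD lee_fin addr_ge0 ?expR_ge0// mulr_ge0.
- exact: emeasurable_funD.
- apply: measurableT_comp => //; apply: measurable_funD => //; exact: measurable_funM.
- move=> w _; rewrite -EFinD lee_fin.
  have := expRN_le_quadratic (t * E w) (mulr_ge0 t0 (E_ge0 w)); rewrite exprMn; lra.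
Qed.

End energy_moments.

(** * The Chernoff exponent and the saving phase *)

Section parameters.
Context {R : realType}.
Variables (P E2 lam : R) (L : nat) (rho : R).
Hypothesis P_gt0 : 0 < P.
Hypothesis E2_gt0 : 0 < E2.
Hypothesis lam_gt0 : 0 < lam.
Hypothesis L_gt0 : (0 < L)%N.
Hypothesis rho_gt0 : 0 < rho.
Hypothesis rho_lt1 : rho < 1.

Let l : R := L%:R.
Let S : R := (1 - rho) * P.
Let alpha : R := 2 * rho * P / (l * E2 + 3 * S ^+ 2).
Let beta : R := alpha / (1 + 63 * alpha * S).

(* Raising the Chernoff exponent from [alpha] to [(1 + slack) * alpha] keeps the
   drift nonpositive because the true variances are smaller than those entering
   [alpha]; it makes the mismatch probability smaller than [eps2] by a constant
   factor. *)
Definition slack : R := P ^+ 2 / (5 * (E2 + P ^+ 2)).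

Let c := slack.
Let th : R := (1 + c) * alpha.

Lemma slack_gt0 : 0 < c.
Proof. by rewrite divr_gt0 ?mulr_gt0 ?addr_gt0 ?exprn_gt0. Qed.

Lemma slack_le : c <= 1 / 5.
Proof.
have p2 : 0 < P ^+ 2 by rewrite exprn_gt0.
rewrite ler_pdivrMr ?mulr_gt0 ?addr_gt0//. have := E2_gt0; lra.
Qed.

Lemma slack_mul_le : c * E2 <= P ^+ 2 / 5.
Proof.
have p2 : 0 < P ^+ 2 by rewrite exprn_gt0.
rewrite /c /slack mulrAC ler_pdivrMr ?mulr_gt0 ?addr_gt0//.
have -> : P ^+ 2 / 5 * (5 * (E2 + P ^+ 2)) = P ^+ 2 * E2 + P ^+ 2 ^+ 2 by field.
by rewrite lerDl sqr_ge0.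
Qed.

Let l_ge1 : 1 <= l. Proof. by rewrite /l ler1n. Qed.
Let l_gt0 : 0 < l. Proof. exact: lt_le_trans ltr01 l_ge1. Qed.

Lemma variance_gt0 : 0 < S.
Proof. by rewrite mulr_gt0// subr_gt0. Qed.

Let S_gt0 := variance_gt0.

Let S_leP : S <= P.
Proof. by rewrite /S mulrBl mul1r gerBl mulr_ge0// ltW. Qed.

Let den_gt0 : 0 < l * E2 + 3 * S ^+ 2.
Proof.
apply: addr_gt0; apply: mulr_gt0 => //; apply: exprn_gt0; exact: S_gt0.
Qed.

Let alpha_gt0 : 0 < alpha.
Proof. by rewrite divr_gt0 ?mulr_gt0. Qed.

Let alpha_den : alpha * (l * E2 + 3 * S ^+ 2) = 2 * rho * P.
Proof. by rewrite divfK// gt_eqF. Qed.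

Let tau_le : alpha * l * E2 <= 2 * rho * P.
Proof.
rewrite -alpha_den -mulrA; apply: ler_wpM2l; first exact: ltW.
by rewrite lerDl mulr_ge0// sqr_ge0.
Qed.

Let P_ge0 : 0 <= P. Proof. exact: ltW. Qed.
Let E2_ge0 : 0 <= E2. Proof. exact: ltW. Qed.
Let alpha_ge0 : 0 <= alpha. Proof. exact: ltW. Qed.
Let S_ge0 : 0 <= S. Proof. exact: ltW. Qed.
Let c_ge0 : 0 <= c. Proof. exact/ltW/slack_gt0. Qed.

Let th_gt0 : 0 < th.
Proof. by rewrite mulr_gt0// addr_gt0// slack_gt0. Qed.

Let th_ge0 : 0 <= th. Proof. exact: ltW. Qed.

Let t_le : th * l * E2 <= 12 / 5 * rho * P.
Proof.
have := slack_le; have := tau_le; rewrite /th => h1 h2.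
have -> : (1 + c) * alpha * l * E2 = (1 + c) * (alpha * l * E2) by ring.
apply: (@le_trans _ _ (6 / 5 * (2 * rho * P))); last by lra.
apply: ler_pM => //.
- by rewrite addr_ge0.
- by do ![apply: mulr_ge0 => //].
- lra.
Qed.

Hypothesis rho_le1 : rho <= 1 / 5.
Hypothesis rho_le2 : rho <= E2 / (48 * P ^+ 2).

Let rhoP2 : 48 * rho * P ^+ 2 <= E2.
Proof.
have p2 : 0 < 48 * P ^+ 2 by rewrite mulr_gt0// exprn_gt0.
by move: rho_le2; rewrite ler_pdivlMr// mulrCA mulrA.
Qed.

Let t_lP : th * l * P <= 1 / 20.
Proof.
have h : th * l * E2 * P <= 12 / 5 * rho * P * P by apply: ler_wpM2r; [exact: ltW|exact: t_le].
rewrite -(ler_pM2r E2_gt0); move: h rhoP2; lra.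
Qed.

Lemma tilt_le : th * S * 2 < 1.
Proof.
have : th * S <= th * l * P.
  apply: ler_pM => //.
  by rewrite -[leLHS]mulr1 ler_pM2l.
have := t_lP; lra.
Qed.

Let thS_le : 0 <= th * S <= 1 / 20.
Proof.
rewrite mulr_ge0//=; apply: le_trans t_lP.
apply: ler_pM => //.
by rewrite -[leLHS]mulr1 ler_pM2l.
Qed.

(** An upper bound on the Laplace transform of the energy of one block, as an exponential so that
    powers and products only add exponents. *)
Definition block_decay : R := expR (- (th * l * P - (th * l) ^+ 2 * (E2 - P ^+ 2 / 4) / 2)).

Lemma block_decay_ge : 1 - th * l * P + (th * l) ^+ 2 * E2 / 2 <= block_decay.
Proof.
apply: quadratic_le_expRN => //.
- by rewrite mulr_ge0.
- by apply: (le_trans t_le); have : rho * P <= 1 / 5 * P; [by apply: ler_wpM2r|have := P_gt0; lra].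
- by apply: (le_trans t_lP); lra.
Qed.

Lemma block_drift : block_decay * (Num.sqrt (1 - th * S * 2))^-1 ^+ L <= 1.
Proof.
have w := invsqrt_le_expR (th * S) thS_le.
apply: (@le_trans _ _ (block_decay * expR (th * S + 5 / 4 * (th * S) ^+ 2) ^+ L)).
  apply: ler_wpM2l; first exact: expR_ge0.
  by apply: lerXn2r; rewrite ?nnegrE ?expR_ge0// invr_ge0 sqrtr_ge0.
rewrite -expRM_natl -expRD -[leRHS]expR0 ler_expR -/l.
have -> : - (th * l * P - (th * l) ^+ 2 * (E2 - P ^+ 2 / 4) / 2) +
   l * (th * S + 5 / 4 * (th * S) ^+ 2) =
   th * l / 2 * (th * (l * (E2 - P ^+ 2 / 4) + 5 / 2 * S ^+ 2) - 2 * rho * P).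
  by rewrite /S; field.
apply: mulr_ge0_le0; first by rewrite divr_ge0// mulr_ge0.
(* By the choice of [alpha], [2 * rho * P] is [alpha] times the second moments
   [l * E2 + 3 * S ^+ 2], so [alpha] cancels. *)
rewrite subr_le0 -alpha_den /th [leLHS](_ : _ = alpha * ((1 + c) * (l * (E2 - P ^+ 2 / 4) + 5 / 2 * S ^+ 2))); last by ring.
apply: ler_wpM2l; first exact: ltW.
have c1 := slack_le; have c2 := slack_mul_le; have c0 := slack_gt0.
(* The factor 5 in [slack] comes from here: [c <= 1 / 5] raises 5/2 to at most 3, and
   [c * E2 <= P ^+ 2 / 5] stays below the gain [P ^+ 2 / 4]. *)
have h1 : (1 + c) * (5 / 2 * S ^+ 2) <= 3 * S ^+ 2.
  rewrite mulrA; apply: ler_wpM2r; [exact: sqr_ge0|lra].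
have h2 : (1 + c) * (E2 - P ^+ 2 / 4) <= E2.
  have : 0 <= c * P ^+ 2 by rewrite mulr_ge0 ?sqr_ge0// ltW.
  have : 0 <= P ^+ 2 by exact: sqr_ge0.
  lra.
have h3 : l * ((1 + c) * (E2 - P ^+ 2 / 4)) <= l * E2 by rewrite ler_pM2l.
lra.
Qed.

Hypothesis rho_le3 : rho <= c / 10.
Hypothesis rho_le4 : rho <= lam * E2 * c / (32 * P ^+ 2).

Let denom : R := l * P * beta + l ^+ 2 * alpha ^+ 2 * E2 / 2.

Lemma beta_gt0 : 0 < beta.
Proof.
by apply: divr_gt0 => //; apply: addr_gt0 => //; do ![apply: mulr_gt0 => //].
Qed.

Lemma denom_gt0 : 0 < denom.
Proof.
apply: addr_gt0; first by apply: mulr_gt0; [exact: mulr_gt0|exact: beta_gt0].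
by apply: divr_gt0 => //; do ![apply: mulr_gt0 => //]; exact: exprn_gt0.
Qed.

Let beta_le : beta <= alpha.
Proof.
rewrite ler_pdivrMr; last by apply: addr_gt0 => //; do ![apply: mulr_gt0 => //].
by rewrite mulrDr mulr1 lerDl; do ![apply: mulr_ge0 => //].
Qed.

(** [beta <= alpha] handles the first term, and the quadratic term is at most a fraction [rho] of
    [alpha * l * P]. *)
Lemma saving_rate_le (e : R) : rho <= e -> denom <= alpha * l * P * (1 + e).
Proof.
move=> re; rewrite mulrDr mulr1; apply: lerD.
  have -> : alpha * l * P = l * P * alpha by ring.
  by apply: ler_wpM2l => //; exact: mulr_ge0.
have -> : l ^+ 2 * alpha ^+ 2 * E2 / 2 = alpha * l * (alpha * l * E2 / 2) by field.
rewrite -[leRHS]mulrA; apply: ler_wpM2l; first by rewrite mulr_ge0.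
apply: (@le_trans _ _ (P * rho)); first by have := tau_le; lra.
by rewrite ler_pM2l.
Qed.

Variable m : nat.
Hypothesis m_ge : lam / denom <= m%:R.

Let m_large : 8 <= c * m%:R.
Proof.
have c0 := slack_gt0; have p2 : 0 < P ^+ 2 by rewrite exprn_gt0.
have d1 := saving_rate_le 1 (ltW rho_lt1).
have -> : 8 = c * (8 / c) :> R by rewrite mulrCA divff ?mulr1// gt_eqF.
rewrite ler_pM2l//; apply: le_trans m_ge.
rewrite ler_pdivrMr// mulrAC ler_pdivlMr ?denom_gt0//.
apply: (@le_trans _ _ (8 * (alpha * l * P * (1 + 1)))); first by rewrite ler_pM2l.
rewrite -(ler_pM2r E2_gt0).
have h1 : alpha * l * E2 * P <= 2 * rho * P * P by apply: ler_wpM2r; [exact: ltW|exact: tau_le].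
have h2 : rho * (32 * P ^+ 2) <= lam * E2 * c by rewrite -ler_pdivlMr// mulr_gt0.
have -> : lam * c * E2 = lam * E2 * c by ring.
apply: le_trans h2; lra.
Qed.

Lemma save_blocks_gt0 : (0 < m)%N.
Proof.
by rewrite lt0n; apply/eqP => m0; have := m_large; rewrite m0 mulr0; lra.
Qed.

(** Of the gain [1 + c] in the exponent, three losses of relative size [c / 8] are deducted: the
    quadratic term of [block_decay], the block lost in passing from [m] to [m - 1], and the excess
    of [denom] over [alpha * l * P]. A gain of [1 + c / 2] remains. *)
Lemma initial_decay : block_decay ^+ m.-1 <= expR (- ((1 + c / 2) * lam)).
Proof.
have c0 := slack_gt0; have c1 := slack_le; have m0 := save_blocks_gt0.
rewrite /block_decay -expRM_natl ler_expR mulrN lerN2.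
set tau := alpha * l * P.
have tau0 : 0 < tau by do ![apply: mulr_gt0 => //].
have tau0' : 0 <= tau by exact: ltW.
have e8 : rho <= c / 8 by have := rho_le3; lra.
have dle := saving_rate_le (c / 8) e8.
have tE : 0 <= th * l by rewrite mulr_ge0.
have h1 : (1 + c) * tau * (1 - c / 8) <= th * l * P - (th * l) ^+ 2 * (E2 - P ^+ 2 / 4) / 2.
  have q1 : (th * l) ^+ 2 * (E2 - P ^+ 2 / 4) <= (th * l) * (th * l * E2).
    rewrite expr2 -mulrA; apply: ler_wpM2l => //; apply: ler_wpM2l => //.
    by rewrite gerBl divr_ge0// sqr_ge0.
  have q2 : (th * l) * (th * l * E2) <= (th * l) * (c / 4 * P).
    apply: ler_wpM2l => //; apply: (le_trans t_le); apply: ler_wpM2r; first exact: ltW.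
    have := rho_le3; lra.
  have -> : (1 + c) * tau * (1 - c / 8) = th * l * P * (1 - c / 8).
    by rewrite /th /tau; ring.
  lra.
have h2 : m%:R * (1 - c / 8) <= (m.-1)%:R :> R.
  rewrite -subn1 natrB//; have := m_large; lra.
have h3 : lam <= m%:R * (tau * (1 + c / 8)).
  apply: (@le_trans _ _ (m%:R * denom)); last by rewrite ler_wpM2l.
  by rewrite -ler_pdivrMr// denom_gt0.
have c8 : 0 <= 1 - c / 8 by lra.
apply: (@le_trans _ _ (m%:R * (1 - c / 8) * ((1 + c) * tau * (1 - c / 8)))); last first.
  have f1 : 0 <= m%:R * (1 - c / 8) by exact: mulr_ge0.
  have f2 : 0 <= 1 + c by exact: addr_ge0.
  have f3 : 0 <= (1 + c) * tau * (1 - c / 8) by do ![apply: mulr_ge0 => //].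
  exact: ler_pM.
have h4 : (1 + c / 2) * (1 + c / 8) <= (1 + c) * (1 - c / 8) ^+ 2.
  rewrite -subr_ge0.
  have -> : (1 + c) * (1 - c / 8) ^+ 2 - (1 + c / 2) * (1 + c / 8) =
     c * (1 / 8 - 19 / 64 * c + c ^+ 2 / 64) by field.
  by rewrite mulr_ge0 ?(ltW c0)//; have := sqr_ge0 c; lra.
apply: (@le_trans _ _ (m%:R * tau * ((1 + c / 2) * (1 + c / 8)))).
  have -> : m%:R * tau * ((1 + c / 2) * (1 + c / 8)) = (1 + c / 2) * (m%:R * (tau * (1 + c / 8))) by ring.
  by apply: ler_wpM2l h3; lra.
have -> : m%:R * (1 - c / 8) * ((1 + c) * tau * (1 - c / 8)) = m%:R * tau * ((1 + c) * (1 - c / 8) ^+ 2) by ring.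
by apply: ler_wpM2l h4; rewrite mulr_ge0// ltW.
Qed.

End parameters.

(** * Back-off, saving length and rate *)

Section rate.
Context {R : realType}.
Variables (P E2 lam : R) (L n : nat).
Hypothesis P_gt0 : 0 < P.
Hypothesis E2_gt0 : 0 < E2.
Hypothesis lam_gt0 : 0 < lam.
Hypothesis L_gt0 : (0 < L)%N.
Hypothesis n_gt0 : (0 < n)%N.

Let l : R := L%:R.
Let N : R := n%:R.

Definition back_off : R :=
  Num.sqrt ((P + 1) * (l * E2 + 3 * P ^+ 2) * ln (1 + P) * lam) / (P * Num.sqrt (2 * N * P)).

Let rho := back_off.

Let l_ge1 : 1 <= l. Proof. by rewrite /l ler1n. Qed.
Let l_gt0 : 0 < l. Proof. exact: lt_le_trans ltr01 l_ge1. Qed.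
Let N_gt0 : 0 < N. Proof. by rewrite /N ltr0n. Qed.
Let lnP_gt0 : 0 < ln (1 + P). Proof. by rewrite ln_gt0// ltrDl. Qed.
Let P1_gt0 : 0 < P + 1. Proof. exact: addr_gt0. Qed.
Let B_gt0 : 0 < l * E2 + 3 * P ^+ 2.
Proof. by rewrite addr_gt0// mulr_gt0// exprn_gt0. Qed.

Let D : R := (P + 1) * ln (1 + P) * lam.
Let D_gt0 : 0 < D. Proof. by do ![apply: mulr_gt0 => //]. Qed.

Lemma back_off_gt0 : 0 < rho.
Proof.
apply: divr_gt0; last by apply: mulr_gt0 => //; rewrite sqrtr_gt0; do ![apply: mulr_gt0 => //].
by rewrite sqrtr_gt0; do ![apply: mulr_gt0 => //].
Qed.

Lemma back_off_sqr : rho ^+ 2 = D * (l * E2 + 3 * P ^+ 2) / (2 * N * P ^+ 3).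
Proof.
rewrite /rho /back_off expr_div_n exprMn !sqr_sqrtr.
- by rewrite /D; field; rewrite !gt_eqF.
- by apply: ltW; do ![apply: mulr_gt0 => //].
- by apply: ltW; do ![apply: mulr_gt0 => //].
Qed.

Lemma back_off_sqr_le : rho ^+ 2 <= D * (E2 + 3 * P ^+ 2) / (2 * P ^+ 3) * (l / N).
Proof.
have p3 : 0 < 2 * P ^+ 3 by rewrite mulr_gt0// exprn_gt0.
rewrite back_off_sqr.
have -> : D * (l * E2 + 3 * P ^+ 2) / (2 * N * P ^+ 3) = D / (2 * P ^+ 3) / N * (l * E2 + 3 * P ^+ 2).
  by field; rewrite !gt_eqF.
have -> : D * (E2 + 3 * P ^+ 2) / (2 * P ^+ 3) * (l / N) = D / (2 * P ^+ 3) / N * (l * (E2 + 3 * P ^+ 2)).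
  by field; rewrite !gt_eqF.
apply: ler_wpM2l; first by rewrite !divr_ge0// ltW.
rewrite mulrDr lerD2l; apply: ler_peMl => //.
by rewrite mulr_ge0// sqr_ge0.
Qed.

Lemma back_off_sqr_ge : D * E2 / (2 * P ^+ 3) * (l / N) <= rho ^+ 2.
Proof.
have p3 : 0 < 2 * P ^+ 3 by rewrite mulr_gt0// exprn_gt0.
rewrite back_off_sqr.
have -> : D * (l * E2 + 3 * P ^+ 2) / (2 * N * P ^+ 3) = D / (2 * P ^+ 3) / N * (l * E2 + 3 * P ^+ 2).
  by field; rewrite !gt_eqF.
have -> : D * E2 / (2 * P ^+ 3) * (l / N) = D / (2 * P ^+ 3) / N * (l * E2).
  by field; rewrite !gt_eqF.
apply: ler_wpM2l; first by rewrite !divr_ge0// ltW.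
by rewrite lerDl mulr_ge0// sqr_ge0.
Qed.

Definition back_off_lower : R := Num.sqrt (D * E2 / (2 * P ^+ 3)).
Definition back_off_upper : R := Num.sqrt (D * (E2 + 3 * P ^+ 2) / (2 * P ^+ 3)).

Lemma back_off_lower_gt0 : 0 < back_off_lower.
Proof.
rewrite sqrtr_gt0; apply: divr_gt0; apply: mulr_gt0 => //; exact: exprn_gt0.
Qed.

Lemma back_off_upper_gt0 : 0 < back_off_upper.
Proof.
rewrite sqrtr_gt0; apply: divr_gt0; apply: mulr_gt0 => //; last exact: exprn_gt0.
by apply: addr_gt0 => //; apply: mulr_gt0 => //; exact: exprn_gt0.
Qed.

Lemma back_off_ge : back_off_lower * Num.sqrt (l / N) <= rho.
Proof.
have p3 : 0 < 2 * P ^+ 3 by rewrite mulr_gt0// exprn_gt0.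
rewrite /back_off_lower -sqrtrM; last by apply: divr_ge0; [apply: mulr_ge0|]; exact: ltW.
rewrite -[leRHS]ger0_norm; last exact/ltW/back_off_gt0.
by rewrite -sqrtr_sqr; apply: ler_wsqrtr; exact: back_off_sqr_ge.
Qed.

Lemma back_off_le : rho <= back_off_upper * Num.sqrt (l / N).
Proof.
have p3 : 0 < 2 * P ^+ 3 by rewrite mulr_gt0// exprn_gt0.
rewrite /back_off_upper -sqrtrM; last first.
  apply: divr_ge0; [apply: mulr_ge0|]; try exact: ltW.
  by apply: addr_ge0; [exact: ltW|rewrite mulr_ge0// sqr_ge0].
rewrite -[leLHS]ger0_norm; last exact/ltW/back_off_gt0.
by rewrite -sqrtr_sqr; apply: ler_wsqrtr; exact: back_off_sqr_le.
Qed.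

Lemma rate_penalty : Num.sqrt ((l * E2 + 3 * P ^+ 2) * ln (1 + P) * lam / (2 * N * P * (P + 1)))
  = rho * P / (P + 1).
Proof.
have r0 := back_off_gt0.
rewrite -[RHS]ger0_norm; last by apply: divr_ge0; [apply: mulr_ge0|]; exact: ltW.
rewrite -sqrtr_sqr expr_div_n exprMn back_off_sqr; congr Num.sqrt.
by rewrite /D; field; rewrite !gt_eqF.
Qed.

Hypothesis rho_le : rho <= 1 / 5.

Let S : R := (1 - rho) * P.
Let alpha : R := 2 * rho * P / (l * E2 + 3 * S ^+ 2).
Let beta : R := alpha / (1 + 63 * alpha * S).
Let denom : R := l * P * beta + l ^+ 2 * alpha ^+ 2 * E2 / 2.

Let rho_gt0 : 0 < rho. Proof. exact: back_off_gt0. Qed.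
Let rho_lt1 : rho < 1. Proof. apply: (le_lt_trans rho_le); lra. Qed.
Let S_gt0 : 0 < S. Proof. exact: variance_gt0. Qed.
Let S_le : S <= P.
Proof. by rewrite /S mulrBl mul1r gerBl; apply: mulr_ge0; exact: ltW. Qed.
Let den_gt0 : 0 < l * E2 + 3 * S ^+ 2.
Proof. by apply: addr_gt0; apply: mulr_gt0 => //; apply: exprn_gt0. Qed.
Let alpha_gt0 : 0 < alpha.
Proof. by apply: divr_gt0 => //; do ![apply: mulr_gt0 => //]. Qed.
Let bden_gt0 : 0 < 1 + 63 * alpha * S.
Proof. by apply: addr_gt0 => //; do ![apply: mulr_gt0 => //]. Qed.
Let beta_gt0 : 0 < beta. Proof. exact: divr_gt0. Qed.

Variable m : nat.
Hypothesis m_le : m%:R <= lam / denom + 1.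

(* Multiplied by [ln (1 + P) / (2 N)], the first term is half of the rate penalty. *)
Lemma saving_length_le :
  (m * L)%:R <= lam * (l * E2 + 3 * P ^+ 2) / (2 * rho * P ^+ 2) + 63 * lam + l.
Proof.
have d0 : 0 < denom.
  by apply: addr_gt0; [do ![apply: mulr_gt0 => //]|apply: divr_gt0 => //; do ![apply: mulr_gt0 => //]; apply: exprn_gt0].
rewrite natrM -/l.
apply: (@le_trans _ _ ((lam / denom + 1) * l)); first by rewrite ler_pM2r.
rewrite mulrDl mul1r lerD2r.
apply: (@le_trans _ _ (lam / (P * beta))).
  rewrite mulrAC ler_pdivrMr// mulrAC ler_pdivlMr; last exact: mulr_gt0.
  rewrite -!mulrA; apply: ler_wpM2l; first exact: ltW.
  rewrite mulrA lerDl; apply: ltW; apply: divr_gt0 => //; do ![apply: mulr_gt0 => //]; exact: exprn_gt0.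
(* [1 / beta = 1 / alpha + 63 * S]: the correction in [beta] costs only a bounded number of
   instants. *)
have -> : lam / (P * beta) = lam * (l * E2 + 3 * S ^+ 2) / (2 * rho * P ^+ 2) + 63 * lam * (S / P).
  have den'_gt0 : 0 < l * E2 + 3 * S ^+ 2 + 63 * (2 * rho * P) * S.
    by apply: addr_gt0 => //; do ![apply: mulr_gt0 => //].
  rewrite /beta /alpha; field.
  by rewrite !(gt_eqF P_gt0, gt_eqF rho_gt0, gt_eqF den_gt0, gt_eqF den'_gt0).
apply: lerD.
  apply: ler_wpM2r; first by rewrite invr_ge0; apply: ltW; do ![apply: mulr_gt0 => //]; exact: exprn_gt0.
  apply: ler_wpM2l; first exact: ltW.
  rewrite lerD2l; apply: ler_wpM2l => //; apply: lerXn2r => //; rewrite nnegrE; exact: ltW.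
rewrite -[leRHS]mulr1; apply: ler_wpM2l; first by apply: mulr_ge0 => //; exact: ltW.
by rewrite ler_pdivrMr// mul1r.
Qed.

Definition saving_upper : R := lam * P / D * back_off_upper + 63 * lam + 1.

Lemma saving_upper_gt0 : 0 < saving_upper.
Proof.
apply: addr_gt0 => //; apply: addr_gt0; last exact: mulr_gt0.
apply: mulr_gt0; last exact: back_off_upper_gt0.
by apply: divr_gt0 => //; exact: mulr_gt0.
Qed.

Lemma mul_sqrt_ratio : N * Num.sqrt (l / N) = Num.sqrt (N * l).
Proof.
have N0 : N = Num.sqrt (N ^+ 2) by rewrite sqrtr_sqr ger0_norm// ltW.
rewrite {1}N0 -sqrtrM ?sqr_ge0//; congr Num.sqrt; field.
by rewrite gt_eqF.
Qed.

Lemma saving_length_upper : l <= N -> (m * L)%:R <= saving_upper * Num.sqrt (N * l).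
Proof.
move=> lN; apply: (le_trans saving_length_le).
have lsq : l <= Num.sqrt (N * l).
  rewrite -[leLHS]ger0_norm; last exact: ltW.
  by rewrite -sqrtr_sqr; apply: ler_wsqrtr; rewrite expr2 ler_pM2r.
(* The formula for [rho ^+ 2] turns division by [rho] into multiplication, so an upper bound on
   [rho] suffices. *)
have -> : lam * (l * E2 + 3 * P ^+ 2) / (2 * rho * P ^+ 2) = lam * P / D * rho * N.
  have -> : lam * P / D * rho * N = lam * P / D * rho ^+ 2 * N / rho.
    by field; rewrite !(gt_eqF rho_gt0, gt_eqF D_gt0).
  rewrite back_off_sqr; field.
  by rewrite !(gt_eqF rho_gt0, gt_eqF D_gt0, gt_eqF P_gt0, gt_eqF N_gt0).
have -> : saving_upper * Num.sqrt (N * l) = lam * P / D * N * (back_off_upper * Num.sqrt (l / N))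
    + (63 * lam * Num.sqrt (N * l) + Num.sqrt (N * l)).
  by rewrite /saving_upper -mul_sqrt_ratio; ring.
rewrite -addrA; apply: lerD; last first.
  apply: lerD => //; have l1 := l_ge1.
  apply: ler_peMr; last exact: le_trans lsq.
  by apply: mulr_ge0 => //; exact: ltW.
rewrite mulrAC; apply: ler_wpM2l; last exact: back_off_le.
apply: mulr_ge0; last exact: ltW.
by apply: divr_ge0; [apply: mulr_ge0|]; exact: ltW.
Qed.

Lemma saving_length_lower : lam / denom <= m%:R ->
  lam * E2 / (4 * P ^+ 2 * back_off_upper) * Num.sqrt (N * l) <= (m * L)%:R.
Proof.
move=> m_ge.
have u0 := back_off_upper_gt0.
have p2 : 0 < P ^+ 2 by exact: exprn_gt0.
have d0 : 0 < denom by apply: denom_gt0.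
have s0 : 0 < Num.sqrt (l / N) by rewrite sqrtr_gt0; exact: divr_gt0.
have -> : (m * L)%:R = m%:R * l by rewrite natrM.
apply: (@le_trans _ _ (lam / denom * l)); last by apply: ler_wpM2r => //; exact: ltW.
have dle : denom <= 4 * rho * P ^+ 2 / E2.
  apply: (@le_trans _ _ (alpha * l * P * (1 + 1))).
    by apply: saving_rate_le => //; exact: ltW.
  rewrite ler_pdivlMr//.
  have -> : 4 * rho * P ^+ 2 = 2 * rho * P * (2 * P) by ring.
  have -> : alpha * l * P * (1 + 1) * E2 = alpha * (l * E2) * (2 * P) by ring.
  apply: ler_wpM2r; first by apply: mulr_ge0 => //; exact: ltW.
  rewrite /alpha mulrAC ler_pdivrMr//; apply: ler_wpM2l.
    by apply: mulr_ge0; [apply: mulr_ge0 => //|]; exact: ltW.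
  by rewrite lerDl mulr_ge0// sqr_ge0.
apply: (@le_trans _ _ (lam / (4 * (back_off_upper * Num.sqrt (l / N)) * P ^+ 2 / E2) * l)).
  have sE : Num.sqrt (l / N) ^+ 2 = l / N by rewrite sqr_sqrtr// divr_ge0// ltW.
  rewrite -mul_sqrt_ratio; set s := Num.sqrt (l / N) in s0 sE *.
  have -> : lam / (4 * (back_off_upper * s) * P ^+ 2 / E2) * l =
      lam * E2 / (4 * P ^+ 2 * back_off_upper) * (N * (l / N)) / s.
    by field; rewrite !(gt_eqF u0, gt_eqF s0, gt_eqF E2_gt0, gt_eqF P_gt0, gt_eqF N_gt0).
  rewrite -sE le_eqVlt; apply/orP; left; apply/eqP; field.
  by rewrite !(gt_eqF u0, gt_eqF s0, gt_eqF P_gt0).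
apply: ler_wpM2r; first exact: ltW.
apply: ler_wpM2l; first exact: ltW.
rewrite lef_pV2 ?posrE//; last first.
  by apply: divr_gt0 => //; do ![apply: mulr_gt0 => //].
apply: (le_trans dle); apply: ler_wpM2r; first by rewrite invr_ge0 ltW.
apply: ler_wpM2r; first exact: ltW.
by apply: ler_wpM2l => //; exact: back_off_le.
Qed.

(** The first summand collects the rounding of [m] and the correction in [beta], the second the
    quadratic term of [ln (1 - y)]. *)
Definition rate_constant : R :=
  1 / 2 * ln (1 + P) * (1 + 63 * lam) + 1 / 2 * (D * (E2 + 3 * P ^+ 2) / (2 * P ^+ 3)).

Lemma rate_constant_gt0 : 0 < rate_constant.
Proof.
apply: addr_gt0; do ![apply: mulr_gt0 => //].
- by apply: addr_gt0 => //; exact: mulr_gt0.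
- by apply: addr_gt0 => //; apply: mulr_gt0 => //; exact: exprn_gt0.
- by rewrite invr_gt0; apply: mulr_gt0 => //; exact: exprn_gt0.
Qed.

(** With [y = rho * P / (P + 1)], [1 + S] is [(1 + P) * (1 - y)], so the smaller power costs [y / 2]
    to first order; the saving phase costs another [y / 2]. *)
Lemma rate_bound : 1 / 2 * ln (1 + P) - rho * P / (P + 1) - rate_constant * (l / N) <=
  (1 - (m * L)%:R / N) * (1 / 2 * ln (1 + S)).
Proof.
have P10 := P1_gt0; have P0 := P_gt0; have r0 := rho_gt0; have Nn := N_gt0.
set y := rho * P / (P + 1).
have y0 : 0 <= y by apply: divr_ge0; [apply: mulr_ge0|]; exact: ltW.
have y_rho : y <= rho.
  rewrite /y ler_pdivrMr//; apply: ler_wpM2l; first exact: ltW.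
  by rewrite lerDl.
have r5 : rho <= 1 / 5 by exact: rho_le.
have lnS : ln (1 + S) = ln (1 + P) + ln (1 - y).
  rewrite -lnM ?posrE; first by congr ln; rewrite /S /y; field; rewrite gt_eqF.
    by rewrite addr_gt0.
  lra.
have lnS_ge : ln (1 + P) - y - y ^+ 2 <= ln (1 + S).
  have h : 0 <= y <= 2 / 5 by apply/andP; split => //; lra.
  by have := ln1B_ge y h; rewrite lnS; lra.
have lnS_le : ln (1 + S) <= ln (1 + P).
  by rewrite ler_ln ?posrE ?addr_gt0// lerD2l.
have y2 : y ^+ 2 <= D * (E2 + 3 * P ^+ 2) / (2 * P ^+ 3) * (l / N).
  apply: le_trans back_off_sqr_le; apply: lerXn2r => //; rewrite nnegrE; exact: ltW.
have mLN : (m * L)%:R / N * (1 / 2 * ln (1 + P)) <=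
    1 / 2 * y + 1 / 2 * ln (1 + P) * (1 + 63 * lam) * (l / N).
  apply: (@le_trans _ _ ((lam * (l * E2 + 3 * P ^+ 2) / (2 * rho * P ^+ 2) + 63 * lam + l) / N * (1 / 2 * ln (1 + P)))).
    apply: ler_wpM2r; first by apply: mulr_ge0 => //; exact: ltW.
    by rewrite ler_pM2r ?invr_gt0//; exact: saving_length_le.
  (* This equality holds for the optimal [rho], at which the two losses coincide. *)
  have yE : lam * (l * E2 + 3 * P ^+ 2) / (2 * rho * P ^+ 2) / N * (1 / 2 * ln (1 + P)) = 1 / 2 * y.
    have -> : y = rho ^+ 2 * P / (rho * (P + 1)) by rewrite /y; field; rewrite !gt_eqF.
    by rewrite back_off_sqr /D; field; rewrite !gt_eqF.
  set A := lam * _ / _ in yE *.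
  have -> : (A + 63 * lam + l) / N * (1 / 2 * ln (1 + P)) =
    A / N * (1 / 2 * ln (1 + P)) + (63 * lam + l) / N * (1 / 2 * ln (1 + P)) by ring.
  rewrite yE; apply: lerD => //.
  have -> : (63 * lam + l) / N * (1 / 2 * ln (1 + P)) = 1 / 2 * ln (1 + P) / N * (63 * lam + l) by ring.
  have -> : 1 / 2 * ln (1 + P) * (1 + 63 * lam) * (l / N) = 1 / 2 * ln (1 + P) / N * ((1 + 63 * lam) * l) by ring.
  apply: ler_wpM2l; first by apply: divr_ge0; [apply: mulr_ge0|] => //; exact: ltW.
  have : lam <= lam * l by apply: ler_peMr => //; exact: ltW.
  lra.
have mN : (m * L)%:R / N * (1 / 2 * ln (1 + S)) <= (m * L)%:R / N * (1 / 2 * ln (1 + P)).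
  by apply: ler_wpM2l; [apply: divr_ge0 => //; exact: ltW|lra].
rewrite /rate_constant mulrBl mul1r; lra.
Qed.

End rate.

(** * Asymptotics *)

Section asymptotics.
Context {R : realType}.
Implicit Types (a b : R).

Lemma near_expRN_le a b : 0 < a -> 0 < b -> \forall n \near \oo, expR (- (a * n%:R)) <= b.
Proof.
move=> a0 b0; near=> n.
rewrite -[leRHS]lnK ?posrE// ler_expR lerNl mulrC -ler_pdivrMr//.
by near: n; exact: nbhs_infty_ger.
Unshelve. all: by end_near. Qed.

Lemma near_linear_ge a b c : 0 < a ->
  \forall n \near \oo, 0 <= a * n%:R - b * Num.sqrt n%:R + c.
Proof.
move=> a0; near=> n.
pose k := (`|b| + `|c|) / a + 1.
have k0 : 0 <= (`|b| + `|c|) / a by apply: divr_ge0; [exact: addr_ge0|exact: ltW].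
have s1 : k <= Num.sqrt n%:R.
  rewrite -[leLHS]ger0_norm; last exact: addr_ge0.
  rewrite -sqrtr_sqr; apply: ler_wsqrtr.
  by near: n; exact: nbhs_infty_ger.
have n_sqr : n%:R = Num.sqrt n%:R ^+ 2 :> R by rewrite sqr_sqrtr.
rewrite [X in a * X]n_sqr.
set s := Num.sqrt n%:R in s1 *.
have s_ge1 : 1 <= s by apply: le_trans s1; rewrite lerDr.
have s_ge : `|b| + `|c| <= a * s.
  by rewrite mulrC -ler_pdivrMr//; apply: le_trans s1; rewrite lerDl.
have h1 : (`|b| + `|c|) * s <= a * s ^+ 2.
  by rewrite expr2 mulrA ler_pM2r//; exact: lt_le_trans s_ge1.
have h2 : b * s <= `|b| * s by rewrite ler_wpM2r ?ler_norm// (le_trans _ s_ge1).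
have h3 : - c <= `|c| by rewrite -normrN ler_norm.
have h4 : `|c| <= `|c| * s by rewrite ler_peMr.
lra.
Unshelve. all: by end_near. Qed.

Lemma near_sqrt_ratio_le (L : nat -> nat) a : 0 < a ->
  (fun n => (L n)%:R : R^o) =o_\oo (fun n => n%:R : R^o) ->
  \forall n \near \oo, Num.sqrt ((L n)%:R / n%:R) <= a.
Proof.
move=> a0 /eqoP L_o; near=> n.
have n0 : (0 < n)%N by near: n; exact: nbhs_infty_gt.
have : `|(L n)%:R : R^o| <= a ^+ 2 * `|n%:R : R^o|.
  by near: n; apply: L_o; rewrite exprn_gt0.
rewrite !normr_nat => h.
rewrite -[leRHS]ger0_norm; last exact: ltW.
by rewrite -sqrtr_sqr; apply: ler_wsqrtr; rewrite ler_pdivrMr// ltr0n.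
Unshelve. all: by end_near. Qed.

(** [Phi] is continuous at the quantile, and dividing this negative number by a root close to 1
    moves it little towards 0. *)
Lemma Phi_margin (p d : R) : 0 < p < 1 / 2 -> 0 < d ->
  exists2 eta, 0 < eta <= 1 / 10 & Phi (Phi_inv p / Num.sqrt (1 + eta)) <= p + d.
Proof.
move=> p01 d0; set z := Phi_inv p.
have zp : Phi z = p by apply: Phi_invK; lra.
have z0 : z < 0 by exact: Phi_inv_lt0.
have /cvgrPdist_lt/(_ d d0) := @Phi_continuous R z.
move=> [e /= e0 he].
(* 1/10 keeps [eta / 2] within the range of [invsqrt_le_expR]; the other bound keeps the
   displacement, at most [- z * eta], below the radius [e]. *)
pose eta := Num.min (1 / 10) (e / (2 * (1 - z))).
have z1 : 0 < 2 * (1 - z) by lra.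
have eta0 : 0 < eta by rewrite lt_min; apply/andP; split; [lra|exact: divr_gt0].
have eta1 : eta <= 1 / 10 by rewrite ge_min lexx.
have eta2 : eta * (2 * (1 - z)) <= e by rewrite -ler_pdivlMr// ge_min lexx orbT.
exists eta; first by rewrite eta0.
have s1 : 1 <= Num.sqrt (1 + eta).
  by rewrite -[leLHS]sqrtr1 ler_wsqrtr// lerDl ltW.
have s2 : Num.sqrt (1 + eta) ^+ 2 = 1 + eta by rewrite sqr_sqrtr// addr_ge0// ltW.
set s := Num.sqrt (1 + eta) in s1 s2 *.
have s3 : s - 1 <= eta.
  have : 0 <= s * (s - 1) by apply: mulr_ge0; lra.
  by rewrite mulrBr mulr1 -expr2 s2; lra.
have s0 : 0 < s by lra.
have zs : z <= z / s.
  rewrite ler_pdivlMr//.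
  have : 0 <= (- z) * (s - 1) by apply: mulr_ge0; lra.
  lra.
have zse : z / s - z < e.
  apply: (@le_lt_trans _ _ ((- z) * eta)).
    have -> : z / s - z = (- z) * ((s - 1) / s) by field; rewrite gt_eqF.
    apply: ler_wpM2l; first lra.
    rewrite ler_pdivrMr//; apply: (le_trans s3); rewrite ler_peMr//; exact: ltW.
  lra.
have := he (z / s).
rewrite /= => /(_ _)/ltW; rewrite zp => h.
have : `|p - Phi (z / s)| <= d by apply: h; rewrite distrC ger0_norm; lra.
by rewrite ler_norml; lra.
Qed.

(** With tilt [eta / 2] the linear terms cancel, and the quadratic ones leave
    [- 1 / 2 + 5 / 16 = - 3 / 16]. *)
Lemma chernoff_margin (eta : R) (N n : nat) : 0 < eta <= 1 / 10 -> (N <= n)%N ->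
  expR (- (eta / 2 * ((1 + eta) * n%:R))) * (Num.sqrt (1 - eta / 2 * 2))^-1 ^+ N
    <= expR (- (3 / 16 * eta ^+ 2 * n%:R)).
Proof.
move=> /andP[eta0 eta1] Nn.
have h : 0 <= eta / 2 <= 1 / 20 by lra.
have w := invsqrt_le_expR (eta / 2) h.
apply: (@le_trans _ _ (expR (- (eta / 2 * ((1 + eta) * n%:R))) *
    expR (eta / 2 + 5 / 4 * (eta / 2) ^+ 2) ^+ n)).
  apply: ler_wpM2l; first exact: expR_ge0.
  apply: (@le_trans _ _ (expR (eta / 2 + 5 / 4 * (eta / 2) ^+ 2) ^+ N)).
    by apply: lerXn2r; rewrite ?nnegrE ?expR_ge0// invr_ge0 sqrtr_ge0.
  apply: ler_weXn2l => //; rewrite -[leLHS]expR0 ler_expR.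
  apply: addr_ge0; first lra.
  by rewrite mulr_ge0// sqr_ge0.
rewrite -expRM_natl -expRD ler_expR le_eqVlt; apply/orP; left; apply/eqP.
by field.
Qed.

End asymptotics.

(** * The code for a fixed large block length *)

Section code_existence.
Context {R : realType} {d0 : measure_display} {Omega0 : measurableType d0}
  {Pr0 : probability Omega0 R}.
Variables (E : {RV Pr0 >-> R}) (P E2 lam eps eps1 eps2 delta eta : R) (L n m : nat).
Hypothesis E_ge0 : forall omega, 0 <= E omega.
Hypothesis EP : ('E_Pr0[E] = P%:E)%E.
Hypothesis EE2 : ('E_Pr0[(fun omega => E omega ^+ 2)%R] = E2%:E)%E.
Hypothesis P_gt0 : 0 < P.
Hypothesis lam_gt0 : 0 < lam.
Hypothesis L_gt0 : (0 < L)%N.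
Hypothesis n_gt0 : (0 < n)%N.

Let rho : R := back_off P E2 lam L n.
Let S : R := (1 - rho) * P.
Let alpha : R := 2 * rho * P / (L%:R * E2 + 3 * S ^+ 2).
Let beta : R := alpha / (1 + 63 * alpha * S).
Let denom : R := L%:R * P * beta + L%:R ^+ 2 * alpha ^+ 2 * E2 / 2.
Let z : R := Phi_inv eps1.
Let c : R := slack P E2.

Hypothesis rho_le1 : rho <= 1 / 5.
Hypothesis rho_le2 : rho <= E2 / (48 * P ^+ 2).
Hypothesis rho_le3 : rho <= c / 10.
Hypothesis rho_le4 : rho <= lam * E2 * c / (32 * P ^+ 2).
Hypothesis m_ge : lam / denom <= m%:R.
Hypothesis m_le : m%:R <= lam / denom + 1.
Hypothesis saving_le : (m * L)%:R <= n%:R / 2 :> R.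
Hypothesis eps1_bounds : 0 < eps1 < 1 / 2.
Hypothesis delta_gt0 : 0 < delta.
Hypothesis eps2_ge : expR (- ((1 + c / 2) * lam)) <= eps2.
Hypothesis eps_ge : expR (- ((1 + c / 2) * lam)) + eps1 + delta <= eps.
Hypothesis eta_bounds : 0 < eta <= 1 / 10.
Hypothesis Phi_eta : Phi (z / Num.sqrt (1 + eta)) <= eps1 + delta / 4.
Hypothesis n_large1 : expR (- (3 / 16 * eta ^+ 2 * n%:R)) <= delta / 4.
Hypothesis n_large2 : 0 <= 1 / 4 * ln (1 + P / 2) * n%:R
  - Num.sqrt (P / (P + 1)) * - z * Num.sqrt n%:R + ln (delta / 2).

Let E2_gt0 : 0 < E2. Proof. exact: (second_moment_gt0 E P E2 E_ge0 EP EE2). Qed.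
Let rho_gt0 : 0 < rho. Proof. exact: back_off_gt0. Qed.
Let rho_lt1 : rho < 1. Proof. by have := rho_le1; lra. Qed.
Let S_gt0 : 0 < S. Proof. exact: variance_gt0. Qed.
Let z_lt0 : z < 0. Proof. exact: Phi_inv_lt0. Qed.
Let N_gt0 : 0 < n%:R :> R. Proof. by rewrite ltr0n. Qed.
Let c_gt0 : 0 < c. Proof. exact: slack_gt0. Qed.

Let S_ltP : S < P.
Proof. by rewrite /S mulrBl mul1r gtrBl; exact: mulr_gt0. Qed.

Let S_ge : P / 2 <= S.
Proof.
have : rho * P <= 1 / 5 * P by apply: ler_wpM2r => //; exact: ltW.
by rewrite /S mulrBl mul1r; have := P_gt0; lra.
Qed.

Let saving_leq : (m * L <= n)%N.
Proof. by rewrite -(ler_nat R); apply: (le_trans saving_le); have := N_gt0; lra. Qed.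

Let dispersion : R := Num.sqrt (n%:R * (P / (P + 1))).

(** The mean score plus a quantile. The deviation is taken for [n] instants at power [P], which
    overestimates that of [n - m * L] instants at power [S]; as [z < 0], this lowers the threshold
    and is on the safe side for misses. *)
Let lnxi : R := (n - m * L)%:R * (1 / 2 * ln (1 + S)) + dispersion * z.
Let xi : R := expR lnxi.
Let M : nat := Num.truncn (xi * (delta / 2)).

Let xi_gt0 : 0 < xi. Proof. exact: expR_gt0. Qed.
Let delta2_gt0 : 0 < delta / 2. Proof. exact: divr_gt0. Qed.

(** It makes [M] positive and ensures that the truncation loses at most a factor 2, as [M_ge]
    states. *)
Let xi_large : 1 <= xi * (delta / 2).
Proof.
rewrite -[delta / 2]lnK ?posrE// -expRD -[leLHS]expR0 ler_expR.
apply: (le_trans n_large2); rewrite lerD2r /lnxi.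
have -> : dispersion = Num.sqrt (P / (P + 1)) * Num.sqrt n%:R.
  by rewrite /dispersion sqrtrM ?(ltW N_gt0)// mulrC.
have -> : Num.sqrt (P / (P + 1)) * - z * Num.sqrt n%:R =
  - (Num.sqrt (P / (P + 1)) * Num.sqrt n%:R * z) by ring.
rewrite opprK lerD2r natrB//.
have -> : 1 / 4 * ln (1 + P / 2) * n%:R = n%:R / 2 * (1 / 2 * ln (1 + P / 2)) by field.
have P2 : 0 < P / 2 by exact: divr_gt0.
apply: ler_pM.
- by apply: divr_ge0 => //; exact: ltW.
- by apply: mulr_ge0 => //; apply: ln_ge0; rewrite lerDl; exact: ltW.
- by have := saving_le; lra.
- apply: ler_wpM2l => //; rewrite ler_ln ?posrE ?addr_gt0//.
  by rewrite lerD2l.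
Qed.

Let M_gt0 : (0 < M)%N. Proof. by rewrite truncn_gt0. Qed.

Let xi_delta_ge0 : 0 <= xi * (delta / 2).
Proof. exact: le_trans xi_large. Qed.

Let M_le : M%:R <= xi * (delta / 2).
Proof. by have /andP[] := truncn_itv xi_delta_ge0. Qed.

Let M_ge : xi * (delta / 4) <= M%:R.
Proof.
have /andP[_] := truncn_itv xi_delta_ge0; rewrite -/M -[M.+1%:R]natr1 => h.
have : 1 <= M%:R :> R by rewrite ler1n.
lra.
Qed.

Let rate_ge : 1 / 2 * ln (1 + P)
    - Num.sqrt ((L%:R * E2 + 3 * P ^+ 2) * ln (1 + P) * lam / (2 * n%:R * P * (P + 1)))
    + Num.sqrt (P / ((P + 1) * n%:R)) * z
    - (rate_constant P E2 lam + `|ln (delta / 4)|)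
      * Num.max (L%:R `^ (1 / 4) / n%:R `^ (3 / 4)) (L%:R / n%:R) <= ln M%:R / n%:R.
Proof.
have delta4 : 0 < delta / 4 by exact: divr_gt0.
have lnM : lnxi + ln (delta / 4) <= ln M%:R.
  have -> : lnxi + ln (delta / 4) = ln (xi * (delta / 4)).
    by rewrite [RHS]lnM ?posrE// /xi expRK.
  by rewrite ler_ln ?posrE ?mulr_gt0 ?ltr0n.
apply: (@le_trans _ _ ((lnxi + ln (delta / 4)) / n%:R)); last first.
  by rewrite ler_pM2r ?invr_gt0.
have rb := rate_bound P E2 lam L n P_gt0 E2_gt0 lam_gt0 L_gt0 n_gt0 rho_le1 m m_le.
rewrite rate_penalty//.
have lnxiE : lnxi / n%:R = (1 - (m * L)%:R / n%:R) * (1 / 2 * ln (1 + S))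
    + Num.sqrt (P / ((P + 1) * n%:R)) * z.
  have -> : Num.sqrt (P / ((P + 1) * n%:R)) = dispersion / n%:R.
    rewrite -[RHS]ger0_norm; last by apply: divr_ge0; [exact: sqrtr_ge0|exact: ltW].
    rewrite -sqrtr_sqr expr_div_n sqr_sqrtr; last first.
      by apply: mulr_ge0; [exact: ltW|apply: divr_ge0; apply: ltW => //; exact: addr_gt0].
    congr Num.sqrt; field.
    by rewrite !gt_eqF//; exact: addr_gt0.
  by rewrite /lnxi natrB//; field; rewrite gt_eqF.
have k0 := rate_constant_gt0 P E2 lam P_gt0 E2_gt0 lam_gt0.
set kappa := rate_constant P E2 lam + _.
have kappa_ge0 : 0 <= kappa by rewrite addr_ge0// ltW.
(* All remainders are multiples of [L / n] or of [1 / n], which is at most [L / n]. *)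
have max_ge : kappa * (L%:R / n%:R) <= kappa * Num.max (L%:R `^ (1 / 4) / n%:R `^ (3 / 4)) (L%:R / n%:R).
  by apply: ler_wpM2l => //; rewrite le_max lexx orbT.
move: max_ge; have : - ln (delta / 4) / n%:R <= `|ln (delta / 4)| * (L%:R / n%:R).
  rewrite mulrA; apply: ler_wpM2r; first by rewrite invr_ge0 ltW.
  apply: (@le_trans _ _ `|ln (delta / 4)|); first by rewrite -normrN ler_norm.
  by apply: ler_peMr => //; rewrite ler1n.
have -> : (lnxi + ln (delta / 4)) / n%:R = lnxi / n%:R + ln (delta / 4) / n%:R by rewrite mulrDl.
have kappaE : kappa * (L%:R / n%:R) =
  rate_constant P E2 lam * (L%:R / n%:R) + `|ln (delta / 4)| * (L%:R / n%:R) by rewrite mulrDl.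
rewrite lnxiE mulNr.
move: rb kappaE; rewrite -/rho -/S; lra.
Qed.

Section code_ensemble.
Context {d : measure_display} {Omega : measurableType d} {Pr : probability Omega R}.
Variable X : ensemble E n M L S Pr.

Let overdraft_le w : (Pr (overdraft_event X m w) <= (expR (- ((1 + c / 2) * lam)))%:E)%E.
Proof.
have decay := initial_decay P E2 lam L rho P_gt0 E2_gt0 L_gt0 rho_gt0 rho_lt1 rho_le3 rho_le4 m m_ge.
have m_gt0 := save_blocks_gt0 P E2 lam L rho P_gt0 E2_gt0 L_gt0 rho_gt0 rho_lt1 rho_le4 m m_ge.
apply: (@le_trans _ _ ((block_decay P E2 L rho ^+ m.-1)%:E)); last by rewrite lee_fin.
have alpha_gt0 : 0 < alpha.
  apply: divr_gt0; first by do ![apply: mulr_gt0 => //].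
  apply: addr_gt0; apply: mulr_gt0 => //; first by rewrite ltr0n.
  exact: exprn_gt0.
have th_gt0 : 0 < (1 + c) * alpha by apply: mulr_gt0 => //; exact: addr_gt0.
apply: (overdraft_probability_le X L_gt0 E_ge0 m w ((1 + c) * alpha)) => //.
- exact: tilt_le.
- apply: (le_trans (integral_expRN_le E P E2 E_ge0 EP EE2 ((1 + c) * alpha * L%:R) _)).
    by apply: mulr_ge0 => //; exact: ltW.
  by rewrite lee_fin; exact: block_decay_ge.
- exact: block_drift.
Qed.

(** One quarter of [delta] pays for a sum of squares above [(1 + eta) * n], another for the division
    of [z] by [Num.sqrt (1 + eta)]. *)
Let missed_le w : (Pr (missed_event X m xi w) <= (eps1 + delta / 2)%:E)%E.
Proof.
have /andP[eta0 eta1] := eta_bounds.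
have P1 : 0 < P + 1 by exact: addr_gt0.
have S1 : 0 < 1 + S by exact: addr_gt0.
have r_gt0 : 0 < (1 + eta) * n%:R by apply: mulr_gt0 => //; exact: addr_gt0.
have SS_gt0 : 0 < S / (1 + S) by exact: divr_gt0.
have PP_gt0 : 0 < P / (P + 1) by exact: divr_gt0.
have cE : (ln xi - (size (@active n L m))%:R * (1 / 2 * ln (1 + S))) / Num.sqrt (S / (1 + S)) =
    dispersion * z / Num.sqrt (S / (1 + S)).
  by rewrite size_active /xi expRK /lnxi addrAC subrr add0r.
have disp_gt0 : 0 < dispersion by rewrite sqrtr_gt0; exact: mulr_gt0.
have eta2_ge0 : 0 <= eta / 2 by lra.
have eta2_lt1 : eta / 2 * 2 < 1 by lra.
have c_lt0 : dispersion * z / Num.sqrt (S / (1 + S)) < 0.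
  by rewrite pmulr_llt0 ?invr_gt0 ?sqrtr_gt0// pmulr_rlt0.
have missed := missed_probability_le X S_gt0 m xi w (eta / 2) ((1 + eta) * n%:R) eta2_ge0 eta2_lt1 r_gt0.
rewrite /= cE in missed.
apply: (le_trans (missed c_lt0)); rewrite lee_fin.
have -> : eps1 + delta / 2 = delta / 4 + (eps1 + delta / 4) by field.
apply: lerD.
  apply: le_trans n_large1; apply: chernoff_margin => //.
  by rewrite size_active leq_subr.
apply: le_trans Phi_eta; apply: Phi_nondecreasing.
have -> : dispersion = Num.sqrt n%:R * Num.sqrt (P / (P + 1)).
  by rewrite /dispersion sqrtrM// ltW.
have -> : Num.sqrt ((1 + eta) * n%:R) = Num.sqrt (1 + eta) * Num.sqrt n%:R.
  by rewrite sqrtrM// addr_ge0// ltW.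
have N'_gt0 : 0 < Num.sqrt n%:R :> R by rewrite sqrtr_gt0.
have e_gt0 : 0 < Num.sqrt (1 + eta) by rewrite sqrtr_gt0 addr_gt0.
have b_gt0 : 0 < Num.sqrt (S / (1 + S)) by rewrite sqrtr_gt0.
have ba : Num.sqrt (S / (1 + S)) <= Num.sqrt (P / (P + 1)).
  apply: ler_wsqrtr; rewrite ler_pdivrMr// mulrAC ler_pdivlMr//.
  by have := S_ltP; lra.
set b := Num.sqrt (S / (1 + S)) in b_gt0 ba *.
set a := Num.sqrt (P / (P + 1)) in ba *.
have -> : Num.sqrt n%:R * a * z / b / (Num.sqrt (1 + eta) * Num.sqrt n%:R) =
    z / Num.sqrt (1 + eta) * (a / b).
  by field; rewrite !(gt_eqF N'_gt0, gt_eqF e_gt0, gt_eqF b_gt0).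
(* [a / b >= 1] because [S < P]; it multiplies a negative number and so only decreases the argument
   of [Phi]. *)
rewrite -[leRHS]mulr1 ler_wnM2l//; last by rewrite ler_pdivlMr// mul1r.
by rewrite pmulr_lle0 ?invr_gt0// ltW.
Qed.

Lemma code_reliable :
  is_save_and_transmit_code X m xi eps /\ (Pr (mismatch X m) <= eps2%:E)%E.
Proof.
split.
  apply: (save_and_transmit_reliable X L_gt0 M_gt0 E_ge0 m xi
    (expR (- ((1 + c / 2) * lam))) (eps1 + delta / 2) (delta / 2)) => //.
  - by have := eps1_bounds; have := delta_gt0; lra.
  - by rewrite ler_pdivrMr// mulrC; exact: M_le.
  - by have := eps_ge; lra.
apply: (mismatch_probability_le X L_gt0 M_gt0 E_ge0).
  by apply: le_trans eps2_ge; exact: expR_ge0.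
by move=> w; apply: (le_trans (overdraft_le w)); rewrite lee_fin.
Qed.

End code_ensemble.

Lemma code_exists : exists (M : nat) (xi : R),
  [/\ (0 < M)%N, 0 < S < P, 0 < xi,
    1 / 2 * ln (1 + P)
    - Num.sqrt ((L%:R * E2 + 3 * P ^+ 2) * ln (1 + P) * lam / (2 * n%:R * P * (P + 1)))
    + Num.sqrt (P / ((P + 1) * n%:R)) * Phi_inv eps1
    - (rate_constant P E2 lam + `|ln (delta / 4)|)
      * Num.max (L%:R `^ (1 / 4) / n%:R `^ (3 / 4)) (L%:R / n%:R) <= ln M%:R / n%:R &
    forall (d : measure_display) (Omega : measurableType d) (Pr : probability Omega R)
      (X : ensemble E n M L S Pr),
      is_save_and_transmit_code X m xi eps /\ (Pr (mismatch X m) <= eps2%:E)%E].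
Proof.
exists M, xi; split => //; first by rewrite S_gt0.
by move=> d Omega Pr X; exact: code_reliable.
Qed.

End code_existence.

Lemma absz_ceil_bounds {R : realType} (x : R) : 0 <= x ->
  x <= `|Num.ceil x|%N%:R <= x + 1.
Proof.
move=> x0; have c0 : 0 <= Num.ceil x by rewrite ceil_ge0; lra.
have -> : `|Num.ceil x|%N%:R = (Num.ceil x)%:~R :> R.
  by rewrite -{2}(gez0_abs c0).
have /andP[h1 h2] := ceil_itv x; rewrite h2/=.
by move: h1; rewrite intrB; lra.
Qed.

Lemma eqTheta_near {R : realType} (f g : nat -> R) (k1 k2 : R) : 0 < k1 -> 0 < k2 ->
  (\forall n \near \oo, 0 <= g n) -> (\forall n \near \oo, k1 * g n <= f n <= k2 * g n) ->
  (f : nat -> R^o) =Theta_\oo (g : nat -> R^o).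
Proof.
move=> k10 k20 g0 fg; rewrite eqThetaE; apply/asboolP.
exists (k1, k2) => /=; first by rewrite k10.
near=> n.
have gn : 0 <= g n by near: n.
have /andP[h1 h2] : k1 * g n <= f n <= k2 * g n by near: n.
have fn : 0 <= f n by apply: le_trans h1; rewrite mulr_ge0// ltW.
by rewrite !ger0_norm.
Unshelve. all: by end_near. Qed.

Theorem corollary8 (R : realType)
    (d0 : measure_display) (Omega0 : measurableType d0)
    (Pr0 : probability Omega0 R) (E : {RV Pr0 >-> R}) (P E2 : R)
    (E_ge0 : forall omega, 0 <= E omega)
    (EP : ('E_Pr0[E] = P%:E)%E) (P_gt0 : 0 < P)
    (EE2 : ('E_Pr0[(fun omega => E omega ^+ 2)%R] = E2%:E)%E)
    (L : nat -> nat) (L_gt0 : forall n, (0 < L n)%N)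
    (L_o : (fun n => (L n)%:R : R^o) =o_\oo (fun n => n%:R : R^o))
    (eps eps1 eps2 : R) (eps_bounds : 0 < eps < 1 / 2)
    (eps1_gt0 : 0 < eps1) (eps2_gt0 : 0 < eps2) (eps12 : eps1 + eps2 = eps) :
  let rho n : R :=
    Num.sqrt ((P + 1) * ((L n)%:R * E2 + 3 * P ^+ 2) * ln (1 + P) * ln (1 / eps2))
      / (P * Num.sqrt (2 * n%:R * P)) in
  let S n : R := (1 - rho n) * P in
  let alpha n : R := 2 * rho n * P / ((L n)%:R * E2 + 3 * S n ^+ 2) in
  let beta n : R := alpha n / (1 + 63 * alpha n * S n) in
  (* the quantity rounded up is positive for large n, where absz is harmless *)
  let m n : nat :=
    `|Num.ceil (ln (1 / eps2) /
        ((L n)%:R * P * beta n + (L n)%:R ^+ 2 * alpha n ^+ 2 * E2 / 2))|%N in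
  [/\ (rho : nat -> R^o) =Theta_\oo (fun n => Num.sqrt ((L n)%:R / n%:R) : R^o),
      (fun n => (m n * L n)%:R : R^o) =Theta_\oo
        (fun n => Num.sqrt (n%:R * (L n)%:R) : R^o) &
      exists2 kappa : R, 0 < kappa &
      \forall n \near \oo, exists (M : nat) (xi : R),
        [/\ (0 < M)%N, 0 < S n < P, 0 < xi,
            ln M%:R / n%:R >=
              1 / 2 * ln (1 + P)
              - Num.sqrt (((L n)%:R * E2 + 3 * P ^+ 2) * ln (1 + P) * ln (1 / eps2)
                          / (2 * n%:R * P * (P + 1)))
              + Num.sqrt (P / ((P + 1) * n%:R)) * Phi_inv eps1
              - kappa * Num.max ((L n)%:R `^ (1 / 4) / n%:R `^ (3 / 4))
                                ((L n)%:R / n%:R) &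
            forall (d : measure_display) (Omega : measurableType d)
                   (Pr : probability Omega R)
                   (X : ensemble E n M (L n) (S n) Pr),
              is_save_and_transmit_code X (m n) xi eps /\
              (Pr (mismatch X (m n)) <= eps2%:E)%E] ].
Proof.
have /andP[eps0 eps_half] := eps_bounds.
have E2_gt0 := second_moment_gt0 E P E2 E_ge0 EP EE2 P_gt0.
move=> rho S alpha beta m.
pose lam : R := ln (1 / eps2).
have eps2E : expR (- lam) = eps2.
  by rewrite /lam div1r lnV ?posrE// opprK lnK ?posrE.
have lam_gt0 : 0 < lam.
  by rewrite /lam ln_gt0// ltr_pdivlMr// mul1r; move: eps1_gt0; lra.
have ub0 := back_off_upper_gt0 P E2 lam P_gt0 E2_gt0 lam_gt0.
have rho_gt0 n : (0 < n)%N -> 0 < rho n.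
  by move=> n0; exact: (back_off_gt0 P E2 lam (L n) n).
have near_rho r : 0 < r -> \forall n \near \oo, rho n <= r.
  move=> r0; near=> n.
  have n0 : (0 < n)%N by near: n; exact: nbhs_infty_gt.
  apply: (le_trans (back_off_le P E2 lam (L n) n P_gt0 E2_gt0 lam_gt0 (L_gt0 n) n0)).
  rewrite mulrC -ler_pdivlMr//.
  by near: n; apply: near_sqrt_ratio_le => //; exact: divr_gt0.
have m_bounds n : (0 < n)%N -> rho n < 1 ->
    lam / ((L n)%:R * P * beta n + (L n)%:R ^+ 2 * alpha n ^+ 2 * E2 / 2) <= (m n)%:R
      <= lam / ((L n)%:R * P * beta n + (L n)%:R ^+ 2 * alpha n ^+ 2 * E2 / 2) + 1.
  move=> n0 rho_lt1; apply: absz_ceil_bounds; apply: divr_ge0; first exact: ltW.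
  by apply/ltW/denom_gt0 => //; exact: rho_gt0.
have near_L_le : \forall n \near \oo, (L n)%:R <= n%:R :> R.
  near=> n; have n0 : (0 < n)%N by near: n; exact: nbhs_infty_gt.
  have : Num.sqrt ((L n)%:R / n%:R) <= 1 :> R.
    by near: n; exact: near_sqrt_ratio_le.
  by rewrite -[leRHS]sqrtr1 ler_sqrt// ler_pdivrMr ?ltr0n// mul1r.
have r5 : 0 < 1 / 5 :> R by exact: divr_gt0.
have su0 := saving_upper_gt0 P E2 lam P_gt0 E2_gt0 lam_gt0.
have mL_upper : \forall n \near \oo,
    (m n * L n)%:R <= saving_upper P E2 lam * Num.sqrt (n%:R * (L n)%:R).
  near=> n; have n0 : (0 < n)%N by near: n; exact: nbhs_infty_gt.
  have rho5 : rho n <= 1 / 5 by near: n; exact: near_rho.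
  have rho_lt1 : rho n < 1 by lra.
  apply: saving_length_upper => //; last by near: n.
  by have /andP[] := m_bounds n n0 rho_lt1.
split.
- apply: (eqTheta_near _ _ (back_off_lower P E2 lam) (back_off_upper P E2 lam)) => //.
  + exact: back_off_lower_gt0.
  + by near=> n; exact: sqrtr_ge0.
  + near=> n; have n0 : (0 < n)%N by near: n; exact: nbhs_infty_gt.
    by apply/andP; split; [exact: back_off_ge|exact: back_off_le].
- apply: (eqTheta_near _ _ (lam * E2 / (4 * P ^+ 2 * back_off_upper P E2 lam)) (saving_upper P E2 lam)).
  + apply: divr_gt0; first exact: mulr_gt0.
    by apply: mulr_gt0 => //; apply: mulr_gt0 => //; exact: exprn_gt0.
  + exact: su0.
  + by near=> n; exact: sqrtr_ge0.
  + near=> n; have n0 : (0 < n)%N by near: n; exact: nbhs_infty_gt.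
    have rho5 : rho n <= 1 / 5 by near: n; exact: near_rho.
    have rho_lt1 : rho n < 1 by lra.
    apply/andP; split; last by near: n.
    apply: saving_length_lower => //.
    by have /andP[] := m_bounds n n0 rho_lt1.
have c_gt0 := slack_gt0 P E2 P_gt0 E2_gt0.
set c := slack P E2 in c_gt0.
(* The part of [eps2] that the improved overdraft bound leaves free; it depends on [P], [E2] and
   [eps2] but not on [n]. *)
pose delta := eps2 - expR (- ((1 + c / 2) * lam)).
have delta_gt0 : 0 < delta.
  by rewrite /delta subr_gt0 -eps2E ltr_expR ltrN2 ltr_pMl// ltrDl divr_gt0.
have eps1_half : 0 < eps1 < 1 / 2 by apply/andP; split=> //; move: eps2_gt0; lra.
have delta4 : 0 < delta / 4 by exact: divr_gt0.
have [eta eta_bounds Phi_eta] := Phi_margin eps1 (delta / 4) eps1_half delta4.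
have /andP[eta0 _] := eta_bounds.
(* The logarithm accounts for [M >= xi * (delta / 4)]. *)
exists (rate_constant P E2 lam + `|ln (delta / 4)|).
  by apply: ltr_wpDr => //; exact: rate_constant_gt0.
near=> n; have n0 : (0 < n)%N by near: n; exact: nbhs_infty_gt.
have rho5 : rho n <= 1 / 5 by near: n; exact: near_rho.
have rho_lt1 : rho n < 1 by lra.
have /andP[m_ge m_le] := m_bounds n n0 rho_lt1.
apply: (code_exists E P E2 lam eps eps1 eps2 delta eta (L n) n (m n)) => //.
- by near: n; apply: near_rho; apply: divr_gt0 => //; apply: mulr_gt0 => //; exact: exprn_gt0.
- by near: n; apply: near_rho; exact: divr_gt0.
- near: n; apply: near_rho; apply: divr_gt0; first by do ![apply: mulr_gt0 => //].
  by apply: mulr_gt0 => //; exact: exprn_gt0.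
- have saving_n : (m n * L n)%:R <= saving_upper P E2 lam * Num.sqrt (n%:R * (L n)%:R) :> R.
    by near: n.
  apply: (le_trans saving_n).
  (* The saving length is at most a constant times [n * Num.sqrt (L / n)], and this root tends to
     0. *)
  rewrite -mul_sqrt_ratio// mulrCA; apply: ler_wpM2l => //.
  rewrite mulrC -ler_pdivlMr//.
  by near: n; apply: near_sqrt_ratio_le => //; apply: divr_gt0.
- by rewrite -subr_ge0 ltW.
- by move: eps12; rewrite /delta -/c; lra.
- near: n; apply: near_expRN_le => //.
  by apply: mulr_gt0; [lra|exact: exprn_gt0].
- near: n; apply: near_linear_ge; apply: mulr_gt0; first lra.
  by rewrite ln_gt0// ltrDl divr_gt0.
Unshelve. all: by end_near.
Qed.
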